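(* For any integer $h\geq 1$ there exist a field $K$, a standard graded polynomial ring $S$ in finitely many variables over $K$, and a homogeneous prime ideal $\mathfrak{p}(h)\subseteq S$ of height $h$ such that $$\beta_{i,i+2}(\mathfrak{p}(h))=\binom{2h}{i+2}-2\binom{h}{i+2}$$ for all integers $i\geq 0$. In particular, the upper bounds $\beta_{i,i+2}(I)\le \binom{2h}{i+2}-2\binom{h}{i+2}$, valid for all $i\ge 0$ and every homogeneous unmixed radical ideal $I$ of height $h$ in a standard graded polynomial ring over a field, are sharp, and all of them are attained simultaneously by a prime ideal.
   Context: A polynomial ring $S=K[x_1,\ldots,x_N]$ is standard graded if $\deg(x_i)=1$ for all $i$. For a finitely generated $\mathbb{Z}$-graded $S$-module $M$, $\beta_{i,j}(M)=\dim_K \operatorname{Tor}_i^S(M,K)_j$ denotes its $(i,j)$-th graded Betti number. An ideal $I\subsetneq S$ is unmixed if $\dim(S/I)=\dim(S/\mathfrak{p})$ for every $\mathfrak{p}\in\operatorname{Ass}(S/I)$. Binomial coefficients satisfy $\binom{a}{b}=0$ whenever $a<b$ or $a<0$ or $b<0$, and $\binom{a}{0}=1$ for $a\ge 0$. *)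

(* Defs.v *)
From mathcomp Require Import all_boot all_order all_algebra.
From mathcomp Require Export mpoly.
From Stdlib Require Import ClassicalEpsilon.

Set Implicit Arguments.
Unset Strict Implicit.
Unset Printing Implicit Defensive.

Import GRing.Theory.
Local Open Scope ring_scope.

(** Ideals are predicates closed under [idealr_closed]; MathComp's
    [idealr_closed] includes properness ([1 \notin I]). *)
Section Ideals.
Variable R : comNzRingType.
Implicit Types (I p : {pred R}) (c : nat -> {pred R}).

Definition prime_ideal p : Prop := idealr_closed p /\ prime_idealr_closed p.

Definition radical_ideal I : Prop :=
  forall (f : R) (n : nat), f ^+ n \in I -> f \in I.

(** [c 0 < c 1 < ... < c n]: a chain of primes of length [n]
    (the values of [c] beyond [n] are irrelevant). *)
Definition prime_chain (n : nat) c : Prop :=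
  (forall k, (k <= n)%N -> prime_ideal (c k)) /\
  (forall k, (k < n)%N -> {subset c k <= c k.+1} /\ ~ {subset c k.+1 <= c k}).

(** The Krull dimension of [R / I] is [d]: primes of [R / I] are the primes of
    [R] containing [I]. *)
Definition quotient_dim I (d : nat) : Prop :=
  (exists2 c, prime_chain d c & {subset I <= c 0%N}) /\
  (forall n c, prime_chain n c -> {subset I <= c 0%N} -> (n <= d)%N).

Definition prime_height p (h : nat) : Prop :=
  (exists2 c, prime_chain h c & c h =i p) /\
  (forall n c, prime_chain n c -> c n =i p -> (n <= h)%N).

(** The height of an ideal: the minimum of the heights of the primes
    containing it. *)
Definition height I (h : nat) : Prop :=
  (exists p, [/\ prime_ideal p, {subset I <= p} & prime_height p h]) /\
  (forall p n, prime_ideal p -> {subset I <= p} -> prime_height p n ->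
     (h <= n)%N).

(** [p] is in Ass(R / I): a prime that is the annihilator of the class of
    some [f]. *)
Definition associated_prime I p : Prop :=
  prime_ideal p /\ exists f : R, forall g : R, (g \in p) = (g * f \in I).

Definition unmixed I : Prop :=
  forall p, associated_prime I p ->
  forall d, quotient_dim I d <-> quotient_dim p d.

End Ideals.

Section Graded.
Variables (K : fieldType) (N : nat).
Local Notation S := {mpoly K[N]}.
Implicit Type I : {pred S}.

Definition homogeneous_ideal I : Prop :=
  forall (f : S) (d : nat), f \in I -> pihomog mdeg d f \in I.

(** A graded free resolution
      ... -> F_1 -> F_0 -> I -> 0,   F_i = \bigoplus_k S(- shift i k),
    of the [S]-module [I] by free modules of finite rank.  Elements of [F_i] are
    row vectors and maps act by right multiplication.  The conditions
    [aug_homog] and [diff_homog] say that the maps preserve degrees. *)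
Record graded_resolution I := GradedResolution {
  rk : nat -> nat;
  shift : forall i, 'I_(rk i) -> int;
  aug : 'cV[S]_(rk 0);
  diff : forall i, 'M[S]_(rk i.+1, rk i);
  aug_homog : forall k (m : 'X_{1..N}),
    m \in msupp (aug k 0) -> (mdeg m)%:Z = shift k;
  diff_homog : forall i k l (m : 'X_{1..N}),
    m \in msupp (diff i k l) -> (mdeg m)%:Z + shift l = shift k;
  aug_image : forall f : S,
    f \in I <-> exists v : 'rV_(rk 0), f = (v *m aug) 0 0;
  exact_aug : forall v : 'rV_(rk 0),
    v *m aug = 0 <-> exists w : 'rV_(rk 1), v = w *m diff 0;
  exact_diff : forall i (v : 'rV_(rk i.+1)),
    v *m diff i = 0 <-> exists w : 'rV_(rk i.+2), v = w *m diff i.+1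
}.

Arguments rk {I} F i : rename.
Arguments shift {I} F i k : rename.
Arguments aug {I} F : rename.
Arguments diff {I} F i : rename.

Section TensorResidueField.
Variables (I : {pred S}) (F : graded_resolution I).

(** [F_i \otimes_S K] is [K^(rk i)], where [K = S / (x_1, ..., x_N)]; on
    matrices, [- \otimes_S K] takes constant coefficients. *)
Definition diffK i : 'M[K]_(rk F i.+1, rk F i) :=
  map_mx (mcoeff 0%MM) (diff F i).

(** Subspaces are row spaces.  The degree [j] component of [F_i \otimes K] is
    spanned by the basis vectors of degree [j]. *)
Definition degree_part i (j : int) : 'M[K]_(rk F i) :=
  diag_mx (\row_k (shift F i k == j)%:R).

Definition cycles i (j : int) : 'M[K]_(rk F i) :=
  match i return 'M[K]_(rk F i) with
  | 0%N => degree_part 0 j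
  | i'.+1 => (degree_part i'.+1 j :&: kermx (diffK i'))%MS
  end.

Definition boundaries i (j : int) : 'M[K]_(rk F i) :=
  (degree_part i j :&: diffK i)%MS.

(** dim_K H_i(F \otimes_S K)_j *)
Definition tor_dim i (j : int) : nat :=
  (\rank (cycles i j) - \rank (boundaries i j))%N.

End TensorResidueField.

(** beta_{i,j}(I) = dim_K Tor_i^S(I, K)_j, computed from some graded free
    resolution of the module [I] (the value does not depend on which). *)
Definition betti I (i : nat) (j : int) : nat :=
  epsilon (inhabits 0%N)
    (fun b => exists F : graded_resolution I, b = tor_dim F i j).

End Graded.

(* Main.v *)
Require Import Defs.
From HB Require Import structures.
From mathcomp Require Import all_boot all_order all_algebra.
From mathcomp Require Import algC.
From mathcomp Require Import ring zify.
From mathcomp Require boolp classical_sets.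
From Stdlib Require ClassicalEpsilon.

Set Implicit Arguments.
Unset Strict Implicit.
Unset Printing Implicit Defensive.

(** The upper bound. Let [I] be a radical unmixed ideal of height [h] in
    [S = K[x_0, ..., x_(N-1)]]. Shifting degrees along a free resolution turns
    [beta_(i,i+2)(I)] into the dimension of the Koszul cycles in
    [Lambda^i (x) I_2] modulo the boundaries of [Lambda^(i+1) (x) I_1]
    ([tor_dim_koszul]), so that only the linear forms and the quadrics of [I]
    matter. As [I] is the intersection of its associated primes, these are the
    linear forms and quadrics that vanish at a family of generic points; as [I]
    is unmixed, each point has transcendence degree at least [N - h]
    ([exists_associated], [associated_trdeg]).

    The variables are then eliminated one by one. Restricting cycles to a
    hyperplane [ell = 0] loses at most [g * 'C(n, i)] dimensions, where [g]
    counts, modulo the linear forms of [I], the linear forms [u] for which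
    [ell * u] is a quadric of [I] ([qdim_le_elim]). As long as the points have
    positive transcendence degree, [ell] is the generic hyperplane
    [sum_i t_i x_i], over the field [K(t)]. No point lies on it, so [u] vanishes
    at all points, and [g = 0] when every such form belongs to [I]. A generic
    section can acquire new linear forms: on the section of a point [xi] such a
    form satisfies [u(xi) = c lam(xi)], where [lam(xi) = sum_i t_i xi_i], and
    differentiation in [t] shows that multiplication by [c] maps the span of the
    coordinates of the section to itself ([spanned_section]). This multiplier is
    not a scalar, for otherwise a form of degree one in [xi] would be divisible
    by [lam(xi)^2], which a Dedekind-Mertens argument excludes
    ([divisible_by_lam_power]). Multipliers survive further sections, and a
    nonscalar multiplier doubles the number of independent linear forms: in [n]
    variables and transcendence degree [d] the forms vanishing at the points
    have dimension at most [n - 2 d = 2 h - n] ([multiplier_rank]). After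
    [N - h] sections [h] variables are left, and for these the trivial bound by
    the number of variables suffices ([homog_bound]). The sum of all
    contributions is ['C(2 h, i + 2) - 2 'C(h, i + 2)] ([strand_bound_double]).

    Sharpness. Over the rationals let [p] be the ideal of the generic point
    [(i t_1, t_1, ..., i t_h, t_h)], with [i] the imaginary unit. It contains no
    linear form. Write [y = J x] for the linear forms with
    [y_(2k) = - x_(2k+1)] and [y_(2k+1) = x_(2k)]; at the point, [y = i x]. For a
    constant form [eta] in [Lambda^(i+2)], contraction with [y] and then with [x]
    gives a cycle, whose coefficients are quadrics of [p] because contracting
    twice with [x] gives zero. The cycle vanishes only if [eta] is of pure type
    [(i+2, 0) + (0, i+2)] for the complex structure [J], and such forms have
    dimension at most [2 'C(h, i + 2)] ([pure_bound]). *)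

Import Order.TTheory GRing.Theory.
Local Open Scope ring_scope.

(** * Codimension of one predicate in another *)

Definition subspace (K : fieldType) (V : lmodType K) (P : V -> Prop) : Prop :=
  P 0 /\ forall (a : K) (u v : V), P u -> P v -> P (a *: u + v).

Lemma subspace0 (K : fieldType) (V : lmodType K) (P : V -> Prop) :
  subspace P -> P 0.
Proof. by case. Qed.

Lemma subspaceD (K : fieldType) (V : lmodType K) (P : V -> Prop) u v :
  subspace P -> P u -> P v -> P (u + v).
Proof. by case=> _ h Pu Pv; rewrite -[u]scale1r; apply: h. Qed.

Lemma subspaceZ (K : fieldType) (V : lmodType K) (P : V -> Prop) a u :
  subspace P -> P u -> P (a *: u).
Proof. by case=> h0 h Pu; rewrite -[_ *: _]addr0; apply: h. Qed.

Lemma subspaceN (K : fieldType) (V : lmodType K) (P : V -> Prop) u :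
  subspace P -> P u -> P (- u).
Proof. by move=> h Pu; rewrite -scaleN1r; apply: (subspaceZ _ h). Qed.

Lemma subspaceB (K : fieldType) (V : lmodType K) (P : V -> Prop) u v :
  subspace P -> P u -> P v -> P (u - v).
Proof. by move=> h Pu Pv; apply: subspaceD => //; apply: subspaceN. Qed.

Lemma subspace_sum (K : fieldType) (V : lmodType K) (P : V -> Prop)
    (I : Type) (r : seq I) (Q : pred I) (F : I -> V) :
  subspace P -> (forall i, Q i -> P (F i)) -> P (\sum_(i <- r | Q i) F i).
Proof.
move=> h hF; elim/big_ind: _ => //; first exact: subspace0 h.
by move=> u v; apply: subspaceD.
Qed.

Section Linear.
Variables (K : fieldType) (V W : lmodType K) (f : V -> W).
Hypothesis fL : linear f.
Lemma linD u v : f (u + v) = f u + f v.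
Proof. by rewrite -[u]scale1r fL !scale1r. Qed.
Lemma lin0 : f 0 = 0.
Proof. by have := fL (-1) 0 0; rewrite scaler0 addr0 scaleN1r addNr. Qed.
Lemma linZ a u : f (a *: u) = a *: f u.
Proof. by rewrite -[a *: u]addr0 fL lin0 addr0. Qed.
Lemma linN u : f (- u) = - f u.
Proof. by rewrite -scaleN1r linZ scaleN1r. Qed.
Lemma linB u v : f (u - v) = f u - f v.
Proof. by rewrite linD linN. Qed.
Lemma lin_sum (I : Type) (r : seq I) (Q : pred I) (F : I -> V) :
  f (\sum_(i <- r | Q i) F i) = \sum_(i <- r | Q i) f (F i).
Proof. exact: (big_morph f linD lin0). Qed.
End Linear.

Definition comb (K : fieldType) (V : lmodType K) m (c : 'rV[K]_m)
    (z : 'I_m -> V) : V := \sum_k c 0 k *: z k.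

Lemma comb_subspace (K : fieldType) (V : lmodType K) (P : V -> Prop) m
    (c : 'rV[K]_m) (z : 'I_m -> V) :
  subspace P -> (forall k, P (z k)) -> P (comb c z).
Proof.
move=> h hz; rewrite /comb; apply: (subspace_sum (P := P)) => // k _.
by apply: (subspaceZ _ h).
Qed.

Lemma comb_linear (K : fieldType) (V W : lmodType K) (f : V -> W) m
    (c : 'rV[K]_m) (z : 'I_m -> V) :
  linear f -> f (comb c z) = comb c (f \o z).
Proof.
move=> lf; rewrite /comb (lin_sum lf); apply: eq_bigr => k _.
exact: (linZ lf).
Qed.

Lemma comb_mulmx (K : fieldType) (V : lmodType K) m p (c : 'rV[K]_p)
    (A : 'M[K]_(p, m)) (z : 'I_m -> V) :
  comb (c *m A) z = comb c (fun k => comb (row k A) z).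
Proof.
rewrite /comb; under eq_bigr do rewrite mxE scaler_suml.
rewrite exchange_big /=; apply: eq_bigr => k _.
by rewrite scaler_sumr; apply: eq_bigr => j _; rewrite mxE scalerA.
Qed.

(** The inequality [dim Z / B <= D], stated so that it makes sense for
    predicates on infinite-dimensional spaces: on every finite family of elements
    of [Z], [D] functionals detect membership in [B]. *)
Definition qdim_le (K : fieldType) (V : lmodType K) (Z B : V -> Prop) (D : nat)
    : Prop :=
  forall m (z : 'I_m -> V), (forall k, Z (z k)) ->
    exists N : 'M[K]_(m, D), forall c : 'rV[K]_m, c *m N = 0 -> B (comb c z).

Lemma qdim_le_sub (K : fieldType) (V : lmodType K) (Z Z' B B' : V -> Prop) D :
  (forall z, Z z -> Z' z) -> (forall z, Z z -> B' z -> B z) -> subspace Z ->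
  qdim_le Z' B' D -> qdim_le Z B D.
Proof.
move=> hZ hB sZ h m z zZ; have [N hN] := h m z (fun k => hZ _ (zZ k)).
by exists N => c /hN; apply: hB; apply: comb_subspace.
Qed.

Lemma qdim_le_weaken (K : fieldType) (V : lmodType K) (Z B : V -> Prop) D D' :
  (D <= D')%N -> qdim_le Z B D -> qdim_le Z B D'.
Proof.
move=> /subnKC <-; move: (D' - D)%N => d h m z zZ; have [N hN] := h m z zZ.
exists (row_mx N 0) => c; rewrite mul_mx_row -[0 in RHS]row_mx0.
by case/eq_row_mx => /hN.
Qed.

Lemma qdim_le0 (K : fieldType) (V : lmodType K) (Z B : V -> Prop) :
  subspace Z -> (forall z, Z z -> B z) -> qdim_le Z B 0.
Proof.
by move=> sZ h m z zZ; exists 0 => c _; apply: h; apply: comb_subspace.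
Qed.

(** A linear relation [R] that is defined on all of [Z] and reflects [B] induces an
    injection of [Z / B] into [Z' / B']. Relations replace maps because lifts along
    the differentials below are not canonical. *)
Lemma qdim_le_rel (K : fieldType) (V W : lmodType K) (Z B : V -> Prop)
    (Z' B' : W -> Prop) (R : V -> W -> Prop) D :
  R 0 0 ->
  (forall a u v u' v', R u v -> R u' v' -> R (a *: u + u') (a *: v + v')) ->
  subspace Z ->
  (forall z, Z z -> exists2 w, Z' w & R z w) ->
  (forall z w, Z z -> R z w -> B' w -> B z) ->
  qdim_le Z' B' D -> qdim_le Z B D.
Proof.
move=> R0 RD sZ hZ hB h m z zZ.
have /boolp.choice[w hw] : forall k, exists w, Z' w /\ R (z k) w.
  by move=> k; have [w ? ?] := hZ _ (zZ k); exists w.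
have [N hN] := h m w (fun k => (hw k).1); exists N => c /hN; apply: hB.
  exact: comb_subspace.
rewrite /comb; elim: (index_enum _) => [|k s IH]; first by rewrite !big_nil.
by rewrite !big_cons; apply: RD => //; case: (hw k).
Qed.

(** The functionals of the image of [f] modulo [B'] come first; on their common
    kernel those of [D2] are used. *)
Lemma qdim_le_filter (K : fieldType) (V W : lmodType K) (Z B : V -> Prop)
    (Z' B' : W -> Prop) (f : V -> W) D1 D2 :
  linear f -> subspace Z ->
  (forall z, Z z -> Z' (f z)) ->
  qdim_le Z' B' D1 ->
  qdim_le (fun z => Z z /\ B' (f z)) B D2 ->
  qdim_le Z B (D1 + D2).
Proof.
move=> lf sZ hZ h1 h2 m z zZ.
have [N1 hN1] := h1 m (f \o z) (fun k => hZ _ (zZ k)).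
have /(h2 m)[N2 hN2] : forall k, Z (comb (row k (kermx N1)) z) /\
    B' (f (comb (row k (kermx N1)) z)).
  move=> k; split; first exact: comb_subspace.
  rewrite comb_linear //; apply: hN1; apply/sub_kermxP; exact: row_sub.
exists (row_mx N1 (pinvmx (kermx N1) *m N2)) => c.
rewrite mul_mx_row -[0 in RHS]row_mx0 => /eq_row_mx[/sub_kermxP c1 c2].
have -> : comb c z = comb (c *m pinvmx (kermx N1)) 
    (fun k => comb (row k (kermx N1)) z).
  by rewrite -comb_mulmx mulmxKpV.
by apply: hN2; rewrite -mulmxA.
Qed.

(** For products: the functionals are put side by side. *)
Lemma qdim_le_pair (K : fieldType) (V W : lmodType K) (Z1 B1 : V -> Prop)
    (Z2 B2 : W -> Prop) D1 D2 :
  qdim_le Z1 B1 D1 -> qdim_le Z2 B2 D2 ->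
  qdim_le (fun z : V * W => Z1 z.1 /\ Z2 z.2)
          (fun z => B1 z.1 /\ B2 z.2) (D1 + D2).
Proof.
move=> h1 h2 m z zZ; have [N1 hN1] := h1 m (fst \o z) (fun k => (zZ k).1).
have [N2 hN2] := h2 m (snd \o z) (fun k => (zZ k).2).
exists (row_mx N1 N2) => c; rewrite mul_mx_row -[0 in RHS]row_mx0.
case/eq_row_mx => /hN1 c1 /hN2 c2.
have e1 : (comb c z).1 = comb c (fst \o z).
  by apply: (comb_linear (f := fst)) => a u v.
have e2 : (comb c z).2 = comb c (snd \o z).
  by apply: (comb_linear (f := snd)) => a u v.
by rewrite e1 e2.
Qed.

Lemma qdim_le_span (K : fieldType) (V : lmodType K) (Z B : V -> Prop) D
    (s : 'I_D -> V) :
  subspace B -> (forall z, Z z -> exists a : 'rV[K]_D, B (z - comb a s)) ->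
  qdim_le Z B D.
Proof.
move=> sB h m z zZ.
have /boolp.choice[a ha] : forall k, exists a : 'rV[K]_D, B (z k - comb a s).
  by move=> k; apply: h.
exists (\matrix_k a k) => c hc.
suff -> : comb c z = comb c (fun k => z k - comb (a k) s).
  exact: comb_subspace.
have : comb (c *m \matrix_k a k) s = 0.
  by rewrite hc /comb big1 // => k _; rewrite mxE scale0r.
rewrite comb_mulmx => e; rewrite -[LHS]subr0 -e /comb -sumrB.
by apply: eq_bigr => k _; rewrite scalerBr rowK.
Qed.

(** * Koszul chains *)

(** [kos X n i.+1] is [Lambda^i K^n (x) X]: the shift of the index by one makes room
    for the zero space [kos X n 0], the target of the last Koszul map. A pair [(a, b)]
    stands for [a + e_n b], where [e_n] is the last basis vector. *)
Fixpoint kos (K : fieldType) (X : lmodType K) (n i : nat) : lmodType K :=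
  match i with
  | 0 => 'rV[K]_0
  | i'.+1 => match n with
             | 0 => if i' is 0 then X else 'rV[K]_0
             | n'.+1 => (kos X n' i'.+1 * kos X n' i')%type
             end
  end.

Lemma pairP (A B : Type) (z w : A * B) : z.1 = w.1 -> z.2 = w.2 -> z = w.
Proof. by case: z w => [? ?] [? ?] /= -> ->. Qed.

(** The map induced on coefficients. It need not be linear over a common field: it
    is also used for extensions of the base field. *)
Fixpoint kmap (K K' : fieldType) (X : lmodType K) (Y : lmodType K') (f : X -> Y)
    (n i : nat) : kos X n i -> kos Y n i :=
  match i with
  | 0 => fun _ => 0
  | i'.+1 => match n with
     | 0 => match i' return kos X 0 i'.+1 -> kos Y 0 i'.+1 with
            | 0 => f | _ => fun _ => 0 end
     | n'.+1 => fun z => (kmap f z.1, kmap f z.2)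
     end
  end.

(** Contraction with [sum_k x_k e_k^*], where the [x_k] are operators on the
    coefficients; this is the Koszul differential. *)
Fixpoint kD (K : fieldType) (X : lmodType K) (x : nat -> X -> X) (n i : nat) :
    kos X n i.+1 -> kos X n i :=
  match n return kos X n i.+1 -> kos X n i with
  | 0 => fun _ => 0
  | n'.+1 => match i return kos X n'.+1 i.+1 -> kos X n'.+1 i with
     | 0 => fun _ => 0
     | i'.+1 => fun z => (kD x z.1 + kmap (x n') z.2, - kD x z.2)
     end
  end.

(** Exterior multiplication by the vector [sum_k t_k e_k]. *)
Fixpoint kom (K : fieldType) (X : lmodType K) (t : nat -> K) (n i : nat) :
    kos X n i -> kos X n i.+1 :=
  match i return kos X n i -> kos X n i.+1 with
  | 0 => fun _ => 0
  | i'.+1 => match n return kos X n i'.+1 -> kos X n i'.+2 with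
     | 0 => fun _ => 0
     | n'.+1 => fun z => (kom t z.1, t n' *: z.1 - kom t z.2)
     end
  end.

(** All coefficients satisfy [P], i.e. the chains with coefficients in [P]. *)
Fixpoint kall (K : fieldType) (X : lmodType K) (P : X -> Prop) (n i : nat) :
    kos X n i -> Prop :=
  match i with
  | 0 => fun _ => True
  | i'.+1 => match n with
     | 0 => match i' return kos X 0 i'.+1 -> Prop with
            | 0 => P | _ => fun _ => True end
     | n'.+1 => fun z => kall P z.1 /\ kall P z.2
     end
  end.

Lemma row0P (K : fieldType) (u v : 'rV[K]_0) : u = v.
Proof. by rewrite (thinmx0 u) (thinmx0 v). Qed.

Lemma kos0P (K : fieldType) (X : lmodType K) n (u v : kos X n 0) : u = v.
Proof. by case: n u v => [|n] u v; exact: row0P. Qed.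

Lemma kall_and_map0 (K K' : fieldType) (X : lmodType K) (Y : lmodType K') (f : X -> Y)
    (P : X -> Prop) n i (z : kos X n i) :
  kall P z -> kmap f z = 0 -> kall (fun v => P v /\ f v = 0) z.
Proof.
elim: n i z => [|n IH] [|[|i]] z //=.
- by case=> h1 h2 [h3 h4]; split; apply: IH.
- by case=> h1 h2 [h3 h4]; split; apply: IH.
Qed.

Lemma kmap_zero (K K' : fieldType) (X : lmodType K) (Y : lmodType K')
    (f : X -> Y) : (forall v, f v = 0) ->
  forall n i (z : kos X n i), kmap f z = 0.
Proof.
move=> h; elim=> [|n IH] [|[|i]] z; try exact: row0P.
- exact: h.
- by apply: pairP; rewrite /= IH.
- by apply: pairP; rewrite /= IH.
Qed.

Lemma kmap_inj0 (K : fieldType) (X Y : lmodType K) (f : X -> Y) :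
  (forall v, f v = 0 -> v = 0) ->
  forall n i (z : kos X n i), kmap f z = 0 -> z = 0.
Proof.
move=> h; elim=> [|n IH] [|[|i]] z /= e; try exact: row0P.
- exact: h.
- by case: e => /IH e1 /IH e2; apply: pairP.
- by case: e => /IH e1 /IH e2; apply: pairP.
Qed.

Lemma kall0 (K : fieldType) (X : lmodType K) (P : X -> Prop) n (z : kos X n 0) :
  kall P z.
Proof. by case: n z. Qed.

Section Map.
Variables (K K' : fieldType) (X : lmodType K) (Y : lmodType K').
Implicit Types (f g : X -> Y).

Lemma kmap_add f : (forall u v, f (u + v) = f u + f v) ->
  forall n i (z w : kos X n i), kmap f (z + w) = kmap f z + kmap f w.
Proof.
move=> fD; elim=> [|n IH] [|[|i]] z w //=; try exact: row0P.
- by apply: pairP; rewrite /= IH.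
- by apply: pairP; rewrite /= IH.
Qed.

Lemma kmap0 f : f 0 = 0 -> forall n i, kmap f (0 : kos X n i) = 0.
Proof.
move=> f0; elim=> [|n IH] [|[|i]] //=; try exact: row0P.
- by apply: pairP; rewrite /= IH.
- by apply: pairP; rewrite /= IH.
Qed.

Lemma kmap_opp f : (forall u, f (- u) = - f u) ->
  forall n i (z : kos X n i), kmap f (- z) = - kmap f z.
Proof.
move=> fN; elim=> [|n IH] [|[|i]] z //=; try exact: row0P.
- by apply: pairP; rewrite /= IH.
- by apply: pairP; rewrite /= IH.
Qed.

Lemma kmap_scale f (s : K -> K') : (forall a u, f (a *: u) = s a *: f u) ->
  forall n i a (z : kos X n i), kmap f (a *: z) = s a *: kmap f z.
Proof.
move=> fZ; elim=> [|n IH] [|[|i]] a z //=; try exact: row0P.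
- by apply: pairP; rewrite /= IH.
- by apply: pairP; rewrite /= IH.
Qed.

Lemma kmap_eq f g (P : X -> Prop) : (forall u, P u -> f u = g u) ->
  forall n i (z : kos X n i), kall P z -> kmap f z = kmap g z.
Proof.
move=> fg; elim=> [|n IH] [|[|i]] z //=; try by move=> *; exact: row0P.
- by apply: fg.
- by case=> ? ?; rewrite !IH.
- by case=> ? ?; rewrite !IH.
Qed.

Lemma kall_map f (P : X -> Prop) (Q : Y -> Prop) :
  (forall u, P u -> Q (f u)) ->
  forall n i (z : kos X n i), kall P z -> kall Q (kmap f z).
Proof.
move=> fg; elim=> [|n IH] [|[|i]] z //=.
- by apply: fg.
- by case=> ? ?; split; [apply: IH | apply: IH].
- by case=> ? ?; split; [apply: IH | apply: IH].
Qed.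

Lemma kall_lift f (P : X -> Prop) (Q : Y -> Prop) :
  (forall v, Q v -> exists2 u, P u & f u = v) ->
  forall n i (w : kos Y n i), kall Q w -> exists2 z, kall P z & kmap f z = w.
Proof.
move=> h; elim=> [|n IH] [|[|i]] w //=.
- by exists 0 => //; exact: row0P.
- by move=> /h.
- by exists 0 => //; exact: row0P.
- by exists 0 => //; exact: row0P.
- case=> /IH[z1 ? e1] /IH[z2 ? e2]; exists (z1, z2) => //=.
  by apply: pairP; rewrite /= ?e1 ?e2.
- case=> /IH[z1 ? e1] /IH[z2 ? e2]; exists (z1, z2) => //=.
  by apply: pairP; rewrite /= ?e1 ?e2.
Qed.

Lemma kmapDf f g n i (z : kos X n i) :
  kmap (fun v => f v + g v) z = kmap f z + kmap g z.
Proof.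
elim: n i z => [|n IH] [|[|i]] z; try exact: row0P; first by [].
- by apply: pairP => /=; rewrite IH.
- by apply: pairP => /=; rewrite IH.
Qed.

Lemma kmapZf a f n i (z : kos X n i) :
  kmap (fun v => a *: f v) z = a *: kmap f z.
Proof.
elim: n i z => [|n IH] [|[|i]] z; try exact: row0P; first by [].
- by apply: pairP => /=; rewrite IH.
- by apply: pairP => /=; rewrite IH.
Qed.

End Map.

Lemma kmap_linear (K : fieldType) (X Y : lmodType K) (f : X -> Y) n i :
  linear f -> linear (@kmap _ _ X Y f n i).
Proof.
move=> lf a u v.
have f0 : f 0 = 0 by have := lf (-1) 0 0; rewrite scaler0 addr0 scaleN1r addNr.
rewrite kmap_add => [|u1 v1]; last by rewrite -[u1]scale1r lf !scale1r.
congr (_ + _); apply: (kmap_scale (s := id)) => a1 u1.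
by rewrite -[a1 *: u1]addr0 lf f0 addr0.
Qed.

Lemma kmap_comp (K1 K2 K3 : fieldType) (X : lmodType K1) (Y : lmodType K2)
    (Z : lmodType K3) (f : X -> Y) (g : Y -> Z) n i (z : kos X n i) :
  kmap g (kmap f z) = kmap (g \o f) z.
Proof.
elim: n i z => [|n IH] [|[|i]] z //=; try exact: row0P; by rewrite !IH.
Qed.

Lemma kmap_id (K : fieldType) (X : lmodType K) n i (z : kos X n i) :
  kmap id z = z.
Proof.
elim: n i z => [|n IH] [|[|i]] z //=; try exact: row0P;
  by rewrite !IH; case: z.
Qed.

Section All.
Variables (K : fieldType) (X : lmodType K).
Implicit Types (P Q : X -> Prop).

Lemma kall_sub P Q : (forall u, P u -> Q u) ->
  forall n i (z : kos X n i), kall P z -> kall Q z.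
Proof. by move=> PQ n i z /(kall_map (f := id) PQ); rewrite kmap_id. Qed.

Lemma kall_subspace P n i : subspace P -> subspace (@kall _ X P n i).
Proof.
move=> sP; elim: n i => [|n IH] [|[|i]].
- by split.
- exact: sP.
- by split.
- by split.
- have [h1 h2] := IH 1%N; have [h3 h4] := IH 0%N.
  split; first by split; [exact: h1|exact: h3].
  by move=> a u v [? ?] [? ?]; split; [exact: h2|exact: h4].
- have [h1 h2] := IH i.+2; have [h3 h4] := IH i.+1.
  split; first by split; [exact: h1|exact: h3].
  by move=> a u v [? ?] [? ?]; split; [exact: h2|exact: h4].
Qed.

Lemma qdim_le_kall P Q g n i : subspace P -> qdim_le P Q g ->
  qdim_le (@kall _ X P n i.+1) (@kall _ X Q n i.+1) ('C(n, i) * g).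
Proof.
move=> sP h; elim: n i => [|n IH] i.
  case: i => [|i]; first by rewrite bin0 mul1n.
  by rewrite bin0n mul0n; apply: qdim_le0; [split|].
case: i => [|i].
  have -> : ('C(n.+1, 0) * g = 'C(n, 0) * g + 0)%N by rewrite !bin0 addn0.
  apply: (qdim_le_pair (IH 0%N)); apply: qdim_le0; last by move=> *; exact: kall0.
  by split=> *; exact: kall0.
rewrite binS mulnDl; exact: qdim_le_pair (IH _) (IH _).
Qed.

End All.

Section Diff.
Variables (K : fieldType) (X : lmodType K) (x : nat -> X -> X).
Hypothesis xL : forall k, linear (x k).

Lemma kD_linear n i : linear (@kD _ X x n i).
Proof.
elim: n i => [|n IH] [|i] a u v; try (by exact: row0P).
- by rewrite /= scaler0 addr0.
- apply: pairP => /=.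
  + rewrite IH (kmap_linear (xL n)) scalerDr.
    by rewrite -!addrA; congr (_ + _); rewrite addrCA.
  + by rewrite IH opprD scalerN.
Qed.

Lemma kDD n i (u v : kos X n i.+1) : kD x (u + v) = kD x u + kD x v.
Proof. by rewrite -[u]scale1r kD_linear !scale1r. Qed.
Lemma kD0 n i : kD x (0 : kos X n i.+1) = 0.
Proof. by have := @kD_linear n i (-1) 0 0; rewrite scaler0 addr0 scaleN1r addNr. Qed.
Lemma kDZ n i a (u : kos X n i.+1) : kD x (a *: u) = a *: kD x u.
Proof. by rewrite -[a *: u]addr0 kD_linear kD0 addr0. Qed.
Lemma kDN n i (u : kos X n i.+1) : kD x (- u) = - kD x u.
Proof. by rewrite -scaleN1r kDZ scaleN1r. Qed.
Lemma kDB n i (u v : kos X n i.+1) : kD x (u - v) = kD x u - kD x v.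
Proof. by rewrite kDD kDN. Qed.

Lemma kall_kD (P Q : X -> Prop) : (forall k u, P u -> Q (x k u)) ->
  subspace Q ->
  forall n i (z : kos X n i.+1), kall P z -> kall Q (kD x z).
Proof.
move=> PQ sQ; elim=> [|n IH] [|i] z; try by move=> _; exact: kall0.
- by move=> _; exact: (subspace0 (kall_subspace 0 i.+1 sQ)).
- case: z => u v [/= Pu Pv]; split.
  + apply: subspaceD; [exact: kall_subspace|exact: IH|].
    by apply: kall_map Pv; apply: PQ.
  + by apply: subspaceN; [exact: kall_subspace|exact: IH].
Qed.

End Diff.

Lemma kmap_kD (K K' : fieldType) (X : lmodType K) (Y : lmodType K')
    (f : X -> Y) (x : nat -> X -> X) (y : nat -> Y -> Y) n :
  (forall u v, f (u + v) = f u + f v) ->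
  (forall k u, (k < n)%N -> f (x k u) = y k (f u)) ->
  forall i (z : kos X n i.+1), kmap f (kD x z) = kD y (kmap f z).
Proof.
move=> fD; have f0 : f 0 = 0 by apply/(addrI (f 0)); rewrite -fD !addr0.
have fN u : f (- u) = - f u.
  by apply/(addrI (f u)); rewrite -fD !addrN.
elim: n => [|n IH] fx [|i] z; try exact: row0P.
- exact: (@kmap0 _ _ _ _ f f0 0 i.+1).
- have IH' := IH (fun k u h => fx k u (ltnW h)).
  apply: pairP => /=; last by rewrite kmap_opp // IH'.
  rewrite kmap_add // IH'; congr (_ + _).
  rewrite !kmap_comp.
  by apply: (kmap_eq (P := fun=> True)) => [u _ /=|]; 
     [exact: fx | elim: (n) (i.+1) (z.2) => [|m IHm] [|[|j]] //=].
Qed.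

Lemma kallT (K : fieldType) (X : lmodType K) n i (z : kos X n i) :
  kall (fun=> True) z.
Proof. by elim: n i z => [|m IHm] [|[|j]] //=. Qed.

Section Commuting.
Variables (K : fieldType) (X : lmodType K) (x : nat -> X -> X).
Hypothesis xL : forall k, linear (x k).
Hypothesis xC : forall k l u, x k (x l u) = x l (x k u).

Lemma kDkD n i (z : kos X n i.+2) : kD x (kD x z) = 0.
Proof.
elim: n i z => [|n IH] [|i] z; try exact: row0P; first by [].
apply: pairP => /=; last by rewrite kDN // IH oppr0 oppr0.
rewrite kDD // IH add0r kmap_opp; last exact: (linN (xL _)).
rewrite (kmap_kD (y := x)); first by rewrite subrr.
- exact: (linD (xL _)).
- by move=> k u _; rewrite xC.
Qed.

End Commuting.

Section Om.
Variables (K : fieldType) (X : lmodType K) (t : nat -> K).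

Lemma kom_linear n i : linear (@kom _ X t n i).
Proof.
have z0 a (V : lmodType K) : 0 = a *: 0 + 0 :> V by rewrite scaler0 addr0.
elim: n i => [|n IH] [|i] a u v.
- exact: (z0 _ (kos X 0 1)).
- exact: (z0 _ (kos X 0 i.+2)).
- exact: (z0 _ (kos X n.+1 1)).
- apply: pairP => /=; first by rewrite IH.
  rewrite IH opprD scalerBr scalerDr addrACA !scalerA mulrC.
  by congr (_ + _); rewrite scalerN.
Qed.

Lemma komD n i (u v : kos X n i) : kom t (u + v) = kom t u + kom t v.
Proof. by rewrite -[u]scale1r kom_linear !scale1r. Qed.
Lemma kom0 n i : kom t (0 : kos X n i) = 0.
Proof. by have := @kom_linear n i (-1) 0 0; rewrite scaler0 addr0 scaleN1r addNr. Qed.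
Lemma komN n i (u : kos X n i) : kom t (- u) = - kom t u.
Proof. by apply/(addrI (kom t u)); rewrite -komD !addrN kom0. Qed.

Lemma kall_kom (P : X -> Prop) n i (z : kos X n i) :
  subspace P -> kall P z -> kall P (kom t z).
Proof.
move=> sP; elim: n i z => [|n IH] [|i] z.
- by move=> _; exact: (subspace0 (kall_subspace 0 1 sP)).
- by move=> _; exact: (subspace0 (kall_subspace 0 i.+2 sP)).
- by move=> _; exact: (subspace0 (kall_subspace n.+1 1 sP)).
- case=> /= Pu Pv; split; first exact: IH.
  apply: subspaceB; [exact: kall_subspace| |exact: IH].
  by apply: subspaceZ => //; exact: kall_subspace.
Qed.

Lemma kom_kmap (f : X -> X) n i (z : kos X n i) : linear f ->
  kmap f (kom t z) = kom t (kmap f z).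
Proof.
move=> lf; have f0 := lin0 lf.
elim: n i z => [|n IH] [|i] z.
- exact: (@kmap0 _ _ X X f f0 0 1).
- exact: (@kmap0 _ _ X X f f0 0 i.+2).
- exact: (@kmap0 _ _ X X f f0 n.+1 1).
- apply: pairP => /=; first exact: IH.
  rewrite kmap_add; last exact: (linD lf).
  rewrite kmap_opp; last exact: (linN lf).
  rewrite (kmap_scale (s := id)); last first.
    exact: (linZ lf).
  by rewrite IH.
Qed.

Variable x : nat -> X -> X.
Hypothesis xL : forall k, linear (x k).

Definition ksum n (v : X) : X := \sum_(k < n) t k *: x k v.

(** Cartan's formula: contraction and exterior multiplication anticommute up to the
    pairing [sum_k t_k x_k] of the two. *)
Lemma kDkom n i (z : kos X n i.+1) :
  kD x (kom t z) = kmap (ksum n) z - kom t (kD x z).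
Proof.
elim: n i z => [|n IH] i z.
  have e0 : forall v : X, ksum 0 v = 0 by move=> v; rewrite /ksum big_ord0.
  case: i z => [|i] z; last exact: row0P.
  by rewrite /= e0 subr0.
have eS m j (w : kos X m j) :
    kmap (ksum n.+1) w = kmap (ksum n) w + t n *: kmap (x n) w.
  rewrite -kmapZf -kmapDf; apply: (kmap_eq (P := fun=> True)) (kallT _).
  by move=> u _; rewrite /ksum big_ord_recr.
have xD := linD (xL n); have xN := linN (xL n); have xZ := linZ (xL n).
case: i z => [|i] z; apply: pairP => /=.
- rewrite IH (kos0P (kD x z.1) 0) (kos0P z.2 0) !kom0 !subr0 eS.
  by rewrite (kmap_scale (s := id)) // .
- exact: kos0P.
- rewrite IH eS komD kmap_add // kmap_opp // (kmap_scale (s := id)) //.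
  rewrite -kom_kmap; last exact: xL.
  by rewrite opprD addrACA.
- rewrite kDB // kDZ // IH eS komN opprK opprB scalerDr [t n *: _ + _]addrC.
  by rewrite -[X in _ = _ - X]addrA opprD addrA addrK opprD addrA addrAC.
Qed.

End Om.

(** * Restriction to a hyperplane *)

Section Elimination.
Variables (K : fieldType) (X Y : lmodType K) (n : nat) (t : nat -> K).
Variables (x : nat -> X -> X) (y : nat -> Y -> Y) (rho : X -> Y).
Hypothesis xL : forall k, linear (x k).
Hypothesis xC : forall k l u, x k (x l u) = x l (x k u).
Hypothesis yL : forall k, linear (y k).
Hypothesis rhoL : linear rho.
Hypothesis rho_x : forall k u, (k < n)%N -> rho (x k u) = y k (rho u).

Definition klam (v : X) : X := x n v - \sum_(k < n) t k *: x k v.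

Hypothesis lam_inj : forall v, klam v = 0 -> v = 0.
Hypothesis rho_lam : forall v, rho (klam v) = 0.

Variables (M W U : X -> Prop) (M' W' : Y -> Prop) (g D : nat) (i : nat).
Hypothesis sM : subspace M.
Hypothesis sW : subspace W.
Hypothesis sU : subspace U.
Hypothesis sM' : subspace M'.
Hypothesis MW : forall k u, M u -> W (x k u).
Hypothesis WW' : forall u, W u -> W' (rho u).
Hypothesis MM' : forall v, M' v -> exists2 u, M u & rho u = v.
Hypothesis WU : forall w, W w -> rho w = 0 -> exists2 u, U u & klam u = w.
Hypothesis UM : qdim_le U M g.

Definition kcyc (V : lmodType K) (v : nat -> V -> V) (P : V -> Prop) m j
    (z : kos V m j.+1) : Prop := kall P z /\ kD v z = 0.
Definition kbnd (V : lmodType K) (v : nat -> V -> V) (P : V -> Prop) m j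
    (z : kos V m j.+1) : Prop := exists2 w, kall P w & z = kD v w.

Lemma kcyc_subspace (V : lmodType K) (v : nat -> V -> V) P m j :
  (forall k, linear (v k)) -> subspace P -> subspace (@kcyc V v P m j).
Proof.
move=> vL sP; split; first by split; [exact: (subspace0 (kall_subspace _ _ sP))|exact: kD0].
move=> a u w [u1 u2] [w1 w2]; split; first by apply (kall_subspace _ _ sP).2.
by rewrite kD_linear // u2 w2 scaler0 addr0.
Qed.

Lemma kbnd_subspace (V : lmodType K) (v : nat -> V -> V) P m j :
  (forall k, linear (v k)) -> subspace P -> subspace (@kbnd V v P m j).
Proof.
move=> vL sP; split; first by exists 0; [exact: (subspace0 (kall_subspace _ _ sP))|rewrite kD0].
move=> a u w [u1 u2 ->] [w1 w2 ->]; exists (a *: u1 + w1); last by rewrite kD_linear.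
by apply (kall_subspace _ _ sP).2.
Qed.

(** Writing a cycle as [a + e_n b], the element [a + t b] restricts to a cycle
    on the hyperplane; when the restriction is a boundary, [a + t b] is
    [lambda] times a chain of [U] up to a boundary, and this chain determines
    the cycle. *)
Lemma qdim_le_elim :
  qdim_le (@kcyc Y y W' n i) (@kbnd Y y M' n i) D ->
  qdim_le (@kcyc X x W n.+1 i) (@kbnd X x M n.+1 i) (D + 'C(n, i) * g).
Proof.
move=> h.
have lamL : linear klam.
  move=> a u v; rewrite /klam xL scalerBr scaler_sumr -addrACA -opprD -big_split /=.
  congr (_ - _); apply: eq_bigr => k _.
  by rewrite xL scalerDr !scalerA mulrC.
have lamE v : klam v = x n v - ksum t x n v by [].
have lamB m j (z : kos X m j) : kmap klam z = kmap (x n) z - kmap (ksum t x n) z.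
  rewrite -scaleN1r -kmapZf -kmapDf; apply: (kmap_eq (P := fun=> True)) (kallT _).
  by move=> u _; rewrite lamE scaleN1r.
have xlam k u : x k (klam u) = klam (x k u).
  rewrite /klam -scaleN1r addrC xL scaleN1r addrC xC; congr (_ - _).
  rewrite (lin_sum (xL k)).
  by apply: eq_bigr => l _; rewrite (linZ (xL _)) xC.
pose at_ (z : kos X n.+1 i.+1) : kos X n i.+1 := z.1 + kom t z.2.
have atL : linear at_.
  by move=> a u v; rewrite /at_ /= kom_linear scalerDr -!addrA; congr (_ + _); rewrite addrCA.
have Dat z : kD x z = 0 -> kD x (at_ z) = - kmap klam z.2.
  case: z => z1 z2; rewrite /at_ /=; case: (i) z1 z2 => [|j] z1 z2.
    by move=> _; exact: kos0P.
  case=> e1 e2; rewrite kDD // kDkom // lamB opprB.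
  by rewrite -[kD x z2]opprK e2 oppr0 kom0 subr0 addrC -(addrK (kmap (x n) z2) (kD x z1)) e1 add0r.
have Wat z : kall W z -> kall W (at_ z).
  by case=> h1 h2; apply: subspaceD (kall_subspace _ _ sW) h1 (kall_kom _ sW h2).
have DrD m j (z : kos X m j.+1) : (m <= n)%N ->
    kmap rho (kD x z) = kD y (kmap rho z).
  move=> le; apply: kmap_kD; first exact: (linD rhoL).
  by move=> k u lt; rewrite rho_x // (leq_trans lt).
have rlam m j (z : kos X m j) : kmap rho (kmap klam z) = 0.
  rewrite kmap_comp; exact: kmap_zero.
have fL : linear (fun z => kmap rho (at_ z)).
  by move=> a u v; rewrite atL (kmap_linear rhoL).
apply: (qdim_le_filter fL (kcyc_subspace _ _ xL sW) _ h).
  move=> z [Wz Dz]; split; first by apply: kall_map (Wat _ Wz).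
  by rewrite -DrD // Dat // (kmap_opp (linN rhoL)) rlam oppr0.
pose R (z : kos X n.+1 i.+1) (a : kos X n i.+1) :=
  exists2 m, kall M m & at_ z - kD x m = kmap klam a.
apply: (qdim_le_rel (R := R) _ _ _ _ _ (qdim_le_kall sU UM)).
- exists 0; first exact: (subspace0 (kall_subspace _ _ sM)).
  by rewrite (lin0 atL) kD0 // subrr (lin0 (kmap_linear lamL)).
- move=> a u v u' v' [m1 h1 e1] [m2 h2 e2]; exists (a *: m1 + m2).
    exact: (kall_subspace _ _ sM).2.
  by rewrite atL kD_linear // (kmap_linear lamL) -e1 -e2 scalerBr opprD addrACA.
- have sC := kcyc_subspace n.+1 i xL sW.
  have sub' : subspace (fun z => @kbnd Y y M' n i (kmap rho (at_ z))) -> 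
     subspace (fun z => kcyc x W z /\ kbnd y M' (kmap rho (at_ z))).
    by case=> p0 p1; split; [split=> //; exact: sC.1|move=> a u v [] ? ? [] ? ?; split; [exact: sC.2|exact: p1]].
  have sB := @kbnd_subspace Y y M' n i yL sM'.
  apply: sub'; split; first by rewrite (lin0 fL); exact: sB.1.
  by move=> a u v hu hv; rewrite fL; exact: sB.2.
- move=> z [[Wz Dz] [m' M'm' em']].
  have [m Mm em] := kall_lift MM' M'm'.
  have Ww : kall W (at_ z - kD x m).
    by apply: subspaceB (kall_subspace _ _ sW) (Wat _ Wz) (kall_kD MW sW Mm).
  have rw0 : kmap rho (at_ z - kD x m) = 0.
    by rewrite (linB (kmap_linear rhoL)) DrD // em em' subrr.
  have := kall_lift (fun v (hv : W v /\ rho v = 0) => WU hv.1 hv.2) (kall_and_map0 Ww rw0).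
  by case=> a Ua ea; exists a => //; exists m.
- move=> z a [[Wz Dz] _] [m Mm em] Ma.
  have e2 : z.2 = - kD x a.
    apply/eqP; rewrite -addr_eq0; apply/eqP/(kmap_inj0 lam_inj).
    rewrite (linD (kmap_linear lamL)).
    rewrite (kmap_kD (y := x)) //; last exact: (linD lamL).
      by rewrite -em kDB // kDkD // subr0 Dat // addrN.
  exists ((m - kom t a, a) : kos X n.+1 i.+2).
    split; last exact: Ma.
    apply: subspaceB (kall_subspace _ _ sM) Mm (kall_kom _ sM Ma).
  apply: pairP => //=.
  have <- : at_ z - kom t z.2 = z.1 by rewrite /at_ addrK.
  have -> : at_ z = kD x m + kmap klam a by rewrite -em addrC subrK.
  rewrite lamB e2 komN opprK kDB // kDkom // opprB -!addrA; congr (_ + _).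
  by rewrite [RHS]addrCA addrC -addrA.
Qed.

End Elimination.

(** * Extension of the base field *)

Section Functionals.
Variables (K K' : fieldType) (iota : {rmorphism K -> K'}).

Let Ksub (H : K' -> Prop) : Prop :=
  H 0 /\ forall a u v, H u -> H v -> H (iota a * u + v).

(** By Zorn's lemma: a maximal [K]-subspace that avoids [x0] is a complement of the
    line through [x0]. *)
Lemma exists_hyperplane (x0 : K') : x0 != 0 ->
  exists2 H, Ksub H /\ ~ H x0 & forall y, exists a, H (y - iota a * x0).
Proof.
move=> x0n.
pose ok (H : K' -> Prop) := Ksub H /\ ~ H x0.
pose T := {H : K' -> Prop | ok H}.
pose R (s t : T) := boolp.asbool (forall u, sval s u -> sval t u).
have RP s t : reflect (forall u, sval s u -> sval t u) (R s t) by exact: boolp.asboolP.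
have h0 : ok (fun u => u = 0).
  split; last exact/eqP; split=> // a u v -> ->; by rewrite mulr0 addr0.
have [] := @classical_sets.Zorn T R.
- by move=> s; apply/RP.
- by move=> s t u /RP st /RP tu; apply/RP => y /st /tu.
- move=> [s ps] [t pt] /RP /= st /RP /= ts.
  have e : s = t by apply: boolp.funext => u; apply: boolp.propext; split; auto.
  by move: ps pt; rewrite e => ps pt; congr exist; exact: boolp.Prop_irrelevance.
- move=> A Atot.
  have [[s0 As0]|Ane] := boolp.EM (exists s, A s); last first.
    by exists (exist ok _ h0) => s As; case: Ane; exists s.
  pose H u := exists2 s, A s & sval s u.
  have HP : Ksub H /\ ~ H x0.
    split; last by case=> s _ sx; exact: (svalP s).2.
    split; first by exists s0 => //; exact: (svalP s0).1.1.
    move=> a u v [s As su] [t At tv].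
    have [/RP st|/RP ts] := Atot _ _ As At.
      by exists t => //; apply: (svalP t).1.2 => //; exact: st.
    by exists s => //; apply: (svalP s).1.2 => //; exact: ts.
  by exists (exist ok H HP) => s As; apply/RP => u su; exists s.
move=> [H HH] Hmax; exists H => //; have [[H0 HD] Hx] := HH.
have HZ a u : H u -> H (iota a * u) by move=> hu; rewrite -[_ * _]addr0; exact: HD.
have HA u v : H u -> H v -> H (u + v).
  by move=> hu hv; rewrite -[u]mul1r -(rmorph1 iota); exact: HD.
have HN u : H u -> H (- u).
  by move=> hu; rewrite -mulN1r -(rmorphN1 iota); exact: HZ.
move=> y; have [Hy|Hy] := boolp.EM (H y).
  by exists 0; rewrite rmorph0 mul0r subr0.
pose H' u := exists b, H (u - iota b * y).
have sH' : Ksub H'.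
  split; first by exists 0; rewrite rmorph0 mul0r subr0.
  move=> a u v [b hb] [c hc]; exists (a * b + c).
  have -> : iota a * u + v - iota (a * b + c) * y
     = iota a * (u - iota b * y) + (v - iota c * y).
    by rewrite rmorphD rmorphM; ring.
  exact: HD.
have [[b hb]|Hx'] := boolp.EM (H' x0); last first.
  have := Hmax (exist ok H' (conj sH' Hx')).
  have /[swap]/[apply] : R (exist ok H HH) (exist ok H' (conj sH' Hx')).
    by apply/RP => u hu /=; exists 0; rewrite rmorph0 mul0r subr0.
  by case=> e; case: Hy; rewrite -e; exists 1; rewrite rmorph1 mul1r subrr.
have bn : b != 0.
  by apply/eqP => b0; apply: Hx; rewrite b0 rmorph0 mul0r subr0 in hb.
exists b^-1.
have -> : y - iota b^-1 * x0 = - (iota b^-1 * (x0 - iota b * y)).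
  rewrite mulrBr mulrA -rmorphM mulVf // rmorph1; ring.
by apply/HN/HZ.
Qed.

(** The coordinate along [x0] with respect to a complement of its line. *)
Lemma exists_functional (x0 : K') : x0 != 0 ->
  exists2 phi : K' -> K,
    (forall a u v, phi (iota a * u + v) = a * phi u + phi v) & phi x0 != 0.
Proof.
move=> x0n; have [H [[H0 HD] Hx] hH] := exists_hyperplane x0n.
have [phi hphi] := boolp.choice hH.
have HZ a u : H u -> H (iota a * u) by move=> hu; rewrite -[_ * _]addr0; exact: HD.
have uni y a b : H (y - iota a * x0) -> H (y - iota b * x0) -> a = b.
  move=> ha hb; apply/eqP; rewrite -subr_eq0; apply/negPn/negP => ne; apply: Hx.
  have : H (iota (-1) * (y - iota a * x0) + (y - iota b * x0)) by exact: HD.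
  rewrite rmorphN1.
  have -> : -1 * (y - iota a * x0) + (y - iota b * x0) = iota (a - b) * x0.
    by rewrite rmorphB; ring.
  move/(HZ (a - b)^-1); by rewrite mulrA -rmorphM mulVf // rmorph1 mul1r.
exists phi.
  move=> a u v; apply: uni (hphi _) _.
  have -> : iota a * u + v - iota (a * phi u + phi v) * x0
    = iota a * (u - iota (phi u) * x0) + (v - iota (phi v) * x0).
    by rewrite rmorphD rmorphM; ring.
  exact: HD.
apply/eqP => e; have := hphi x0; rewrite e rmorph0 mul0r subr0; exact: Hx.
Qed.

End Functionals.

(** A row space of maximal rank inside the subspace exhausts it. *)
Lemma subspace_mx (K : fieldType) m (P : 'rV[K]_m -> Prop) : subspace P ->
  exists A : 'M[K]_m, forall u, P u <-> (u <= A)%MS.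
Proof.
move=> sP.
pose Q r := boolp.asbool (exists2 A : 'M[K]_m, (forall u, (u <= A)%MS -> P u) & \rank A = r).
have Q0 : exists r, Q r.
  exists 0%N; apply/boolp.asboolP; exists 0; last exact: mxrank0.
  by move=> u; rewrite submx0 => /eqP->; exact: sP.1.
have Qm r : Q r -> (r <= m)%N.
  by move=> /boolp.asboolP[A _ <-]; exact: rank_leq_row.
case: (ex_maxnP Q0 Qm) => r /boolp.asboolP[A hA rA] rmax.
exists A => u; split; last exact: hA.
move=> Pu; have : Q (\rank (A + u)%MS).
  apply/boolp.asboolP; exists (A + u)%MS => // v /sub_addsmxP[[v1 v2] /= ->].
  apply: subspaceD => //; first by apply: hA; rewrite submxMl.
  by rewrite [v2]mx11_scalar mul_scalar_mx; exact: subspaceZ.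
move/rmax; rewrite -rA => le; apply: submx_trans (addsmxSr A u) _.
by rewrite -(geq_leqif (mxrank_leqif_sup (addsmxSl A u))).
Qed.

Lemma exists_equations (K : fieldType) m D (A : 'M[K]_m) : (m - \rank A <= D)%N ->
  exists N : 'M[K]_(m, D), forall c : 'rV_m, c *m N = 0 -> (c <= A)%MS.
Proof.
move=> le.
have le' : (\rank (cokermx A) <= D)%N by rewrite mxrank_coker.
rewrite -(subnKC le'); move: (D - _)%N => d.
exists (row_mx (col_base (cokermx A)) 0) => c.
rewrite mul_mx_row -[0 in RHS]row_mx0 => /eq_row_mx[e _].
by rewrite submxE -[X in _ *m X]mulmx_base mulmxA e mul0mx.
Qed.

Section Descent.
Variables (K K' : fieldType) (iota : {rmorphism K -> K'}).
Variables (X : lmodType K) (X' : lmodType K') (mu : X -> X').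
Variables (x : nat -> X -> X) (x' : nat -> X' -> X') (n i D : nat).
Hypothesis xL : forall k, linear (x k).
Hypothesis muD : forall u v, mu (u + v) = mu u + mu v.
Hypothesis mu_x : forall k u, (k < n)%N -> mu (x k u) = x' k (mu u).
Variables (M W : X -> Prop) (M' W' : X' -> Prop).
Hypothesis sM : subspace M.
Hypothesis WW' : forall u, W u -> W' (mu u).
Hypothesis functionals : forall phi : K' -> K,
  (forall a u v, phi (iota a * u + v) = a * phi u + phi v) ->
  exists Phi : X' -> X,
    [/\ forall u v, Phi (u + v) = Phi u + Phi v,
        forall a u, Phi (a *: mu u) = phi a *: u,
        forall k w, (k < n)%N -> Phi (x' k w) = x k (Phi w)
      & forall w, M' w -> M (Phi w)].

(** Functionals over [K'] that detect [M'] restrict to [K]; a combination over [K]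
    that bounds over [K'] bounds over [K], because every [K]-linear functional of
    [K'] carries the bounding chain to one with coefficients in [M]. *)
Lemma qdim_le_descent :
  qdim_le (@kcyc _ X' x' W' n i) (@kbnd _ X' x' M' n i) D ->
  qdim_le (@kcyc _ X x W n i) (@kbnd _ X x M n i) D.
Proof.
move=> h m z zZ.
have [|A hA] := @subspace_mx K m (fun c => kbnd x M (comb c z)).
  have sB := kbnd_subspace n i xL sM.
  split; first by rewrite /comb big1 => [|k _]; rewrite ?mxE ?scale0r //; exact: sB.1.
  move=> a u v hu hv.
  have -> : comb (a *: u + v) z = a *: comb u z + comb v z.
    rewrite /comb scaler_sumr -big_split; apply: eq_bigr => k _ /=.
    by rewrite !mxE scalerDl scalerA.
  exact: sB.2.
have [|N hN] := h m (fun k => kmap mu (z k)).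
  move=> k; have [Wz Dz] := zZ k; split; first exact: kall_map Wz.
  rewrite -(kmap_kD (x := x)) // Dz kmap0 //.
  by apply: (addrI (mu 0)); rewrite -muD !addr0.
have kerA : (kermx N <= map_mx iota A)%MS.
  apply/row_subP => r; set u := row r _.
  have [y' My' ey'] : kbnd x' M' (comb u (fun k => kmap mu (z k))).
    by apply/hN/sub_kermxP/row_sub.
  rewrite submxE -map_cokermx; apply/eqP/rowP => j; rewrite [RHS]mxE.
  apply/eqP/negPn/negP => /(exists_functional iota)[phi phiL].
  have phi0 : phi 0 = 0 by have := phiL (-1) 0 0; rewrite mulr0 addr0 mulN1r addNr.
  have phiD a b : phi (a + b) = phi a + phi b.
    by rewrite -[a]mul1r -(rmorph1 iota) phiL rmorph1 !mul1r.
  have phiM a b : phi (b * iota a) = phi b * a.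
    by rewrite mulrC [RHS]mulrC -[_ * b]addr0 phiL phi0 addr0.
  have [Phi [PhiD PhiZ Phix PhiM]] := functionals phiL.
  have Phi0 : Phi 0 = 0 by apply: (addrI (Phi 0)); rewrite -PhiD !addr0.
  case/negP; rewrite mxE (big_morph phi phiD phi0).
  have /hA : kbnd x M (comb (map_mx phi u) z).
    exists (kmap Phi y'); first exact: kall_map My'.
    rewrite -(kmap_kD (x := x')) // -ey' /comb.
    rewrite (big_morph (@kmap _ _ _ _ Phi n i.+1) (@kmap_add _ _ _ _ _ PhiD n i.+1) (@kmap0 _ _ _ _ _ Phi0 n i.+1)).
    apply: eq_bigr => k _; rewrite mxE -kmapZf kmap_comp.
    rewrite -{1}[z k]kmap_id -kmapZf; apply: (kmap_eq (P := fun=> True)) (kallT _).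
    by move=> v _ /=; rewrite PhiZ.
  rewrite submxE => /eqP/rowP/(_ j); rewrite !mxE => e; apply/eqP; rewrite -[RHS]e.
  by apply: eq_bigr => k _; rewrite !mxE phiM.
have le : (m - \rank A <= D)%N.
  have := mxrankS kerA; rewrite mxrank_ker mxrank_map => le1.
  by have := rank_leq_col N; lia.
have [N0 hN0] := exists_equations le.
by exists N0 => c /hN0 /hA.
Qed.
End Descent.

(** * Forms divisible by a generic linear form *)

(** The characteristic polynomial of [A] vanishes at [x]. *)
Lemma eigen_algebraic (K F : fieldType) (iota : {rmorphism K -> F})
    (I : finType) (A : I -> I -> K) (v : I -> F) (x : F) :
  (exists i, v i != 0) ->
  (forall i, x * v i = \sum_j iota (A i j) * v j) -> algebraicOver iota x.
Proof.
move=> [i0 vi0] h; pose m := #|I|.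
pose B : 'M[K]_m := \matrix_(i, j) A (enum_val j) (enum_val i).
exists (char_poly B); first exact/monic_neq0/char_poly_monic.
rewrite map_char_poly -eigenvalue_root_char; apply/eigenvalueP.
exists (\row_j v (enum_val j)).
  apply/rowP => j; rewrite !mxE h (reindex (@enum_val I predT)) /=.
    by apply: eq_bigr => k _; rewrite !mxE mulrC.
  by exists enum_rank => k _; [exact: enum_valK|exact: enum_rankK].
apply/eqP => /rowP/(_ (enum_rank i0)); rewrite !mxE enum_rankK => e.
by rewrite e eqxx in vi0.
Qed.

Section Forms.
Variables (K F : fieldType) (iota : {rmorphism K -> F}) (n : nat).
Variable xi : 'I_n -> F.

(** Values at [xi] of the forms of degree [r] over [K]. *)
Definition Lform (r : nat) (x : F) : Prop :=
  exists2 p : {mpoly K[n]}, p \is r.-homog & x = mmap iota xi p.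

Lemma Lform0 r : Lform r 0.
Proof. by exists 0; rewrite ?dhomog0 ?mmap0. Qed.

Lemma LformD r x y : Lform r x -> Lform r y -> Lform r (x + y).
Proof.
by move=> [p hp ->] [q hq ->]; exists (p + q); rewrite ?dhomogD ?mmapD.
Qed.

Lemma LformN r x : Lform r x -> Lform r (- x).
Proof. by move=> [p hp ->]; exists (- p); rewrite ?dhomogN ?mmapN. Qed.

Lemma LformM r s x y : Lform r x -> Lform s y -> Lform (r + s) (x * y).
Proof.
move=> [p hp ->] [q hq ->]; exists (p * q); first exact: dhomogM.
by rewrite rmorphM.
Qed.

Lemma LformZ r a x : Lform r x -> Lform r (iota a * x).
Proof.
by move=> [p hp ->]; exists (a *: p); rewrite ?dhomogZ ?mmapZ.
Qed.

Lemma Lform_sum r (I : Type) (s : seq I) (P : pred I) (f : I -> F) :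
  (forall i, P i -> Lform r (f i)) -> Lform r (\sum_(i <- s | P i) f i).
Proof.
by move=> h; elim/big_ind: _ => //; [exact: Lform0|exact: LformD].
Qed.

Lemma LformX i : Lform 1 (xi i).
Proof.
by exists 'X_i; [rewrite dhomogX /= mdeg1|rewrite mmapX mmap1U].
Qed.

Lemma LformXn i k : Lform k (xi i ^+ k).
Proof.
exists ('X_i ^+ k); last by rewrite rmorphXn /= mmapX mmap1U.
by have := @dhomogMn n K mdeg 1 'X_i k; rewrite mul1n dhomogX /= mdeg1; apply.
Qed.

Lemma Lform_mnm m : Lform (mdeg m) (mmap1 xi m).
Proof. by exists 'X_[m]; [rewrite dhomogX|rewrite mmapX]. Qed.

Lemma Lform_ind r (P : F -> Prop) :
  P 0 -> (forall a x y, P x -> P y -> P (iota a * x + y)) ->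
  (forall m, mdeg m = r -> P (mmap1 xi m)) -> forall x, Lform r x -> P x.
Proof.
move=> P0 PD Pm x [p /dhomogP hp ->]; rewrite /mmap big_seq.
elim/big_rec: _ => // m y hm Py; apply: PD => //; apply: Pm; exact: hp.
Qed.

Definition lam : {mpoly F[n]} := \sum_i xi i *: 'X_i.

Lemma mcoeffMXU (c : {mpoly F[n]}) (i : 'I_n) m :
  (c * 'X_i)@_m = if m i == 0%N then 0 else c@_(m - U_(i))%MM.
Proof.
case: eqP => [e|/eqP ne].
  apply: memN_msupp_eq0; apply/negP => /msuppM_le /allpairsP[[m1 m2] /= []].
  rewrite msuppX inE => _ /eqP -> e2; have := congr1 (fun u : 'X_{1..n} => u i) e2.
  by rewrite /= e mnmDE mnm1E eqxx addn1.
rewrite -{1}(@submK _ U_(i) m) ?lep1mP // addmC; exact: mcoeffMX.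
Qed.

(** Multiplication by the coefficients of [g] maps forms of degree [a + d] at [xi] to
    forms of degree [s + d]. With [s < a] the coefficients behave like
    quotients of forms of degree [s] by forms of degree [a]. *)
Definition carries (g : {mpoly F[n]}) (a s : nat) : Prop :=
  forall d g0 x, Lform (a + d) x -> Lform (s + d) (g@_g0 * x).

(** A Dedekind-Mertens argument: if the coefficients of [c lambda] multiply
    forms of degree [a + d] into forms of degree [s + d], those of [c] do the
    same with a larger gain. A coefficient [c_g] times a large power of [xi_i]
    is treated by descending induction on the exponent of [t_i] in [g]; a
    monomial of large degree is divisible by a large power of some [xi_i]. *)
Lemma carries_lam c a s : carries (c * lam) a s ->
  exists M, carries c (a + M.+1) (s + M).
Proof.
move=> h; pose e := msize c.
have key k (i : 'I_n) (g0 : 'X_{1..n}) d x : (e <= g0 i + k)%N -> Lform (a + d) x ->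
    Lform (s + d + k) (c@_g0 * xi i ^+ k.+1 * x).
  move=> le; elim: k g0 le x d => [|k IH] g0 le x d hx.
    rewrite memN_msupp_eq0 ?mul0r ?mul0r; first exact: Lform0.
    apply: msize_mdeg_ge; apply: leq_trans le _; rewrite addn0 mdegE.
    by rewrite (bigD1 i) //= leq_addr.
  have -> : c@_g0 * xi i ^+ k.+2 * x
      = (c * lam)@_(g0 + U_(i))%MM * x * xi i ^+ k.+1
        - \sum_(l | l != i) xi l * ((c * 'X_l)@_(g0 + U_(i))%MM * xi i ^+ k.+1 * x).
    have -> : (c * lam)@_(g0 + U_(i))%MM
       = c@_g0 * xi i + \sum_(l | l != i) xi l * (c * 'X_l)@_(g0 + U_(i))%MM.
      rewrite /lam mulr_sumr raddf_sum (bigD1 i) //=; congr (_ + _).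
        by rewrite -scalerAr mcoeffZ addmC mcoeffMX mulrC.
      by apply: eq_bigr => l _; rewrite -scalerAr mcoeffZ.
    rewrite [X in _ = X * _ * _ - _]addrC mulrDl mulrDl addrAC.
    rewrite mulr_suml mulr_suml -sumrB big1 ?add0r; first by rewrite [in LHS]exprS; ring.
    by move=> l _; ring.
  have -> : (s + d + k.+1 = s + d + k + 1)%N by lia.
  apply: LformD.
    have -> : (s + d + k + 1 = (s + d) + k.+1)%N by lia.
    exact: LformM (h _ _ _ hx) (LformXn _ _).
  apply/LformN/Lform_sum => l li; rewrite addnC; apply: LformM; first exact: LformX.
  rewrite mcoeffMXU; case: eqP => _; first by rewrite !mul0r; exact: Lform0.
  apply: IH hx; rewrite mnmBE mnmDE !mnm1E eqxx (negbTE li) subn0; lia.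
exists (n * e)%N => d g0.
apply: (@Lform_ind _ (fun x => Lform (s + n * e + d) (c@_g0 * x))).
- by rewrite mulr0; exact: Lform0.
- move=> b y z hy hz; rewrite mulrDr mulrCA; apply: LformD hz; exact: LformZ.
move=> m dm.
have [i hi] : exists i, (e < m i)%N.
  apply/existsP; apply: contraT; rewrite negb_exists => /forallP hm.
  have : (mdeg m <= n * e)%N.
    rewrite mdegE -[X in (_ <= X * _)%N]card_ord -sum_nat_const.
    by apply: leq_sum => j _; rewrite leqNgt hm.
  by rewrite dm; set q := (n * e)%N; lia.
pose m' := (m - U_(i) *+ e.+1)%MM.
have em : m = (U_(i) *+ e.+1 + m')%MM.
  apply/mnmP => j; rewrite mnmDE mnmBE mulmnE mnm1E.
  by case: eqP => [<-|_]; lia.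
have dm' : (e.+1 + mdeg m' = a + (n * e).+1 + d)%N.
  by rewrite -dm [in RHS]em mdegD mdegMn mdeg1 mul1n.
have n0 : (0 < n)%N by case: i {hi em dm' m'} => j /=; case: (n).
have le1 : (e <= n * e)%N by rewrite leq_pmull.
rewrite em commr_mmap1_M => [|j y]; last exact: mulrC.
have -> : mmap1 xi (U_(i) *+ e.+1)%MM = xi i ^+ e.+1.
  by have := mmapX xi iota (U_(i) *+ e.+1)%MM; rewrite -mpolyXn rmorphXn /= mmapX mmap1U.
rewrite mulrA; have -> : (s + n * e + d = s + (n * e - e + d) + e)%N by lia.
apply: key; first by rewrite leq_addl.
by have -> : (a + (n * e - e + d) = mdeg m')%N; [lia|exact: Lform_mnm].
Qed.

(** If the coefficients of [c lambda^(r+1)] are forms of degree [r], then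
    those of [c] multiply forms of some degree [s + 1] into forms of degree
    [s], and hence [c_g xi_i] preserves a finite-dimensional space. *)
Lemma divisible_by_lam_power (f c : {mpoly F[n]}) r a b :
  (forall m, Lform r f@_m) -> f = c * lam ^+ r.+1 ->
  xi b != 0 -> ~ algebraicOver iota (xi a / xi b) -> c = 0.
Proof.
move=> hf ef xb0 nalg; apply/eqP/negPn/negP => c0; apply: nalg.
have [s hs] : exists s, carries c s.+1 s.
  have : carries f 0 r.
    by move=> d g0 x hx; apply: LformM.
  rewrite ef; have : forall k c', carries (c' * lam ^+ k) 0 r ->
     exists M, carries c' (M + k) (r + M).
    elim=> [|k IH] c' h.
      by exists 0%N; move: h; rewrite expr0 mulr1 !addn0.
    have /IH[M hM] : carries (c' * lam * lam ^+ k) 0 r by rewrite -mulrA -exprS.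
    have [M' hM'] := carries_lam hM.
    exists (M + M')%N; rewrite addnA.
    by have -> : (M + M' + k.+1 = M + k + M'.+1)%N by lia.
  move=> H /H[M hM]; exists (r + M)%N.
  by have -> : ((r + M).+1 = M + r.+1)%N by lia.
have [g cg0] : exists g, c@_g != 0.
  by exists (mlead c); rewrite mleadc_eq0.
have stab i : forall x, Lform s x -> Lform s (c@_g * xi i * x).
  move=> x hx; rewrite -mulrA -[s]addn0; apply: hs; rewrite addn0 -add1n.
  exact: LformM (LformX i) hx.
have alg i : algebraicOver iota (c@_g * xi i).
  pose I : finType := {m : 'X_{1..n < s.+1} | mdeg m == s}.
  pose v (m : I) := mmap1 xi (val (val m)).
  have [A hA] : exists A : I -> I -> K, forall m, c@_g * xi i * v m = \sum_m' iota (A m m') * v m'.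
    suff /boolp.choice[A hA] : forall m, exists w : I -> K,
        c@_g * xi i * v m = \sum_m' iota (w m') * v m' by exists A.
    move=> m; have : Lform s (c@_g * xi i * v m).
      by apply: stab; rewrite -(eqP (valP m)); exact: Lform_mnm.
    apply: (@Lform_ind s (fun y => exists w : I -> K, y = \sum_m' iota (w m') * v m')).
    - by exists (fun=> 0); rewrite big1 // => j _; rewrite rmorph0 mul0r.
    - move=> d x y [w1 ->] [w2 ->]; exists (fun j => d * w1 j + w2 j).
      rewrite mulr_sumr -big_split; apply: eq_bigr => j _ /=.
      by rewrite rmorphD rmorphM mulrDl mulrA.
    - move=> m' dm'; have lt : (mdeg m' < s.+1)%N by rewrite dm'.
      have P : mdeg (BMultinom lt) == s by rewrite /= dm'.
      exists (fun j => (j == exist _ (BMultinom lt) P)%:R).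
      rewrite (bigD1 (exist _ (BMultinom lt) P)) //= eqxx rmorph1 mul1r.
      by rewrite big1 ?addr0 // => j /negbTE ->; rewrite rmorph0 mul0r.
  apply: eigen_algebraic hA.
  have lt : (mdeg (U_(b) *+ s)%MM < s.+1)%N by rewrite mdegMn mdeg1 mul1n.
  have P : mdeg (BMultinom lt) == s by rewrite /= mdegMn mdeg1 mul1n.
  exists (exist _ (BMultinom lt) P); rewrite /v /=.
  have := mmapX xi iota (U_(b) *+ s)%MM; rewrite -mpolyXn rmorphXn /= mmapX mmap1U => <-.
  exact: expf_neq0.
have -> : xi a / xi b = (c@_g * xi a) / (c@_g * xi b).
  by rewrite -mulf_div mulfV // mul1r.
exact: algebraic_div.
Qed.

End Forms.

Local Open Scope quotient_scope.

Notation "x %:F" := (@FracField.tofrac _ x).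

(** * Fraction fields *)

Lemma frac_numden (R : idomainType) (r : {ratio R}) :
  \pi_({fraction R}) r = (frac r).1%:F / (frac r).2%:F.
Proof.
have d0 : (frac r).2 != 0 by case: r => [[? ?] ?].
apply: (canRL (mulfK _)); first by rewrite tofrac_eq0.
unlock FracField.tofrac; rewrite -[LHS]FracField.pi_mul; apply/eqmodP.
rewrite /= FracField.equivfE /= /FracField.mulf !numden_Ratio ?mulr1 ?oner_eq0 //.
by rewrite mulrC.
Qed.

Lemma fracE (R : idomainType) (x : {fraction R}) :
  exists a b : R, b != 0 /\ x = a%:F / b%:F.
Proof.
rewrite -[x]reprK frac_numden; exists (frac (repr x)).1, (frac (repr x)).2.
by split=> //; case: (repr x) => [[? ?] ?].
Qed.

Section Lift.
Variables (R : idomainType) (F : fieldType) (f : {rmorphism R -> F}).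
Hypothesis f_inj : forall x, f x = 0 -> x = 0.

Definition flift (_ : forall x, f x = 0 -> x = 0) (x : {fraction R}) : F :=
  f (frac (repr x)).1 / f (frac (repr x)).2.

Lemma fliftE a b : b != 0 -> flift f_inj (a%:F / b%:F) = f a / f b.
Proof.
move=> b0; set x := _ / _; rewrite /flift.
have [] : exists c d, d != 0 /\ x = c%:F / d%:F /\ frac (repr x) = (c, d).
  exists (frac (repr x)).1, (frac (repr x)).2; split.
    by case: (repr x) => [[? ?] ?].
  by rewrite -frac_numden reprK; split=> //; case: (frac _).
move=> c [d [d0 [ex ->]]] /=.
have fb : f b != 0 by apply: contraNneq b0 => /f_inj ->.
have fd : f d != 0 by apply: contraNneq d0 => /f_inj ->.
have : a * d = c * b.
  apply/eqP; rewrite -tofrac_eq !tofracM; apply/eqP.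
  have b0' : b%:F != 0 by rewrite tofrac_eq0.
  have d0' : d%:F != 0 by rewrite tofrac_eq0.
  apply/eqP; rewrite -(eqr_div _ _ b0' d0'); exact/eqP.
move/(congr1 f); rewrite !rmorphM => e.
by apply/eqP; rewrite eqr_div // -e.
Qed.

Lemma flift_additive : zmod_morphism (flift f_inj).
Proof.
move=> x y; have [a [b [b0 ->]]] := fracE x; have [c [d [d0 ->]]] := fracE y.
have fb : f b != 0 by apply: contraNneq b0 => /f_inj ->.
have fd : f d != 0 by apply: contraNneq d0 => /f_inj ->.
have b0' : b%:F != 0 by rewrite tofrac_eq0.
have d0' : d%:F != 0 by rewrite tofrac_eq0.
have -> : a%:F / b%:F - c%:F / d%:F = (a * d - c * b)%:F / (b * d)%:F.
  by rewrite tofracB !tofracM -mulNr addf_div // mulNr.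
rewrite !fliftE ?mulf_neq0 // rmorphB !rmorphM -mulNr -[in RHS]mulNr addf_div // mulNr.
Qed.

Lemma flift_multiplicative : monoid_morphism (flift f_inj).
Proof.
split.
  have -> : 1 = 1%:F / 1%:F :> {fraction R} by rewrite tofrac1 divr1.
  by rewrite fliftE ?oner_eq0 // rmorph1 divr1.
move=> x y; have [a [b [b0 ->]]] := fracE x; have [c [d [d0 ->]]] := fracE y.
by rewrite mulf_div -!tofracM !fliftE ?mulf_neq0 // mulf_div !rmorphM.
Qed.

HB.instance Definition _ := GRing.isZmodMorphism.Build _ _ (flift f_inj) flift_additive.
HB.instance Definition _ := GRing.isMonoidMorphism.Build _ _ (flift f_inj) flift_multiplicative.

Lemma exists_flift : exists g : {rmorphism {fraction R} -> F}, forall x, g x%:F = f x.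
Proof.
exists (flift f_inj) => x.
rewrite /=; have -> : x%:F = x%:F / 1%:F by rewrite tofrac1 divr1.
by rewrite fliftE ?oner_eq0 // rmorph1 divr1.
Qed.

End Lift.

Lemma common_denominator (R : idomainType) (I : finType) (x : I -> {fraction R}) :
  exists (d : R) (a : I -> R), d != 0 /\ forall i, x i = (a i)%:F / d%:F.
Proof.
have /boolp.choice[a ha] : forall i, exists ab : R * R, ab.2 != 0 /\ x i = ab.1%:F / ab.2%:F.
  by move=> i; have [a [b ?]] := fracE (x i); exists (a, b).
exists (\prod_i (a i).2), (fun i => (a i).1 * \prod_(j | j != i) (a j).2).
split; first by apply/prodf_neq0 => i _; case: (ha i).
move=> i; have [h ->] := ha i.
rewrite [X in _ = _ / X%:F](bigD1 i) //= !tofracM -mulf_div divff ?mulr1 //.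
by rewrite tofrac_eq0; apply/prodf_neq0 => j _; case: (ha j).
Qed.

Local Close Scope quotient_scope.

(** * Algebraic independence *)

Section Indep.
Variables (K F : fieldType) (iota : {rmorphism K -> F}).

Definition indep d (y : 'I_d -> F) : Prop :=
  forall f : {mpoly K[d]}, mmap iota y f = 0 -> f = 0.

Lemma mmap_eq d (y z : 'I_d -> F) : y =1 z -> mmap iota y =1 mmap iota z.
Proof.
move=> e f; rewrite /mmap; apply: eq_bigr => m _; congr (_ * _).
by rewrite /mmap1; apply: eq_bigr => i _; rewrite e.
Qed.

Lemma mmap_rename d e (s : 'I_d -> 'I_e) (y : 'I_e -> F) (f : {mpoly K[d]}) :
  mmap iota y (mmap (@mpolyC e K) (fun i => 'X_(s i)) f) = mmap iota (y \o s) f.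
Proof.
elim/mpolyind: f => [|c m f _ _ IH]; first by rewrite !mmap0.
rewrite !mmapD IH; congr (_ + _); rewrite !mmapZ rmorphM /= mmapC; congr (_ * _).
rewrite !mmapX /mmap1 rmorph_prod; apply: eq_bigr => i _.
by rewrite rmorphXn /= mmapX mmap1U.
Qed.

Lemma indep_inj d e (s : 'I_d -> 'I_e) (y : 'I_e -> F) :
  injective s -> indep y -> indep (y \o s).
Proof.
move=> sI hy f; rewrite -mmap_rename => /hy e0; apply/mpolyP => m.
pose M (u : 'X_{1..d}) := [multinom (\sum_(i | s i == j) u i)%N | j < e].
have key (g : {mpoly K[d]}) : (mmap (@mpolyC e K) (fun i => 'X_(s i)) g)@_(M m) = g@_m.
  elim/mpolyind: g => [|c m' g _ _ IH]; first by rewrite mmap0 !mcoeff0.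
  rewrite mmapD !mcoeffD IH; congr (_ + _).
  rewrite mmapZ mul_mpolyC !mcoeffZ mmapX mcoeffX; congr (_ * _).
  have -> : mmap1 (fun i => 'X_(s i)) m' = 'X_[M m'] :> {mpoly K[e]}.
    rewrite [in RHS]mpolyXE_id /mmap1.
    under [in RHS]eq_bigr do rewrite mnmE -prodrXr.
    rewrite (exchange_big_dep predT) //=; apply: eq_bigr => i _.
    by rewrite (big_pred1 (s i)) // => j; rewrite eq_sym.
  rewrite mcoeffX; congr (nat_of_bool _)%:R.
  apply/eqP/eqP => [e1|-> //]; apply/mnmP => i.
  have := congr1 (fun u : 'X_{1..e} => u (s i)) e1; rewrite !mnmE.
  by rewrite !(big_pred1 i) // => j; rewrite (inj_eq sI).
by rewrite -key e0 !mcoeff0.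
Qed.

Lemma indep_neq0 d (y : 'I_d -> F) i : indep y -> y i != 0.
Proof.
move=> hy; apply/eqP => e; have : 'X_i = 0 :> {mpoly K[d]}.
  by apply: hy; rewrite mmapX mmap1U.
by move/(congr1 (mcoeff U_(i)%MM)); rewrite mcoeffX eqxx mcoeff0 => /eqP; rewrite oner_eq0.
Qed.

Lemma indep_index_inj d e (T : 'I_d -> 'I_e) (y : 'I_e -> F) :
  indep (y \o T) -> injective T.
Proof.
move=> hy i j eT; apply/eqP/negPn/negP => ne.
have : 'X_i - 'X_j = 0 :> {mpoly K[d]}.
  by apply: hy; rewrite mmapB !mmapX !mmap1U /= eT subrr.
move/(congr1 (mcoeff U_(i)%MM)); rewrite mcoeffB !mcoeffXU eqxx mcoeff0.
by rewrite eq_sym (negbTE ne) subr0 => /eqP; rewrite oner_eq0.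
Qed.

(** An independent family minus one element generates a field over which this
    element is transcendental. *)
Lemma indep_transcendental d (y : 'I_d.+1 -> F) (a : 'I_d.+1) : indep y ->
  exists2 iota2 : {rmorphism {fraction {mpoly K[d]}} -> F},
    (forall g, iota2 g%:F = mmap iota (y \o lift a) g) &
    ~ algebraicOver iota2 (y a).
Proof.
move=> hy; have hya : indep (y \o lift a) by apply: indep_inj => //; exact: lift_inj.
have [iota2 h2] := exists_flift (f := mmap iota (y \o lift a)) hya.
exists iota2 => //; case=> p p0 /eqP; rewrite horner_coef size_map_poly => px0.
have [d0 [c [d0n hc]]] := common_denominator (fun i : 'I_(size p) => p`_i).
pose ren := mmap (@mpolyC d.+1 K) (fun k => 'X_(lift a k)).
pose Q : {mpoly K[d.+1]} := \sum_(i < size p) ren (c i) * 'X_a ^+ i.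
have d0F : d0%:F != 0 by rewrite tofrac_eq0.
have Q0 : mmap iota y Q = 0.
  rewrite -[RHS](mulr0 (iota2 d0%:F)) -px0 mulr_sumr /Q raddf_sum /=.
  apply: eq_bigr => i _; rewrite coef_map hc /= rmorphM rmorphXn /= mmapX mmap1U.
  by rewrite [RHS]mulrA -[iota2 d0%:F * _]rmorphM [d0%:F * _]mulrC divfK // h2 /ren mmap_rename.
have {}Q0 := hy _ Q0.
pose h k := if unlift a k is Some j then ('X_j)%:P else 'X : {poly {mpoly K[d]}}.
pose back := mmap (polyC \o @mpolyC d K) h.
have back_ren g : back (ren g) = g%:P.
  elim/mpolyind: g => [|e m g _ _ IH]; first by rewrite /back /ren !mmap0.
  rewrite /back /ren !mmapD -/back -/ren IH polyCD; congr (_ + _).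
  rewrite /ren mmapZ /back rmorphM /= mmapC [in LHS]mmapX -mul_mpolyC polyCM; congr (_ * _).
  rewrite /mmap1 rmorph_prod mpolyXE_id rmorph_prod; apply: eq_bigr => i _.
  by rewrite !rmorphXn /= mmapX mmap1U /h liftK.
have e : \sum_(i < size p) (c i)%:P * 'X ^+ i = 0.
  have := congr1 back Q0; rewrite /back mmap0 /Q raddf_sum /= => {2}<-.
  apply: eq_bigr => i _; rewrite rmorphM rmorphXn /= mmapX mmap1U.
  by rewrite -/back back_ren /h unlift_none.
case/negP: p0; apply/eqP/polyP => k; rewrite coef0.
have [lt|ge] := ltnP k (size p); last by rewrite nth_default.
have := congr1 (fun q : {poly _} => q`_k) e; rewrite coef_sum coef0.
rewrite (bigD1 (Ordinal lt)) //= coefCM coefXn eqxx mulr1 big1 ?addr0.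
  by move=> ck; rewrite (hc (Ordinal lt)) ck tofrac0 mul0r.
move=> j ne; rewrite coefCM coefXn; case: eqP => [ek|_]; last by rewrite mulr0.
by case/eqP: ne; apply: val_inj.
Qed.

End Indep.

(** * Generic hyperplane sections of a point *)

(** Some [d] of the coordinates are algebraically independent; for points with
    coordinates generating the field this is [trdeg >= d]. *)
Definition trdeg_ge (K F : fieldType) (iota : {rmorphism K -> F}) n
    (xi : 'I_n -> F) (d : nat) : Prop :=
  exists T : 'I_d -> 'I_n, indep iota (xi \o T).

Definition fieldt (K : fieldType) n : fieldType := {fraction {mpoly K[n]}}.

Lemma algebraicOver_factor (K E F : fieldType) (i1 : {rmorphism K -> F})
    (j : {rmorphism K -> E}) (i2 : {rmorphism E -> F}) x :
  (forall a, i1 a = i2 (j a)) -> algebraicOver i1 x -> algebraicOver i2 x.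
Proof.
move=> e [p p0 px]; exists (map_poly j p); first by rewrite map_poly_eq0.
rewrite -map_poly_comp; move: px; rewrite (eq_map_poly (g := i2 \o j)) //.
Qed.

Section Section1.
Variables (K F : fieldType) (iota : {rmorphism K -> F}) (n : nat).
Variable xi : 'I_n.+1 -> F.
Local Notation l := (lam xi).
Local Notation R := {mpoly F[n.+1]}.

Variable i0 : 'I_n.+1.
Hypothesis xi0 : xi i0 != 0.

(** Solving [lam xi = 0] for the variable [i0]. *)
Let sub_ (i : 'I_n.+1) : R := if i == i0 then
  (- (xi i0)^-1) *: \sum_(j | j != i0) xi j *: 'X_j else 'X_i.
Let sol : R -> R := mmap (@mpolyC n.+1 F) sub_.

Lemma lam_split : l = xi i0 *: 'X_i0 + \sum_(j | j != i0) xi j *: 'X_j.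
Proof. by rewrite /lam (bigD1 i0). Qed.

Lemma solX i : sol 'X_i = sub_ i.
Proof. by rewrite /sol mmapX mmap1U. Qed.

Lemma sol_lam : sol l = 0.
Proof.
rewrite lam_split /sol mmapD mmapZ -/sol solX /sub_ eqxx [X in _ + X]raddf_sum /=.
rewrite mul_mpolyC scalerA mulrN mulfV // scaleN1r addrC.
apply/eqP; rewrite subr_eq0; apply/eqP; apply: eq_bigr => j /negbTE nj.
by rewrite mmapZ -/sol solX /sub_ nj mul_mpolyC.
Qed.

Lemma sol_mod f : exists c, f - sol f = c * l.
Proof.
have hX i : exists c, 'X_i - sol 'X_i = c * l.
  rewrite solX /sub_; case: eqP => [->|_]; last by exists 0; rewrite subrr mul0r.
  exists (xi i0)^-1%:MP; rewrite lam_split mul_mpolyC scalerDr scalerA mulVf //.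
  by rewrite scale1r scaleNr opprK.
have hM f1 f2 : (exists c, f1 - sol f1 = c * l) -> (exists c, f2 - sol f2 = c * l) ->
   exists c, f1 * f2 - sol (f1 * f2) = c * l.
  move=> [c1 e1] [c2 e2]; exists (c1 * f2 + sol f1 * c2).
  rewrite /sol rmorphM /= -/sol mulrDl -mulrA [f2 * l]mulrC mulrA -e1 -mulrA -e2.
  ring.
elim/mpolyind: f => [|c m f _ _ [c2 e2]].
  by exists 0; rewrite /sol mmap0 subr0 mul0r.
have [c1 e1] : exists c, 'X_[m] - sol 'X_[m] = c * l.
  rewrite mpolyXE_id; elim/big_rec: _ => [|i g _ IH].
    by exists 0; rewrite /sol rmorph1 subrr mul0r.
  apply: (fun h => hM _ _ h IH); elim: (m i) => [|k IHk].
    by exists 0; rewrite expr0 /sol rmorph1 subrr mul0r.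
  by rewrite exprS; exact: (hM _ _ (hX i) IHk).
exists (c%:MP * c1 + c2); rewrite mulrDl -mulrA -e1 -e2 /sol mmapD mmapZ.
by rewrite mulrBr -mul_mpolyC opprD addrACA.
Qed.

Lemma sol_ker f : sol f = 0 -> exists c, f = c * l.
Proof. by move=> e; have [c] := sol_mod f; rewrite e subr0 => ->; exists c. Qed.

End Section1.

Section Section2.
Variables (K F : fieldType) (iota : {rmorphism K -> F}) (n : nat).
Variable xi : 'I_n.+1 -> F.
Local Notation l := (lam xi).

Lemma lam_ker_exists i0 : xi i0 != 0 ->
  exists s : {rmorphism {mpoly F[n.+1]} -> fieldt F n.+1},
    s l = 0 /\ forall f, s f = 0 -> exists c, f = c * l.
Proof.
move=> xi0; pose sub_ (i : 'I_n.+1) : {mpoly F[n.+1]} := if i == i0 then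
  (- (xi i0)^-1) *: \sum_(j | j != i0) xi j *: 'X_j else 'X_i.
exists (@FracField.tofrac _ \o mmap (@mpolyC n.+1 F) sub_); split=> [|f] /=.
  by rewrite sol_lam // tofrac0.
by move/eqP; rewrite tofrac_eq0 => /eqP; exact: sol_ker.
Qed.

(** If the coefficients of a multiple of [lam xi] are polynomials in elements
    over which some ratio [xi_a / xi_b] is transcendental, it vanishes. *)
Lemma lam_multiple0 (E : fieldType) (i2 : {rmorphism E -> F}) a b
    (g : {mpoly F[n.+1]}) c :
  (forall m, exists e, g@_m = i2 e) -> xi b != 0 ->
  ~ algebraicOver i2 (xi a / xi b) -> g = c * l -> g = 0.
Proof.
move=> hg xb nalg eg; suff c0 : c = 0 by rewrite eg c0 mul0r.
apply: (divisible_by_lam_power (r := 0) (iota := i2) (f := g) _ eg xb nalg) => m.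
have [e ->] := hg m; exists e%:MP; last by rewrite mmapC.
by rewrite dhomogE msuppC; case: ifP => //= _; rewrite mdeg0.
Qed.

(** The coordinates of the section live in the function field of [lam xi = 0], which is
    rational: solve for one [t_i]. Dropping one of the independent coordinates, the
    others remain independent over [K(t)]: a relation among them would, after clearing
    denominators, be a multiple of [lam xi] with coefficients in the field that they
    generate over [K], which [lam_multiple0] excludes. *)
Lemma section_point d : trdeg_ge iota xi d.+2 ->
  exists (F' : fieldType) (iota' : {rmorphism fieldt K n.+1 -> F'})
     (s : {rmorphism {mpoly F[n.+1]} -> F'}),
  [/\ forall g, iota' g%:F = s (map_mpoly iota g),
      s l = 0,
      forall f, s f = 0 -> exists c, f = c * l
    & trdeg_ge iota' (fun i : 'I_n => s (xi (widen_ord (leqnSn n) i))%:MP) d.+1].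
Proof.
move=> [T hT]; have TI := indep_index_inj hT.
have nz k : xi (T k) != 0 by exact: (indep_neq0 k hT).
pose a : 'I_d.+2 := if [pick k | T k == ord_max] is Some k then k else ord0.
pose T1 := T \o lift a.
have T1n k : T1 k != ord_max.
  rewrite /T1 /= /a; case: pickP => [k' /eqP e|/(_ (lift ord0 k))->//].
  by rewrite -e (inj_eq TI) eq_sym neq_lift.
pose b := lift a ord0.
have [i2 h2 nalg2] := indep_transcendental a hT.
have ratio : ~ algebraicOver i2 (xi (T a) / xi (T b)).
  move=> h; apply: nalg2 => /=.
  have -> : xi (T a) = xi (T a) / xi (T b) * i2 ('X_ord0)%:F.
    by rewrite h2 mmapX mmap1U /= divfK.
  exact: algebraic_mul h (algebraic_id _ _).
have [s [sl sker]] := lam_ker_exists (nz b).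
have thI (g : {mpoly K[n.+1]}) : s (map_mpoly iota g) = 0 -> g = 0.
  move=> /sker[c eg]; have : map_mpoly iota g = 0.
    apply: (lam_multiple0 (i2 := i2)) (nz b) ratio eg => m.
    by exists (g@_m)%:MP%:F; rewrite h2 mmapC mcoeff_map_mpoly.
  move=> e; apply/mpolyP => m; apply/eqP; rewrite mcoeff0 -(fmorph_eq0 iota).
  by rewrite -mcoeff_map_mpoly e mcoeff0.
have [iota' hi'] := exists_flift (f := s \o map_mpoly iota) thI.
exists _, iota', s; split=> //.
have lt k : (T1 k < n)%N.
  by have := T1n k; rewrite -val_eqE /=; have := ltn_ord (T1 k); lia.
exists (fun k => Ordinal (lt k)) => f.
rewrite (@mmap_eq _ _ iota' _ _ (fun k => s (xi (T1 k))%:MP)); last first.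
  by move=> k /=; congr (s (xi _)%:MP); apply: val_inj.
(* clearing denominators, the relation has coefficients in K[t] *)
have [d0 [c [d0n hc]]] := common_denominator
  (fun m : 'X_{1..d.+1 < msize f} => f@_m).
have d0F : d0%:F != 0 by rewrite tofrac_eq0.
pose y := xi \o T1.
rewrite (mmapE (msize f)) // => f0.
pose G := \sum_(m : 'X_{1..d.+1 < msize f}) map_mpoly iota (c m) * (mmap1 y m)%:MP.
have sG : s G = 0.
  rewrite -[RHS](mulr0 (iota' d0%:F)) -f0 mulr_sumr /G raddf_sum /=.
  apply: eq_bigr => m _; rewrite rmorphM -[s (map_mpoly _ _)]hi' hc.
  rewrite [RHS]mulrA -[iota' d0%:F * _]rmorphM [d0%:F * _]mulrC divfK //.
  congr (_ * _); rewrite /mmap1 !rmorph_prod; apply: eq_bigr => i _.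
  by rewrite !rmorphXn.
pose gu (u : 'X_{1..n.+1}) : {mpoly K[d.+1]} :=
  \sum_(m : 'X_{1..d.+1 < msize f}) (c m)@_u *: 'X_[m].
have Gu u : G@_u = i2 (gu u)%:F.
  rewrite h2 /gu /G !raddf_sum /=; apply: eq_bigr => m _.
  by rewrite mmapZ mmapX mulrC mcoeffCM mcoeff_map_mpoly mulrC.
have [c' ec'] := sker _ sG.
have G0 : G = 0.
  by apply: (lam_multiple0 (i2 := i2)) (nz b) ratio ec' => m; rewrite Gu; eexists.
have gu0 u : gu u = 0.
  apply/eqP; rewrite -tofrac_eq0 -(fmorph_eq0 i2) -Gu G0 mcoeff0 //.
have cm0 m : c m = 0.
  apply/mpolyP => u; rewrite mcoeff0.
  have := congr1 (mcoeff (m : 'X_{1..d.+1})) (gu0 u).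
  rewrite mcoeff0 /gu raddf_sum (bigD1 m) //= mcoeffZ mcoeffX eqxx mulr1.
  rewrite big1 ?addr0 // => m' ne; rewrite mcoeffZ mcoeffX.
  by rewrite -bmeqP (negbTE ne) mulr0.
apply/mpolyP => m; rewrite mcoeff0.
have [lt'|ge] := ltnP (mdeg m) (msize f); last first.
  by apply: memN_msupp_eq0; exact: msize_mdeg_ge.
by have := hc (BMultinom lt'); rewrite cm0 tofrac0 mul0r.
Qed.
End Section2.

(** * Multipliers *)

(** The certificate that an algebraic element is not a scalar which survives purely
    transcendental extensions of the base field ([rootfree_fieldt]). *)
Definition rootfree (K : fieldType) (mu : {poly K}) : Prop := forall a, ~~ root mu a.

Lemma ord_le_pred m (k : 'I_m) : (k <= m.-1)%N.
Proof. by case: m k => [[]//|m] k; rewrite -ltnS ltn_ord. Qed.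

Lemma rootfree_neq0 (K : fieldType) (mu : {poly K}) : rootfree mu -> mu != 0.
Proof. by move=> h; apply: contraNneq (h 0) => ->; rewrite root0. Qed.

Lemma mcoeff_expW (K : fieldType) d (p : {mpoly K[d]}) m k :
  (mlead p <= m)%O -> (mlead (p ^+ k) <= (m *+ k)%MM)%O /\ (p ^+ k)@_(m *+ k)%MM = p@_m ^+ k.
Proof.
move=> le; elim: k => [|k [IH1 IH2]].
  by rewrite expr0 mlead1 mulm0n lexx expr0 mcoeff1 eqxx.
rewrite exprS mulmS; split; last by rewrite mleadcMW // IH2 exprS.
apply: le_trans (mleadM_le _ _) _; exact: lem_add.
Qed.

(** A polynomial without roots in [K] has none in a purely transcendental
    extension: compare leading coefficients. *)
Lemma rootfree_mpoly (K : fieldType) (mu : {poly K}) d (a b : {mpoly K[d]}) :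
  rootfree mu -> b != 0 ->
  \sum_(k < size mu) mu`_k *: (a ^+ k * b ^+ ((size mu).-1 - k)) != 0.
Proof.
move=> mufree b0; pose m := Order.max (mlead a) (mlead b).
have am : (mlead a <= m)%O by rewrite le_max lexx.
have bm : (mlead b <= m)%O by rewrite le_max lexx orbT.
pose e := (size mu).-1; have se : size mu = e.+1.
  by rewrite prednK // size_poly_gt0 rootfree_neq0.
apply/eqP => /(congr1 (mcoeff (m *+ e)%MM)); rewrite mcoeff0 raddf_sum /=.
have -> : \sum_(k < size mu) (mu`_k *: (a ^+ k * b ^+ ((size mu).-1 - k)))@_(m *+ e)%MM
   = \sum_(k < size mu) mu`_k * (a@_m ^+ k * b@_m ^+ (e - k)).
  apply: eq_bigr => k _; rewrite mcoeffZ; congr (_ * _).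
  have ke : (k <= e)%N by rewrite -ltnS -se.
  have [h1 h2] := mcoeff_expW k am; have [h3 h4] := mcoeff_expW (e - k) bm.
  have -> : (m *+ e = m *+ k + m *+ (e - k))%MM.
    by apply/mnmP => i; rewrite mnmDE !mulmnE -mulnDr subnKC.
  by rewrite mleadcMW // h2 h4.
have [bm0|bm0] := eqVneq b@_m 0.
  have lt : (mlead b < m)%O.
    rewrite lt_neqAle bm andbT; apply: contraNneq b0 => e1.
    by rewrite -mleadc_eq0 e1 bm0.
  have mE : m = mlead a.
    by move: lt; rewrite {1}/m /m maxElt; case: ifP => // _; rewrite ltxx.
  have a0 : a@_m != 0.
    rewrite mE mleadc_eq0; apply/eqP => a0; move: lt.
    by rewrite mE a0 mlead0 ltNge le0m.
  rewrite bm0 se big_ord_recr /= big1 ?add0r => [|k _]; last first.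
    by rewrite expr0n subn_eq0 leqNgt ltn_ord mulr0 mulr0.
  rewrite subnn expr0 mulr1 => /eqP; rewrite mulf_eq0 expf_eq0 (negbTE a0) andbF orbF.
  by rewrite -[e]/((size mu).-1) lead_coef_eq0 (negbTE (rootfree_neq0 mufree)).
move=> h; have := mufree (a@_m / b@_m); rewrite /root horner_coef.
case/eqP; apply: (mulIf (expf_neq0 e bm0)); rewrite mul0r -[RHS]h mulr_suml.
apply: eq_bigr => k _; rewrite -mulrA; congr (_ * _).
have ke : (k <= e)%N by rewrite -ltnS -se.
by rewrite -[in LHS](subnKC ke) exprD expr_div_n mulrA divfK // expf_neq0.
Qed.

Lemma rootfree_fieldt (K : fieldType) n (mu : {poly K}) (j : {rmorphism K -> fieldt K n}) :
  (forall a, j a = (a%:MP)%:F) -> rootfree mu -> rootfree (map_poly j mu).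
Proof.
move=> hj mufree x; apply/negP; have [a [b [b0 ->]]] := fracE x.
have bF : b%:F != 0 by rewrite tofrac_eq0.
rewrite /root horner_coef size_map_poly => /eqP h.
case/eqP: (rootfree_mpoly a mufree b0); apply/eqP; rewrite -tofrac_eq0; apply/eqP.
rewrite -[RHS](mulr0 (b%:F ^+ (size mu).-1)) -h mulr_sumr raddf_sum /=.
apply: eq_bigr => k _; rewrite coef_map /= hj -mul_mpolyC !tofracM !tofracXn.
have ke : (k <= (size mu).-1)%N by exact: ord_le_pred.
rewrite [RHS]mulrCA; congr (_ * _); rewrite -[in RHS](subnK ke) exprD expr_div_n.
by rewrite -mulrA [b%:F ^+ k * _]mulrC divfK ?expf_neq0 // mulrC.
Qed.

(** Removing its roots in [K] from a polynomial vanishing at [c]. *)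
Lemma exists_rootfree (K F : fieldType) (iota : {rmorphism K -> F}) (c : F) :
  algebraicOver iota c -> (forall a, iota a <> c) ->
  exists2 mu, rootfree mu & root (map_poly iota mu) c.
Proof.
move=> [p p0 pc] hc; have [k] := ubnP (size p); elim: k p p0 pc => // k IH p p0 pc lt.
have [fr|] := boolp.EM (rootfree p); first by exists p.
move/boolp.existsNP => [a /negP/negPn /factor_theorem[q eq]].
have q0 : q != 0 by apply: contraNneq p0 => q0; rewrite eq q0 mul0r.
apply: (IH q) => //; last first.
  by move: lt; rewrite eq size_Mmonic ?monicXsubC // size_XsubC addn2.
move: pc; rewrite eq rmorphM rootM rmorphB /= map_polyX map_polyC /= root_XsubC.
by case/orP => // /eqP e; case: (hc a).
Qed.

Section Multiplier.
Variables (K : fieldType) (n : nat) (J : Type) (F : J -> fieldType).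
Variables (iota : forall j, {rmorphism K -> F j}) (xi : forall j, 'I_n -> F j).

Definition vanish (u : 'rV[K]_n) : Prop :=
  forall j, \sum_i iota j (u 0 i) * xi j i = 0.

Lemma vanish_subspace : subspace vanish.
Proof.
split=> [j|a u v hu hv j].
  by rewrite big1 // => i _; rewrite mxE rmorph0 mul0r.
have -> : \sum_i iota j ((a *: u + v) 0 i) * xi j i
   = iota j a * (\sum_i iota j (u 0 i) * xi j i) + \sum_i iota j (v 0 i) * xi j i.
  rewrite mulr_sumr -big_split; apply: eq_bigr => i _ /=.
  by rewrite !mxE rmorphD rmorphM; ring.
by rewrite hu hv mulr0 addr0.
Qed.

(** Multiplication by the family [c] preserves the linear forms at [xi], but
    [c] does not come from a single scalar of [K]. *)
Definition multiplier : Prop :=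
  exists (Phi : 'M[K]_n) (c : forall j, F j),
   (forall j k, \sum_i iota j (Phi k i) * xi j i = c j * xi j k) /\
   ((exists j mu, rootfree mu /\ root (map_poly (iota j) mu) (c j)) \/
    (exists j j' k k', k <> k' /\ c j = iota j k /\ c j' = iota j' k')).

Lemma not_scalar_multiplier d (Phi : 'M[K]_n) (c : forall j, F j) :
  (forall j, trdeg_ge (iota j) (xi j) d.+1) ->
  (forall j k, \sum_i iota j (Phi k i) * xi j i = c j * xi j k) ->
  ~ (exists k, forall j, c j = iota j k) -> multiplier.
Proof.
move=> htr hPhi nsc; exists Phi, c; split=> //.
have alg j : algebraicOver (iota j) (c j).
  apply: (eigen_algebraic (A := fun k i => Phi k i) (v := xi j)) => [|k]; last by rewrite hPhi.
  by have [T hT] := htr j; exists (T ord0); exact: (indep_neq0 ord0 hT).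
have [h|] := boolp.EM (forall j, exists k, c j = iota j k); last first.
  move/boolp.existsNP => [j hj]; left; exists j.
  have [|mu h1 h2] := exists_rootfree (alg j); last by exists mu.
  by move=> a ea; apply: hj; exists a.
right; have [[j0 _]|nJ] := boolp.EM (exists j : J, True); last first.
  by case: nsc; exists 0 => j; case: nJ; exists j.
have [k0 ck0] := h j0.
have [|/boolp.existsNP[j hj]] := boolp.EM (forall j, c j = iota j k0).
  by move=> hk; case: nsc; exists k0.
have [k ck] := h j; exists j0, j, k0, k; split=> // e.
by apply: hj; rewrite ck e.
Qed.

(** If some [c_j] is not a scalar, the [d] independent coordinates of the point and
    their products with [c_j] are independent over [K]: in a relation [c_j] would be a
    quotient of linear forms in independent elements, and a polynomial without roots
    in [K] has no root there. If [c_j] and [c_j'] are different scalars, the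
    eigenspaces of [Phi] separate [d] independent coordinates of one point from those
    of the other. *)
Lemma multiplier_rank d : (forall j, trdeg_ge (iota j) (xi j) d) -> multiplier ->
  exists G : 'M[K]_(d + d, n), forall a : 'rV_(d + d), vanish (a *m G) -> a = 0.
Proof.
move=> htr [Phi [c [hPhi hc]]].
have ev j m (a : 'rV[K]_m) (G : 'M[K]_(m, n)) :
    \sum_i iota j ((a *m G) 0 i) * xi j i
    = \sum_k iota j (a 0 k) * \sum_i iota j (G k i) * xi j i.
  under eq_bigr do rewrite mxE rmorph_sum mulr_suml.
  rewrite exchange_big; apply: eq_bigr => k _; rewrite mulr_sumr.
  by apply: eq_bigr => i _; rewrite rmorphM mulrA.
have ind j (T : 'I_d -> 'I_n) (a : 'rV[K]_d) : indep (iota j) (xi j \o T) ->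
    \sum_k iota j (a 0 k) * xi j (T k) = 0 -> a = 0.
  move=> hT e; have : \sum_k a 0 k *: 'X_k = 0 :> {mpoly K[d]}.
    apply: hT; rewrite raddf_sum -[RHS]e; apply: eq_bigr => k _ /=.
    by rewrite mmapZ mmapX mmap1U.
  move=> e1; apply/rowP => k; have := congr1 (mcoeff U_(k)%MM) e1.
  rewrite mcoeff0 raddf_sum (bigD1 k) //= mcoeffZ mcoeffXU eqxx mulr1 mxE.
  by rewrite big1 ?addr0 // => i /negbTE ne; rewrite mcoeffZ mcoeffXU ne mulr0.
have evI j (T : 'I_d -> 'I_n) k : \sum_i iota j ((\matrix_(k, i) (i == T k)%:R : 'M[K]_(d, n)) k i) * xi j i = xi j (T k).
  rewrite (bigD1 (T k)) //= mxE eqxx rmorph1 mul1r big1 ?addr0 // => i /negbTE ne.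
  by rewrite mxE ne rmorph0 mul0r.
case: hc => [[j [mu [mufree muc]]]|[j [j' [k [k' [nk [ck ck']]]]]]].
  have [T hT] := htr j.
  exists (col_mx (\matrix_(k, i) (i == T k)%:R) (\matrix_(k, i) Phi (T k) i)) => a /(_ j).
  rewrite -[a]hsubmxK mul_row_col.
  set a1 := lsubmx a; set a2 := rsubmx a => e.
  have {}e : \sum_k iota j (a1 0 k) * xi j (T k) + c j * \sum_k iota j (a2 0 k) * xi j (T k) = 0.
    rewrite -[RHS]e; under [in RHS]eq_bigr do rewrite mxE rmorphD mulrDl.
    rewrite big_split !ev /=; congr (_ + _).
      by apply: eq_bigr => k _; rewrite evI.
    rewrite mulr_sumr; apply: eq_bigr => k _; rewrite mulrCA -hPhi; congr (_ * _).
    by apply: eq_bigr => i _; rewrite mxE.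
  pose f (b : 'rV[K]_d) : {mpoly K[d]} := \sum_k b 0 k *: 'X_k.
  have fE b : mmap (iota j) (xi j \o T) (f b) = \sum_k iota j (b 0 k) * xi j (T k).
    by rewrite raddf_sum; apply: eq_bigr => k _ /=; rewrite mmapZ mmapX mmap1U.
  rewrite -!fE in e.
  have [f0|f0] := eqVneq (f a2) 0.
    have a20 : a2 = 0 by apply: (ind j T) => //; rewrite -fE f0 mmap0.
    move: e; rewrite f0 mmap0 mulr0 addr0 fE => /(ind j T _ hT) a10.
    by rewrite a10 a20 row_mx0.
  exfalso; case/eqP: (rootfree_mpoly (- f a1) mufree f0); apply: (hT).
  have g0 : mmap (iota j) (xi j \o T) (f a2) != 0 by apply: contra_neq f0 => /hT.
  have ec : mmap (iota j) (xi j \o T) (- f a1) = c j * mmap (iota j) (xi j \o T) (f a2).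
    by apply/eqP; rewrite mmapN eq_sym -addr_eq0 addrC; apply/eqP.
  rewrite raddf_sum /= -[RHS](mulr0 (mmap (iota j) (xi j \o T) (f a2) ^+ (size mu).-1)).
  move: muc; rewrite /root horner_coef size_map_poly => /eqP muc.
  rewrite -[X in _ = _ * X]muc mulr_sumr; apply: eq_bigr => k _; rewrite mmapZ rmorphM !rmorphXn /= ec coef_map.
  have ke : (k <= (size mu).-1)%N by exact: ord_le_pred.
  by rewrite -[in RHS](subnKC ke) exprD exprMn; ring.
have [T hT] := htr j; have [T' hT'] := htr j'.
pose G1 := \matrix_(l, i) (Phi (T l) i - k' * (i == T l)%:R) : 'M[K]_(d, n).
pose G2 := \matrix_(l, i) (Phi (T' l) i - k * (i == T' l)%:R) : 'M[K]_(d, n).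
have evG j0 (S : 'I_d -> 'I_n) x l :
   \sum_i iota j0 ((\matrix_(l, i) (Phi (S l) i - x * (i == S l)%:R) : 'M[K]_(d, n)) l i) * xi j0 i
   = (c j0 - iota j0 x) * xi j0 (S l).
  rewrite mulrBl -hPhi -evI mulr_sumr -sumrB; apply: eq_bigr => i _.
  by rewrite !mxE rmorphB rmorphM; ring.
exists (col_mx G1 G2) => a va; rewrite -[a]hsubmxK; move: va; rewrite -[a]hsubmxK mul_row_col.
rewrite row_mxKl row_mxKr.
set a1 := lsubmx a; set a2 := rsubmx a => va.
have e j0 : \sum_l iota j0 (a1 0 l) * ((c j0 - iota j0 k') * xi j0 (T l))
    + \sum_l iota j0 (a2 0 l) * ((c j0 - iota j0 k) * xi j0 (T' l)) = 0.
  rewrite -[RHS](va j0); under [in RHS]eq_bigr do rewrite mxE rmorphD mulrDl.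
  by rewrite big_split !ev /=; congr (_ + _); apply: eq_bigr => l _; rewrite evG.
have kk j0 : iota j0 k - iota j0 k' != 0 by rewrite subr_eq0 fmorph_eq; apply/eqP.
have -> : a1 = 0.
  apply: (ind j T) => //; apply: (mulfI (kk j)); rewrite mulr0.
  have ej := e j; rewrite ck subrr in ej.
  have z : \sum_l iota j (a2 0 l) * (0 * xi j (T' l)) = 0.
    by apply: big1 => l _; rewrite mul0r mulr0.
  rewrite z addr0 in ej; rewrite -[RHS]ej.
  by rewrite mulr_sumr; apply: eq_bigr => l _; rewrite mulrCA.
have -> : a2 = 0; last by rewrite row_mx0.
apply: (ind j' T') => //; apply: (mulfI (kk j')); rewrite mulr0 -[RHS]oppr0.
have ej := e j'; rewrite ck' subrr in ej.
have z : \sum_l iota j' (a1 0 l) * (0 * xi j' (T l)) = 0.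
  by apply: big1 => l _; rewrite mul0r mulr0.
rewrite z add0r in ej; rewrite -[X in _ = - X]ej.
by rewrite mulr_sumr -sumrN; apply: eq_bigr => l _; ring.
Qed.

End Multiplier.

(** * Generic hyperplane sections of a family of points *)

(** The generic section of one point, packed so that it can be chosen for all points of
    a family at once. *)
Record section_data (K F : fieldType) (iota : {rmorphism K -> F}) n
    (xi : 'I_n.+1 -> F) (d : nat) := SectionData {
  sd_field : fieldType;
  sd_iota : {rmorphism fieldt K n.+1 -> sd_field};
  sd_eval : {rmorphism {mpoly F[n.+1]} -> sd_field};
  sd_iotaE : forall g, sd_iota g%:F = sd_eval (map_mpoly iota g);
  sd_lam : sd_eval (lam xi) = 0;
  sd_ker : forall f, sd_eval f = 0 -> exists c, f = c * lam xi;
  sd_trdeg : trdeg_ge sd_iota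
     (fun i : 'I_n => sd_eval (xi (widen_ord (leqnSn n) i))%:MP) d }.

Lemma exists_section_data (K F : fieldType) (iota : {rmorphism K -> F}) n
    (xi : 'I_n.+1 -> F) d :
  trdeg_ge iota xi d.+2 -> inhabited (section_data iota xi d.+1).
Proof.
by move=> /section_point[F' [i' [s [h1 h2 h3 h4]]]]; split; exists F' i' s.
Qed.

(** Restriction of linear forms to [x_n = - sum_(i < n) (t_i / t_n) x_i]. *)
Definition restr (K : fieldType) n : 'M[fieldt K n.+1]_(n.+1, n) :=
  \matrix_(i, k) (if unlift ord_max i is Some i' then (i' == k)%:R
                  else - (('X_(lift ord_max k))%:F / ('X_ord_max)%:F)).

Definition inFt (K : fieldType) n (a : K) : fieldt K n := (a%:MP)%:F.
Lemma inFt_zmod K n : zmod_morphism (@inFt K n).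
Proof. by move=> a b; rewrite /inFt mpolyCB tofracB. Qed.
Lemma inFt_monoid K n : monoid_morphism (@inFt K n).
Proof.
by split=> [|a b]; rewrite /inFt; [rewrite mpolyC1 tofrac1|rewrite mpolyCM tofracM].
Qed.
HB.instance Definition _ K n := GRing.isZmodMorphism.Build _ _ (@inFt K n) (@inFt_zmod K n).
HB.instance Definition _ K n := GRing.isMonoidMorphism.Build _ _ (@inFt K n) (@inFt_monoid K n).

Definition spanned_or_multiplier (K : fieldType) n (J : Type) (F : J -> fieldType)
    (iota : forall j, {rmorphism K -> F j}) (xi : forall j, 'I_n -> F j)
    r (M : 'M[K]_(r, n)) : Prop :=
  (forall u, vanish iota xi u -> (u <= M)%MS) \/ multiplier iota xi.

Lemma mderiv_map (K F : fieldType) (iota : {rmorphism K -> F}) n i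
    (p : {mpoly K[n]}) :
  mderiv i (map_mpoly iota p) = map_mpoly iota (mderiv i p).
Proof.
by apply/mpolyP => m; rewrite mcoeff_mderiv !mcoeff_map_mpoly mcoeff_mderiv raddfMn.
Qed.

Lemma mderiv_lam (F : fieldType) n (xi : 'I_n -> F) i : mderiv i (lam xi) = (xi i)%:MP.
Proof.
rewrite /lam raddf_sum (bigD1 i) //= big1 ?addr0 => [|j ne].
  rewrite mderivZ mderivX mnm1E eqxx scale1r.
  by have -> : (U_(i) - U_(i) = 0)%MM; [apply/mnmP => j; rewrite mnmBE subnn mnm0E|
     rewrite mpolyX0 -mul_mpolyC mulr1].
by rewrite mderivZ mderivX mnm1E (negbTE ne) scale0r scaler0.
Qed.

Lemma trdeg_ratio (K F : fieldType) (iota : {rmorphism K -> F}) n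
    (xi : 'I_n -> F) d : trdeg_ge iota xi d.+2 ->
  exists a b, xi b != 0 /\ ~ algebraicOver iota (xi a / xi b).
Proof.
move=> [T hT]; have [i2 h2 nalg] := indep_transcendental ord0 hT.
pose b : 'I_d.+2 := lift ord0 ord0.
have b0 : xi (T b) != 0 by exact: (indep_neq0 b hT).
exists (T ord0), (T b); split=> // h; apply: nalg => /=.
have {}h : algebraicOver i2 (xi (T ord0) / xi (T b)).
  apply: (algebraicOver_factor (j := @FracField.tofrac _ \o @mpolyC d.+1 K)) h => a /=.
  by rewrite h2 mmapC.
have -> : xi (T ord0) = xi (T ord0) / xi (T b) * i2 ('X_ord0)%:F.
  by rewrite h2 mmapX mmap1U /= divfK.
exact: algebraic_mul h (algebraic_id _ _).
Qed.

(** Vanishing in [F_j[t]] is vanishing of all coefficients in [t]. *)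
Lemma vanishing_coefficients (K : fieldType) n N (J : Type) (F : J -> fieldType)
    (iota : forall j, {rmorphism K -> F j}) (xi : forall j, 'I_n -> F j)
    r (M : 'M[K]_(r, n)) (a : 'I_n -> {mpoly K[N]}) :
  (forall v, vanish iota xi v -> (v <= M)%MS) ->
  (forall j, \sum_i map_mpoly (iota j) (a i) * (xi j i)%:MP = 0) ->
  (\row_i (a i)%:F <= map_mx (@inFt K N) M)%MS.
Proof.
move=> hM a0; pose k0 := (\max_i msize (a i))%N.
have -> : \row_i (a i)%:F = \sum_(m : 'X_{1..N < k0})
    ('X_[m])%:F *: map_mx (@inFt K N) (\row_i (a i)@_m) :> 'rV[fieldt K N]_n.
  apply/rowP => i; rewrite mxE summxE.
  rewrite [in LHS](mpolywE (leq_bigmax i : (msize (a i) <= k0)%N)) raddf_sum /=.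
  by apply: eq_bigr => m _; rewrite !mxE -mul_mpolyC tofracM mulrC.
apply: summx_sub => m _; apply: scalemx_sub; rewrite map_submx; apply: hM => j.
have := congr1 (mcoeff (m : 'X_{1..N})) (a0 j); rewrite mcoeff0 => e.
rewrite -[RHS]e raddf_sum; apply: eq_bigr => i _ /=.
by rewrite mxE [in RHS]mulrC mcoeffCM mcoeff_map_mpoly mulrC.
Qed.

Section FamilySection.
Variables (K : fieldType) (n : nat) (J : Type) (F : J -> fieldType).
Variables (iota : forall j, {rmorphism K -> F j}) (xi : forall j, 'I_n.+1 -> F j).
Variable d : nat.
Hypothesis htr : forall j, trdeg_ge (iota j) (xi j) d.+2.
Local Notation K' := (fieldt K n.+1).
Local Notation w := (widen_ord (leqnSn n)).

Let D j : section_data (iota j) (xi j) d.+1 :=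
  ClassicalEpsilon.epsilon (exists_section_data (htr j)) (fun=> True).
Let F' j := sd_field (D j).
Let iota' j : {rmorphism K' -> F' j} := sd_iota (D j).
Let ev j : {rmorphism {mpoly (F j)[n.+1]} -> F' j} := sd_eval (D j).
Let xi' j (i : 'I_n) : F' j := ev j (xi j (w i))%:MP.
Local Notation t_ i := (('X_i)%:F : K').

Let ev_lam j : \sum_i iota' j (t_ i) * ev j (xi j i)%:MP = 0.
Proof.
rewrite -[RHS](sd_lam (D j)) /lam raddf_sum; apply: eq_bigr => i _.
by rewrite /iota' sd_iotaE map_mpolyX -rmorphM mulrC mul_mpolyC.
Qed.

Let iotaF j a : iota' j (inFt n.+1 a) = ev j (iota j a)%:MP.
Proof. by rewrite /iota' /inFt sd_iotaE map_mpolyC. Qed.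

Let tn0 : (t_ ord_max : K') != 0.
Proof. by rewrite tofrac_eq0 -msize_poly_eq0 msizeX. Qed.

Let lift_max_w k : lift ord_max k = w k :> 'I_n.+1.
Proof. by apply: val_inj; rewrite /= /bump leqNgt ltn_ord. Qed.

(** Evaluation at the section point is compatible with [restr]. *)
Let restrE j (u : 'rV[K']_n.+1) :
  \sum_k iota' j ((u *m restr K n) 0 k) * xi' j k
  = \sum_i iota' j (u 0 i) * ev j (xi j i)%:MP.
Proof.
have key i : \sum_k iota' j (restr K n i k) * xi' j k = ev j (xi j i)%:MP.
  case: (unliftP ord_max i) => [i'|] ->.
    rewrite (bigD1 i') //= mxE liftK eqxx rmorph1 mul1r big1 ?addr0 => [|k ne].
      by rewrite /xi' lift_max_w.
    by rewrite mxE liftK eq_sym (negbTE ne) rmorph0 mul0r.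
  have tn : iota' j (t_ ord_max) != 0 by rewrite fmorph_eq0.
  have := ev_lam j; rewrite big_ord_recr /= => /eqP; rewrite addrC addr_eq0 => /eqP e.
  apply: (mulfI tn); rewrite e mulr_sumr -sumrN; apply: eq_bigr => k _.
  rewrite mxE unlift_none rmorphN fmorph_div /xi' lift_max_w.
  by rewrite mulNr mulrN mulrA [iota' j _ * (_ / _)]mulrC divfK.
under eq_bigr do rewrite mxE rmorph_sum mulr_suml.
rewrite exchange_big; apply: eq_bigr => i _; rewrite -key mulr_sumr.
by apply: eq_bigr => k _; rewrite rmorphM mulrA.
Qed.

(** In the first case a form [u] vanishing on the section satisfies
    [u(xi_j) = c_j lam(xi_j)] in [F_j[t]]; differentiating in [t_m] shows that
    the matrix of the derivatives of [u] multiplies the section point by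
    [c_j].  Were [c_j] a common scalar [a / b], then [(b u - a t)(xi_j)] would
    be divisible by [lam(xi_j)^2], hence zero. *)
Lemma spanned_section r (M : 'M[K]_(r, n.+1)) (u : 'rV[K']_n) :
  (forall v, vanish iota xi v -> (v <= M)%MS) ->
  vanish iota' xi' u ->
  (u <= map_mx (@inFt K n.+1) M *m restr K n)%MS \/ multiplier iota' xi'.
Proof.
move=> hM hu; have [d0 [a [d0n ha]]] := common_denominator (fun i => u 0 i).
have d0F : d0%:F != 0 by rewrite tofrac_eq0.
pose f j : {mpoly (F j)[n.+1]} := \sum_i map_mpoly (iota j) (a i) * (xi j (w i))%:MP.
have evf j : ev j (f j) = 0.
  rewrite -[RHS](mulr0 (iota' j d0%:F)) -(hu j) mulr_sumr /f raddf_sum /=.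
  apply: eq_bigr => i _; rewrite rmorphM /= ha [RHS]mulrA -[iota' j d0%:F * _]rmorphM [d0%:F * _]mulrC divfK //.
  by rewrite /iota' sd_iotaE.
pose c j := projT1 (boolp.cid (sd_ker (evf j))).
have fc j : f j = c j * lam (xi j) := projT2 (boolp.cid (sd_ker (evf j))).
pose Phi := \matrix_(m, i) (mderiv (w m) (a i))%:F : 'M[K']_n.
have hPhi j m : \sum_i iota' j (Phi m i) * xi' j i = ev j (c j) * xi' j m.
  have : mderiv (w m) (f j) = mderiv (w m) (c j) * lam (xi j) + c j * (xi j (w m))%:MP.
    by rewrite fc mderivM mderiv_lam.
  move/(congr1 (ev j)); rewrite rmorphD !rmorphM /ev sd_lam mulr0 add0r => <-.
  rewrite /f [mderiv _ _]raddf_sum rmorph_sum /=; apply: eq_bigr => i _.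
  rewrite mderivM mderivC mulr0 addr0 mderiv_map rmorphM; congr (_ * _).
  by rewrite mxE /iota' sd_iotaE.
have [[kap hkap]|nsc] := boolp.EM (exists kap, forall j, ev j (c j) = iota' j kap); last first.
  right; apply: not_scalar_multiplier hPhi nsc => j; exact: sd_trdeg.
left; have [a' [b [b0 ek]]] := fracE kap.
  have bF : b%:F != 0 by rewrite tofrac_eq0.
  pose uh (i : 'I_n.+1) : {mpoly K[n.+1]} :=
    (if unlift ord_max i is Some i' then b * a i' else 0) - a' * 'X_i.
  pose g j := \sum_i map_mpoly (iota j) (uh i) * (xi j i)%:MP.
  have gE j : g j = (c j * map_mpoly (iota j) b - map_mpoly (iota j) a') * lam (xi j).
    rewrite /g; under eq_bigr do rewrite rmorphB mulrBl rmorphM /= map_mpolyX.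
    rewrite sumrB mulrBl mulrAC -fc; congr (_ - _).
      rewrite big_ord_recr /= unlift_none rmorph0 mul0r addr0 /f mulr_suml.
      apply: eq_bigr => i _; rewrite -lift_max_w liftK rmorphM; ring.
    rewrite /lam mulr_sumr; apply: eq_bigr => i _.
    by rewrite -mulrA; congr (_ * _); rewrite mulrC mul_mpolyC.
  have ck j : ev j (c j * map_mpoly (iota j) b - map_mpoly (iota j) a') = 0.
    rewrite rmorphB rmorphM hkap /ev -!sd_iotaE -/(iota' j) -rmorphM ek divfK //.
    by rewrite subrr.
  have g0 j : g j = 0.
    have [c' ec'] := sd_ker (ck j).
    have [x [y [y0 nalg]]] := trdeg_ratio (htr j).
    suff c'0 : c' = 0 by rewrite gE ec' c'0 !mul0r.
    apply: (divisible_by_lam_power (r := 1) (iota := iota j) (f := g j) _ _ y0 nalg).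
      move=> m; rewrite /g raddf_sum /=; apply: Lform_sum => i _.
      rewrite mulrC mcoeffCM mcoeff_map_mpoly mulrC; apply: LformZ; exact: LformX.
    by rewrite gE ec' -mulrA.
  have uhM := @vanishing_coefficients K n.+1 n.+1 J F iota xi r M uh hM g0.
  have bd0 : (b * d0)%:F != 0 by rewrite tofrac_eq0 mulf_neq0.
  have -> : u = (b * d0)%:F^-1 *: ((\row_i (uh i)%:F) *m restr K n).
    apply/rowP => k.
    have r1 i : restr K n (w i) k = (i == k)%:R by rewrite mxE -lift_max_w liftK.
    have r2 : restr K n ord_max k = - (t_ (w k) / t_ ord_max).
      by rewrite mxE unlift_none lift_max_w.
    have u1 i : uh (w i) = b * a i - a' * 'X_(w i) by rewrite /uh -lift_max_w liftK.
    have u2 : uh ord_max = - (a' * 'X_ord_max) by rewrite /uh unlift_none sub0r.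
    rewrite mxE [in RHS]mxE big_ord_recr /= !mxE -/(restr K n ord_max k).
    have -> : \sum_(i < n) (\row_i0 (uh i0)%:F) 0 (w i) * restr K n (w i) k
              = (b * a k)%:F - a'%:F * t_ (w k).
      rewrite (bigD1 k) //= r1 eqxx mulr1 mxE u1 tofracB [in X in _ - X]tofracM.
      by rewrite big1 ?addr0 // => i ne; rewrite r1 (negbTE ne) mulr0.
    have := r2; rewrite mxE => ->.
    rewrite u2 tofracN [(a' * 'X_ord_max)%:F]tofracM mulrNN -[_ * t_ ord_max * _]mulrA [t_ ord_max * _]mulrC divfK // subrK.
    rewrite ha !tofracM invfM [X in _ = X * _]mulrC -mulrA mulKf; last exact: bF.
    exact: mulrC.
  by apply: scalemx_sub; exact: submxMr.
Qed.

(** The matrix of a multiplier is restricted to the hyperplane; its eigenvalues remain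
    the same elements, now regarded in the larger fields. *)
Lemma multiplier_section : multiplier iota xi -> multiplier iota' xi'.
Proof.
move=> [Phi [c [hPhi hc]]].
exists (\matrix_(k, i) (map_mx (@inFt K n.+1) (row (w k) Phi) *m restr K n) 0 i).
exists (fun j => ev j (c j)%:MP); split=> [j k|].
  under eq_bigr do rewrite mxE.
  rewrite restrE /xi' -rmorphM -mpolyCM -hPhi [_%:MP]rmorph_sum rmorph_sum /=.
  by apply: eq_bigr => i _; rewrite !mxE iotaF mpolyCM rmorphM.
case: hc => [[j [mu [fr rt]]]|[j [j' [k [k' [ne [e e']]]]]]]; [left|right].
  exists j, (map_poly (@inFt K n.+1) mu); split; first exact: rootfree_fieldt.
  have -> : map_poly (iota' j) (map_poly (@inFt K n.+1) mu)
      = map_poly (ev j \o @mpolyC n.+1 (F j)) (map_poly (iota j) mu).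
    by apply/polyP => i; rewrite !coef_map /= iotaF.
  exact: (rmorph_root (ev j \o @mpolyC n.+1 (F j))).
exists j, j', (inFt n.+1 k), (inFt n.+1 k'); rewrite !iotaF e e'; split=> //.
by move=> /eqP; rewrite /inFt tofrac_eq mpolyC_eq => /eqP.
Qed.

Lemma family_section_local :
  exists (F2 : J -> fieldType) (iota2 : forall j, {rmorphism K' -> F2 j})
         (e : forall j, {rmorphism F j -> F2 j}),
    let xi2 := fun j (i : 'I_n) => e j (xi j (w i)) in
  [/\ forall j, trdeg_ge (iota2 j) (xi2 j) d.+1,
      forall j a, iota2 j (inFt n.+1 a) = e j (iota j a),
      forall j, \sum_i iota2 j (t_ i) * e j (xi j i) = 0
    & forall r (M : 'M[K]_(r, n.+1)), spanned_or_multiplier iota xi M ->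
      spanned_or_multiplier iota2 xi2 (map_mx (@inFt K n.+1) M *m restr K n)].
Proof.
exists F', iota', (fun j => ev j \o @mpolyC n.+1 (F j)); split=> //=.
- by move=> j; exact: sd_trdeg.
- move=> r M [hM|hm]; last by right; exact: multiplier_section.
  have [hx|nm] := boolp.EM (multiplier iota' xi'); [by right|left=> u hu].
  by case: (spanned_section hM hu).
Qed.
End FamilySection.

Lemma family_section (K : fieldType) n (J : Type) (F : J -> fieldType)
    (iota : forall j, {rmorphism K -> F j}) (xi : forall j, 'I_n.+1 -> F j) d :
  (forall j, trdeg_ge (iota j) (xi j) d.+2) ->
  exists (F2 : J -> fieldType) (iota2 : forall j, {rmorphism fieldt K n.+1 -> F2 j})
         (e : forall j, {rmorphism F j -> F2 j}),
    let xi2 := fun j (i : 'I_n) => e j (xi j (widen_ord (leqnSn n) i)) in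
  [/\ forall j, trdeg_ge (iota2 j) (xi2 j) d.+1,
      forall j a, iota2 j (inFt n.+1 a) = e j (iota j a),
      forall j, \sum_i iota2 j ('X_i)%:F * e j (xi j i) = 0
    & forall r (M : 'M[K]_(r, n.+1)), spanned_or_multiplier iota xi M ->
      spanned_or_multiplier iota2 xi2 (map_mx (@inFt K n.+1) M *m restr K n)].
Proof. exact: family_section_local. Qed.

(** * Linear forms, quadrics and multiplication by the variables *)

Lemma mpoly_ring_ind (K : fieldType) n (P : {mpoly K[n]} -> Prop) :
  (forall c, P c%:MP) -> (forall i, P 'X_i) ->
  (forall f g, P f -> P g -> P (f + g)) -> (forall f g, P f -> P g -> P (f * g)) ->
  forall f, P f.
Proof.
move=> hC hX hD hM; have h1 : P 1 by rewrite -mpolyC1; exact: hC.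
have hm m : P 'X_[m].
  rewrite mpolyXE_id; elim/big_ind: _ => // i _.
  elim: (m i) => [|k IH]; [by rewrite expr0|rewrite exprS; exact: hM].
elim/mpolyind => [|c m p _ _ IH]; first by rewrite -mpolyC0.
by apply: hD => //; rewrite -mul_mpolyC; apply: hM.
Qed.

Lemma rmorph_mpoly_eq (K : fieldType) n (R : comNzRingType)
    (f g : {rmorphism {mpoly K[n]} -> R}) :
  (forall c, f c%:MP = g c%:MP) -> (forall i, f 'X_i = g 'X_i) -> f =1 g.
Proof.
move=> hC hX; apply: mpoly_ring_ind => // p q e1 e2; first by rewrite !rmorphD e1 e2.
by rewrite !rmorphM e1 e2.
Qed.

Lemma pihomogM (K : fieldType) n e d (l c : {mpoly K[n]}) : l \is e.-homog ->
  pihomog mdeg (e + d) (l * c) = l * pihomog mdeg d c.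
Proof.
move=> hl; elim/mpolyind: c => [|x m p _ _ IH]; first by rewrite mulr0 !pihomog0 mulr0.
rewrite mulrDr !pihomogD IH mulrDr; congr (_ + _).
rewrite -scalerAr !linearZ /= -scalerAr; congr (_ *: _); rewrite pihomogX.
have hm : l * 'X_[m] \is (e + mdeg m).-homog by rewrite dhomogM // dhomogX.
case: eqP => [<-|/eqP ne]; first by rewrite pihomog_dE.
by rewrite mulr0 (pihomog_ne0 _ hm) // eqn_add2l.
Qed.

Definition mvar (K : fieldType) n (k : nat) : {mpoly K[n]} :=
  if insub k is Some i then 'X_i else 0.
Definition xop (K : fieldType) n (k : nat) (f : {mpoly K[n]}) := mvar K n k * f.

Lemma mvarE (K : fieldType) n (i : 'I_n) : mvar K n i = 'X_i.
Proof. by rewrite /mvar valK. Qed.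

Lemma xop_linear (K : fieldType) n k : linear (@xop K n k).
Proof. by move=> a u v; rewrite /xop mulrDr scalerAr. Qed.

Lemma xopC (K : fieldType) n k l (u : {mpoly K[n]}) :
  xop k (xop l u) = xop l (xop k u).
Proof. exact: mulrCA. Qed.

Lemma lam_homog (K : fieldType) n (u : 'I_n -> K) : lam u \is 1.-homog.
Proof.
apply: rpred_sum => i _; apply: rpredZ.
by rewrite dhomogX /= mdeg1.
Qed.

Lemma lam_linear (K : fieldType) n (a : K) (u v : 'rV[K]_n) :
  lam ((a *: u + v) 0) = a *: lam (u 0) + lam (v 0).
Proof.
rewrite /lam scaler_sumr -big_split; apply: eq_bigr => i _ /=.
by rewrite !mxE scalerDl scalerA.
Qed.

Lemma mmap_lam (K F : fieldType) (iota : {rmorphism K -> F}) n (xi : 'I_n -> F)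
    (u : 'I_n -> K) : mmap iota xi (lam u) = \sum_i iota (u i) * xi i.
Proof.
by rewrite [LHS]raddf_sum; apply: eq_bigr => i _ /=; rewrite mmapZ mmapX mmap1U.
Qed.

Lemma mnm1_inj_eq n (i j : 'I_n) : (U_(i) == U_(j))%MM = (i == j).
Proof.
apply/eqP/eqP => [/mnmP/(_ i)|->//]; rewrite !mnm1E eqxx.
by case: eqP => [->|].
Qed.

Lemma mcoeff_lam (K : fieldType) n (u : 'I_n -> K) i : (lam u)@_U_(i) = u i.
Proof.
rewrite /lam raddf_sum (bigD1 i) //= big1 => [|j ne].
  by rewrite mcoeffZ mcoeffX eqxx mulr1 addr0.
by rewrite mcoeffZ mcoeffX mnm1_inj_eq (negbTE ne) mulr0.
Qed.

Lemma mdeg1_eq n (m : 'X_{1..n}) : mdeg m = 1%N -> exists i, m = U_(i)%MM.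
Proof. by move=> /eqP/mdeg1P[i /eqP->]; exists i. Qed.

Lemma homog1_lam (K : fieldType) n (f : {mpoly K[n]}) : f \is 1.-homog ->
  f = lam (fun i => f@_U_(i)).
Proof.
move=> hf; apply/mpolyP => m.
have [/eqP/mdeg1_eq[i ->]|ne] := boolP (mdeg m == 1%N); first by rewrite mcoeff_lam.
by rewrite (dhomog_nemf_coeff hf) // (dhomog_nemf_coeff (lam_homog _)).
Qed.

Definition lforms (K : fieldType) n r (M : 'M[K]_(r, n)) (f : {mpoly K[n]}) : Prop :=
  exists2 u : 'rV[K]_n, (u <= M)%MS & f = lam (u 0).

Lemma lforms_subspace K n r (M : 'M_(r, n)) : subspace (@lforms K n r M).
Proof.
split=> [|a f g [u hu ->] [v hv ->]].
  exists 0; first exact: sub0mx.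
  by rewrite /lam big1 // => i _; rewrite mxE scale0r.
by exists (a *: u + v); rewrite ?lam_linear // addmx_sub // scalemx_sub.
Qed.

Definition quadrics (K : fieldType) n (J : Type) (F : J -> fieldType)
    (iota : forall j, {rmorphism K -> F j}) (xi : forall j, 'I_n -> F j)
    (f : {mpoly K[n]}) : Prop :=
  f \is 2.-homog /\ forall j, mmap (iota j) (xi j) f = 0.

Lemma homog_subspace (K : fieldType) n d : subspace (fun f : {mpoly K[n]} => f \is d.-homog).
Proof. by split=> [|a u v hu hv]; [exact: rpred0|rewrite rpredD // rpredZ]. Qed.

Lemma quadrics_subspace (K : fieldType) n (J : Type) (F : J -> fieldType)
    (iota : forall j, {rmorphism K -> F j}) (xi : forall j, 'I_n -> F j) :
  subspace (quadrics iota xi).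
Proof.
split=> [|a u v [hu hu'] [hv hv']].
  by split=> [|j]; [exact: rpred0|rewrite mmap0].
split=> [|j]; first exact: (homog_subspace K n 2).2.
by rewrite mmapD mmapZ hu' hv' mulr0 addr0.
Qed.

Section Restriction.
Variables (K : fieldType) (n : nat) (t : 'I_n -> K).

Definition rho : {mpoly K[n.+1]} -> {mpoly K[n]} :=
  mmap (@mpolyC n K) (fun i => if unlift ord_max i is Some i' then 'X_i' else lam t).
Definition unrho : {mpoly K[n]} -> {mpoly K[n.+1]} :=
  mmap (@mpolyC n.+1 K) (fun i => 'X_(lift ord_max i)).
Definition ell : {mpoly K[n.+1]} := 'X_ord_max - \sum_k t k *: 'X_(lift ord_max k).

Lemma rhoC c : rho c%:MP = c%:MP. Proof. exact: mmapC. Qed.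
Lemma rhoX k : rho 'X_(lift ord_max k) = 'X_k.
Proof. by rewrite /rho mmapX mmap1U liftK. Qed.
Lemma rhoX_max : rho 'X_ord_max = lam t.
Proof. by rewrite /rho mmapX mmap1U unlift_none. Qed.
Lemma rho_linear : linear rho.
Proof. by move=> a u v; rewrite /rho mmapD mmapZ mul_mpolyC. Qed.
Lemma rhoM f g : rho (f * g) = rho f * rho g. Proof. exact: rmorphM. Qed.
Lemma unrhoX k : unrho 'X_k = 'X_(lift ord_max k).
Proof. by rewrite /unrho mmapX mmap1U. Qed.

Lemma rho_ell : rho ell = 0.
Proof.
rewrite /ell /rho mmapB -/rho rhoX_max; apply/eqP; rewrite subr_eq0; apply/eqP.
rewrite [RHS]raddf_sum; apply: eq_bigr => k _ /=.
by rewrite mmapZ -/rho rhoX mul_mpolyC.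
Qed.

Lemma rho_mod f : exists c, f - unrho (rho f) = ell * c.
Proof.
elim/mpoly_ring_ind: f => [c|i|f g [c e] [c' e']|f g [c e] [c' e']].
- by exists 0; rewrite rhoC /unrho mmapC subrr mulr0.
- case: (unliftP ord_max i) => [k|] ->.
    by exists 0; rewrite rhoX unrhoX subrr mulr0.
  exists 1; rewrite rhoX_max mulr1 /ell; congr (_ - _).
  by rewrite [LHS]raddf_sum; apply: eq_bigr => k _ /=; rewrite mmapZ -/unrho unrhoX mul_mpolyC.
- exists (c + c'); rewrite mulrDr -e -e' /rho /unrho !rmorphD; ring.
exists (c * g + unrho (rho f) * c'); rewrite mulrDr mulrA -e mulrCA -e'.
by rewrite /rho /unrho !rmorphM /=; ring.
Qed.

Lemma rho_ker f : rho f = 0 -> exists c, f = ell * c.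
Proof.
by move=> e; have [c] := rho_mod f; rewrite e /unrho mmap0 subr0; exists c.
Qed.

Lemma ell_homog : ell \is 1.-homog.
Proof.
by rewrite rpredB ?rpred_sum // => [|k _]; rewrite ?rpredZ // dhomogX /= mdeg1.
Qed.

Lemma ell_neq0 : ell != 0.
Proof.
apply: contraTneq (oner_neq0 K) => e; rewrite negbK; apply/eqP.
have := congr1 (mcoeff U_(ord_max)) e; rewrite mcoeff0 => <-.
rewrite raddfB raddf_sum /= mcoeffX eqxx big1 ?subr0 // => k _.
by rewrite mcoeffZ mcoeffX mnm1_inj_eq eq_sym (negbTE (neq_lift _ _)) mulr0.
Qed.

Lemma rho_homog d f : f \is d.-homog -> rho f \is d.-homog.
Proof.
move=> /dhomogP hf; rewrite /rho /mmap big_seq; apply: rpred_sum => m hm.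
rewrite mul_mpolyC; apply: rpredZ; rewrite -(hf m hm) /= mdegE /mmap1.
elim/big_rec2: _ => [|i e p _ IH]; first exact: dhomog1.
rewrite dhomogM //.
have h : (if unlift ord_max i is Some i' then 'X_i' else lam t) \is 1.-homog.
  by case: (unlift _ _) => [k|]; [rewrite dhomogX /= mdeg1|exact: lam_homog].
by have := dhomogMn (m i) h; rewrite mul1n.
Qed.

(** The kernel of the restriction is generated by [ell]; comparing components of degree
    two gives a linear cofactor. *)
Lemma ell_quotient w : w \is 2.-homog -> rho w = 0 ->
  exists2 u, u \is 1.-homog & ell * u = w.
Proof.
move=> hw /rho_ker[c ec]; exists (pihomog mdeg 1 c); first exact: pihomogP.
by rewrite -(pihomogM 1 c ell_homog) -ec pihomog_dE.
Qed.

Lemma mmap_rho (F : fieldType) (iota : {rmorphism K -> F}) (xi : 'I_n.+1 -> F) f :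
  xi ord_max = \sum_k iota (t k) * xi (lift ord_max k) ->
  mmap iota (xi \o lift ord_max) (rho f) = mmap iota xi f.
Proof.
move=> e; apply: (rmorph_mpoly_eq
  (f := mmap iota (xi \o lift ord_max) \o rho) (g := mmap iota xi)) f => [c|i] /=.
  by rewrite !mmapC.
rewrite -/(rho 'X_i) [RHS]mmapX mmap1U; case: (unliftP ord_max i) => [k|] ->.
  by rewrite rhoX mmapX mmap1U.
by rewrite rhoX_max mmap_lam e.
Qed.

(** The coefficients of [ell] as a sequence, the form in which the elimination of a
    variable was stated. *)
Definition tnat (k : nat) : K := if insub k is Some i then t i else 0.

Lemma klam_ell v : klam n tnat (@xop K n.+1) v = ell * v.
Proof.
rewrite /klam /xop /ell mulrBl; congr (_ * _ - _).
  by rewrite -[n in mvar _ _ n]/(val (@ord_max n)) mvarE.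
rewrite mulr_suml; apply: eq_bigr => k _; rewrite /tnat valK -scalerAl.
by congr (_ *: (_ * _)); rewrite -mvarE /= /bump leqNgt ltn_ord.
Qed.

Lemma rho_xop k u : (k < n)%N -> rho (xop k u) = xop k (rho u).
Proof.
move=> lt; rewrite /xop rhoM; congr (_ * _).
have -> : k = lift ord_max (Ordinal lt) :> nat by rewrite /= /bump leqNgt lt.
by rewrite mvarE rhoX /= /bump leqNgt lt; rewrite -(mvarE K (Ordinal lt)).
Qed.

End Restriction.

(** * The bound for a family of points *)

Lemma lforms_qdim (K : fieldType) n r (A : 'M[K]_(r, n)) B :
  subspace B -> qdim_le (lforms A) B (\rank A).
Proof.
move=> sB; apply: (qdim_le_span (s := fun k => lam (row k (row_base A) 0))) => // z [u].
rewrite -(eq_row_base A) => /submxP[a ->] ->; exists a.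
suff -> : lam ((a *m row_base A) 0) = comb a (fun k => lam (row k (row_base A) 0)).
  by rewrite subrr; exact: subspace0 sB.
rewrite /lam /comb; under eq_bigr do rewrite mxE scaler_suml.
rewrite exchange_big /=; apply: eq_bigr => k _; rewrite scaler_sumr.
by apply: eq_bigr => i _; rewrite scalerA /row mxE.
Qed.

Lemma homog1_lforms (K : fieldType) n (f : {mpoly K[n]}) :
  f \is 1.-homog -> lforms 1%:M f.
Proof.
move=> hf; exists (\row_i f@_U_(i)); first exact: submx1.
by rewrite {1}(homog1_lam hf); apply: eq_bigr => i _; rewrite mxE.
Qed.

Lemma zero_subspace (K : fieldType) (V : lmodType K) : subspace (fun f : V => f = 0).
Proof. by split=> // a u v -> ->; rewrite scaler0 addr0. Qed.

Lemma kcyc0_qdim (K : fieldType) i (W B : {mpoly K[0]} -> Prop) :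
  subspace W -> subspace B -> (forall f, W f -> f \is 2.-homog) ->
  qdim_le (kcyc (@xop K 0) W (m := 0) (j := i)) (kbnd (@xop K 0) B (m := 0) (j := i)) 0.
Proof.
move=> sW sB h; apply: qdim_le0; first exact: kcyc_subspace (@xop_linear K 0) sW.
move=> z [Wz _]; have -> : z = 0; last exact: (kbnd_subspace _ _ (@xop_linear K 0) sB).1.
case: i z Wz => [|i] z Wz; last exact: row0P.
apply/mpolyP => m; rewrite mcoeff0; apply: (dhomog_nemf_coeff (h _ Wz)).
by rewrite /= mdegE big_ord0.
Qed.

Lemma ell_inj (K : fieldType) n (t : 'I_n -> K) (v : {mpoly K[n.+1]}) :
  klam n (tnat t) (@xop K n.+1) v = 0 -> v = 0.
Proof.
by rewrite klam_ell => /eqP; rewrite mulf_eq0 (negbTE (ell_neq0 t)) => /eqP.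
Qed.

Lemma poly_elim (K : fieldType) n (t : 'I_n -> K) (M W U : {mpoly K[n.+1]} -> Prop)
    (M' W' : {mpoly K[n]} -> Prop) g D i :
  subspace M -> subspace W -> subspace U -> subspace M' ->
  (forall k u, M u -> W (xop k u)) ->
  (forall u, W u -> u \is 2.-homog /\ W' (rho t u)) ->
  (forall v, M' v -> exists2 u, M u & rho t u = v) ->
  (forall u, u \is 1.-homog -> W (ell t * u) -> U u) ->
  qdim_le U M g ->
  qdim_le (kcyc (@xop K n) W' (m := n) (j := i)) (kbnd (@xop K n) M' (m := n) (j := i)) D ->
  qdim_le (kcyc (@xop K n.+1) W (m := n.+1) (j := i))
    (kbnd (@xop K n.+1) M (m := n.+1) (j := i)) (D + 'C(n, i) * g).
Proof.
move=> sM sW sU sM' MW WW' MM' hU; apply: (@qdim_le_elim K _ _ n (tnat t) _ _ (rho t)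
    (@xop_linear K n.+1) (@xopC K n.+1) (@xop_linear K n) (rho_linear t)) => //.
- by move=> k u; exact: rho_xop.
- exact: ell_inj.
- by move=> v; rewrite klam_ell rhoM rho_ell mul0r.
- by move=> u /WW'[].
- move=> w Ww hw; have [hw2 _] := WW' _ Ww; have [u hu e] := ell_quotient hw2 hw.
  by exists u; rewrite ?klam_ell //; apply: hU; rewrite // e.
Qed.

(** With all quadrics and no linear forms, eliminating [x_n] by [x_n = 0] meets all
    linear forms in [n + 1] variables. *)
Lemma homog_bound (K : fieldType) n i :
  qdim_le (kcyc (@xop K n) (fun f => f \is 2.-homog) (m := n) (j := i))
          (kbnd (@xop K n) (fun f => f = 0) (m := n) (j := i))
          (\sum_(k < n) k.+1 * 'C(k, i)).
Proof.
have s0 m : subspace (fun f : {mpoly K[m]} => f = 0) by exact: zero_subspace.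
elim: n => [|n IH].
  by rewrite big_ord0; apply: kcyc0_qdim => //; exact: homog_subspace.
rewrite big_ord_recr /= [(n.+1 * _)%N]mulnC.
apply: (poly_elim (t := fun=> 0) (U := fun f => f \is 1.-homog) _ _ _ _ _ _ _ _ _ IH) => //.
- exact: homog_subspace.
- exact: homog_subspace.
- by move=> k u ->; rewrite /xop mulr0 rpred0.
- by move=> u hu; split=> //; exact: rho_homog.
- by move=> v ->; exists 0 => //; rewrite (lin0 (rho_linear _)).
- have h := lforms_qdim (A := (1%:M : 'M[K]_n.+1)) (s0 n.+1); rewrite mxrank1 in h.
  by apply: (qdim_le_sub _ _ _ h) => //; [exact: homog1_lforms|exact: homog_subspace].
Qed.

Section CoefficientMap.
Variables (K K' : fieldType) (iota : {rmorphism K -> K'}) (n : nat).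
Variable phi : K' -> K.
Hypothesis phiL : forall a u v, phi (iota a * u + v) = a * phi u + phi v.

Let phiD u v : phi (u + v) = phi u + phi v.
Proof. by rewrite -{1}[u]mul1r -(rmorph1 iota) phiL mul1r. Qed.
Let phi0 : phi 0 = 0.
Proof. by apply/(addrI (phi 0)); rewrite -phiD !addr0. Qed.
Let phiZ a u : phi (iota a * u) = a * phi u.
Proof. by rewrite -[_ * u]addr0 phiL phi0 addr0. Qed.

(** Coefficientwise application of a [K]-linear functional of [K']. *)
Definition coefmap (w : {mpoly K'[n]}) : {mpoly K[n]} :=
  \sum_(m <- msupp w) phi w@_m *: 'X_[m].

Lemma mcoeff_coefmap w m : (coefmap w)@_m = phi w@_m.
Proof.
rewrite /coefmap raddf_sum /=; have [hm|hm] := boolP (m \in msupp w).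
  rewrite (bigD1_seq m) //= mcoeffZ mcoeffX eqxx mulr1 big1 ?addr0 // => m' /negbTE ne.
  by rewrite mcoeffZ mcoeffX ne mulr0.
rewrite big_seq big1 => [|m' hm']; first by rewrite memN_msupp_eq0.
rewrite mcoeffZ mcoeffX; case: eqP => [e|_]; last by rewrite mulr0.
by rewrite -e hm' in hm.
Qed.

Lemma coefmapD u v : coefmap (u + v) = coefmap u + coefmap v.
Proof. by apply/mpolyP => m; rewrite mcoeffD !mcoeff_coefmap mcoeffD phiD. Qed.

Lemma coefmap_map a u : coefmap (a *: map_mpoly iota u) = phi a *: u.
Proof.
apply/mpolyP => m; rewrite mcoeff_coefmap !mcoeffZ mcoeff_map_mpoly.
by rewrite mulrC phiZ mulrC.
Qed.

Lemma coefmap_xop k w : coefmap (xop k w) = xop k (coefmap w).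
Proof.
apply/mpolyP => m; rewrite mcoeff_coefmap /xop /mvar; case: insubP => [i _ _|_].
  rewrite [_ * w]mulrC [_ * coefmap w]mulrC !mcoeffMXU.
  by case: eqP => // _; rewrite mcoeff_coefmap.
by rewrite !mul0r !mcoeff0 phi0.
Qed.

Lemma coefmap_lforms r (M : 'M[K]_(r, n)) w :
  lforms (map_mx iota M) w -> lforms M (coefmap w).
Proof.
move=> [u /submxP[a eu] ->]; exists (\row_i phi (u 0 i)).
  apply/submxP; exists (\row_k phi (a 0 k)); apply/rowP => i; rewrite !mxE eu mxE.
  rewrite (big_morph phi phiD phi0); apply: eq_bigr => k _.
  by rewrite !mxE mulrC phiZ mulrC.
apply/mpolyP => m; rewrite mcoeff_coefmap.
have [/eqP/mdeg1_eq[i ->]|ne] := boolP (mdeg m == 1%N).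
  by rewrite !mcoeff_lam mxE.
by rewrite !(dhomog_nemf_coeff (lam_homog _)) // phi0.
Qed.
End CoefficientMap.

Lemma map_mpolyZX (K K' : fieldType) (iota : {rmorphism K -> K'}) n a (i : 'I_n) :
  map_mpoly iota (a *: 'X_i) = iota a *: 'X_i.
Proof. by rewrite -mul_mpolyC rmorphM /= map_mpolyC map_mpolyX mul_mpolyC. Qed.

Lemma poly_descent (K K' : fieldType) (iota : {rmorphism K -> K'}) n r
    (M : 'M[K]_(r, n)) (W : {mpoly K[n]} -> Prop) (W' : {mpoly K'[n]} -> Prop) i D :
  (forall u, W u -> W' (map_mpoly iota u)) ->
  qdim_le (kcyc (@xop K' n) W' (m := n) (j := i))
    (kbnd (@xop K' n) (lforms (map_mx iota M)) (m := n) (j := i)) D ->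
  qdim_le (kcyc (@xop K n) W (m := n) (j := i))
    (kbnd (@xop K n) (lforms M) (m := n) (j := i)) D.
Proof.
move=> WW'; apply: (qdim_le_descent (iota := iota) (mu := map_mpoly iota)) => //.
- exact: xop_linear.
- by move=> u v; rewrite rmorphD.
- move=> k u lt; rewrite /xop rmorphM /=; congr (_ * _).
  by rewrite -[k]/(val (Ordinal lt)) !mvarE map_mpolyX.
- exact: lforms_subspace.
move=> phi hphi; exists (coefmap (n := n) phi); split.
- exact: coefmapD hphi.
- exact: coefmap_map hphi.
- by move=> k w _; exact: coefmap_xop hphi _ _.
- exact: coefmap_lforms hphi _ _.
Qed.

Definition extend (K K' : fieldType) (iota : {rmorphism K -> K'}) n
    (W : {mpoly K[n]} -> Prop) (f : {mpoly K'[n]}) : Prop :=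
  forall P : {mpoly K'[n]} -> Prop, subspace P ->
    (forall w, W w -> P (map_mpoly iota w)) -> P f.

Lemma extend_subspace (K K' : fieldType) (iota : {rmorphism K -> K'}) n W :
  subspace (@extend K K' iota n W).
Proof.
split=> [P sP _|a u v hu hv P sP hP]; first exact: sP.1.
by apply: sP.2; [exact: hu|exact: hv].
Qed.

Lemma map_mpoly_homog (K K' : fieldType) (iota : {rmorphism K -> K'}) n d
    (f : {mpoly K[n]}) : f \is d.-homog -> map_mpoly iota f \is d.-homog.
Proof.
move=> hf; apply/dhomogP => m; apply: contraTeq => ne.
rewrite mcoeff_msupp negbK mcoeff_map_mpoly.
by have -> : f@_m = 0; [exact: (dhomog_nemf_coeff hf)|rewrite raddf0].
Qed.

Section SectionStep.
Variables (K : fieldType) (n : nat) (J : Type) (F : J -> fieldType).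
Variables (iota : forall j, {rmorphism K -> F j}) (xi : forall j, 'I_n.+1 -> F j).
Local Notation K' := (fieldt K n.+1).

(** The generic hyperplane [sum_i t_i x_i = 0], solved for the last variable. *)
Definition gent (k : 'I_n) : K' := - (('X_(lift ord_max k))%:F / ('X_ord_max)%:F).

Let tn0 : (('X_ord_max)%:F : K') != 0.
Proof. by rewrite tofrac_eq0 -msize_poly_eq0 msizeX. Qed.

Lemma gent_vanish (E : fieldType) (i2 : {rmorphism K' -> E}) (y : 'I_n.+1 -> E) :
  i2 ('X_ord_max)%:F * (y ord_max - \sum_k i2 (gent k) * y (lift ord_max k))
  = \sum_i i2 ('X_i)%:F * y i.
Proof.
have tn : i2 ('X_ord_max)%:F != 0 by rewrite fmorph_eq0.
rewrite mulrBr big_ord_recr /= addrC; congr (_ + _).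
rewrite mulr_sumr -sumrN; apply: eq_bigr => k _.
have -> : widen_ord (leqnSn n) k = lift ord_max k.
  by apply: val_inj; rewrite /= /bump leqNgt ltn_ord.
rewrite /gent rmorphN fmorph_div mulNr mulrN opprK mulrA.
by rewrite [_ * (_ / _)]mulrC divfK.
Qed.

Lemma rho_lam_restr (u : 'rV[K']_n.+1) :
  rho gent (lam (u 0)) = lam ((u *m restr K n) 0).
Proof.
have L a : lam ((u *m restr K n) 0) = a -> a = lam ((u *m restr K n) 0) by move->.
apply/L; rewrite [RHS](_ : _ = \sum_i u 0 i *: rho gent 'X_i); last first.
  by rewrite /lam (lin_sum (rho_linear gent)); apply: eq_bigr => i _; rewrite (linZ (rho_linear _)).
rewrite /lam; under eq_bigr do rewrite mxE scaler_suml.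
rewrite exchange_big /=; apply: eq_bigr => i _.
have -> : rho gent 'X_i = lam (restr K n i).
  case: (unliftP ord_max i) => [k|] ->.
    rewrite rhoX /lam (bigD1 k) //= mxE liftK eqxx scale1r big1 ?addr0 // => j ne.
    by rewrite mxE liftK eq_sym (negbTE ne) scale0r.
  by rewrite rhoX_max /lam; apply: eq_bigr => k _; rewrite mxE unlift_none.
by rewrite /lam scaler_sumr; apply: eq_bigr => k _; rewrite scalerA.
Qed.

Variable d : nat.
Hypothesis htr : forall j, trdeg_ge (iota j) (xi j) d.+1.

(** A form whose product with the generic hyperplane lies in the span of the
    quadrics vanishes at the points, which do not lie on this hyperplane. *)
Lemma colon_ell r (A : 'M[K]_(r, n.+1)) (u : {mpoly K'[n.+1]}) :
  (forall v, vanish iota xi v -> (v <= A)%MS) ->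
  u \is 1.-homog ->
  extend (@inFt K n.+1) (quadrics iota xi) (ell gent * u) ->
  lforms (map_mx (@inFt K n.+1) A) u.
Proof.
move=> hA hu1 hu; pose u0 := \row_i u@_U_(i).
have eu : u = lam (u0 0).
  by rewrite {1}(homog1_lam hu1); apply: eq_bigr => i _; rewrite mxE.
exists u0 => //; have [d0 [a [d0n ha]]] := common_denominator (fun i => u0 0 i).
have -> : u0 = d0%:F^-1 *: \row_i (a i)%:F.
  by apply/rowP => i; rewrite ha !mxE mulrC.
apply: scalemx_sub; apply: vanishing_coefficients hA _ => j.
have [|it hit] := @exists_flift _ (fieldt (F j) n.+1)
    (@FracField.tofrac _ \o map_mpoly (iota j)).
  move=> x /= /eqP; rewrite tofrac_eq0 => /eqP e; apply/mpolyP => m.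
  apply/eqP; rewrite mcoeff0 -(fmorph_eq0 (iota j)) -mcoeff_map_mpoly.
  by apply/eqP; rewrite -[map_mpoly _ _]/(map_mpoly (iota j) x) e mcoeff0.
pose y i := inFt n.+1 (xi j i).
have it1 c : it (inFt n.+1 c) = inFt n.+1 (iota j c).
  by rewrite /inFt hit /= map_mpolyC.
have h : mmap it y (ell gent * u) = 0.
  apply: (hu (fun f => mmap it y f = 0)) => [|w [_ hw]].
    split=> [|c f g hf hg]; first by rewrite mmap0.
    by rewrite mmapD mmapZ hf hg mulr0 addr0.
  rewrite -[RHS](rmorph0 (@inFt (F j) n.+1)) -(hw j).
  move: w {hw}; apply: (rmorph_mpoly_eq (f := mmap it y \o map_mpoly (@inFt K n.+1))
    (g := @inFt (F j) n.+1 \o mmap (iota j) (xi j))) => [c|i] /=.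
    by rewrite map_mpolyC !mmapC; exact: it1.
  by rewrite map_mpolyX !mmapX !mmap1U.
have ell0 : mmap it y (ell gent) != 0.
  apply/eqP => e0; have := gent_vanish it y.
  have -> : y ord_max - \sum_k it (gent k) * y (lift ord_max k) = mmap it y (ell gent).
    rewrite /ell mmapB mmapX mmap1U; congr (_ - _).
    by rewrite [RHS]raddf_sum; apply: eq_bigr => k _ /=; rewrite mmapZ mmapX mmap1U.
  rewrite e0 mulr0 => /esym; under eq_bigr do rewrite hit /= map_mpolyX -tofracM.
  rewrite -raddf_sum => /eqP; rewrite tofrac_eq0 => /eqP.
  move=> e; have [T hT] := htr j; case/eqP: (indep_neq0 ord0 hT).
  rewrite /= -(mcoeff_lam (xi j) (T ord0)) (_ : lam _ = 0) ?mcoeff0 //.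
  by rewrite -[RHS]e; apply: eq_bigr => i _; rewrite mulrC mul_mpolyC.
move: h; rewrite rmorphM /= => /eqP; rewrite mulf_eq0 (negbTE ell0) /= => /eqP.
rewrite eu mmap_lam => h.
apply/eqP; rewrite -tofrac_eq0; apply/eqP.
rewrite -[RHS](mulr0 (it d0%:F)) -h mulr_sumr raddf_sum /=; apply: eq_bigr => i _.
rewrite ha fmorph_div mulrA [_ * (_ / _)]mulrC divfK ?fmorph_eq0 ?tofrac_eq0 //.
by rewrite tofracM hit.
Qed.

(** In the multiplier case the forms vanishing at the points have codimension
    at least [2 (d + 1)]; otherwise they are spanned by [M]. *)
Lemma vanish_qdim r (M : 'M[K]_(r, n.+1)) g :
  spanned_or_multiplier iota xi M -> (n.+1 <= g + (d.+1 + d.+1))%N ->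
  exists2 A : 'M[K]_n.+1, forall v, vanish iota xi v -> (v <= A)%MS &
    qdim_le (lforms (map_mx (@inFt K n.+1) A)) (lforms (map_mx (@inFt K n.+1) M)) g.
Proof.
move=> hM le; have [A hA] := subspace_mx (vanish_subspace iota xi).
exists A; first by move=> v /hA.
have sM := @lforms_subspace K' n.+1 r (map_mx (@inFt K n.+1) M).
case: hM => [hM|hm].
  apply: (qdim_le_weaken (leq0n g)); apply: qdim_le0; first exact: lforms_subspace.
  move=> z [u hu ->]; exists u => //; apply: submx_trans hu _.
  rewrite map_submx; apply/row_subP => k; apply: hM; apply/hA; exact: row_sub.
apply: (qdim_le_weaken _ (lforms_qdim (A := map_mx (@inFt K n.+1) A) sM)).
rewrite mxrank_map; have [G hG] := multiplier_rank htr hm.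
have rG : \rank G = (d.+1 + d.+1)%N.
  apply/eqP; rewrite -[_ == _]/(row_free G) -kermx_eq0; apply/eqP/row_matrixP => k.
  rewrite row0; apply: hG; have -> : row k (kermx G) *m G = 0.
    by apply/sub_kermxP; exact: row_sub.
  exact: (vanish_subspace iota xi).1.
have AG : (A :&: G = 0)%MS.
  apply/row_matrixP => k; rewrite row0.
  have : (row k (A :&: G) <= A :&: G)%MS by exact: row_sub.
  rewrite sub_capmx => /andP[/hA h1 /submxP[a ea]]; move: h1; rewrite ea => /hG ->.
  by rewrite mul0mx.
have := mxrank_sum_cap A G; rewrite AG mxrank0 addn0 rG => e.
by rewrite -(leq_add2r (d.+1 + d.+1)) -e (leq_trans (rank_leq_col _)).
Qed.

(** One generic section: extend the scalars to [K(t)], restrict to the hyperplane,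
    and descend again. *)
Lemma elim_section r (M : 'M[K]_(r, n.+1)) g D i (W' M' : {mpoly K'[n]} -> Prop) :
  (forall u, (u <= M)%MS -> vanish iota xi u) ->
  spanned_or_multiplier iota xi M -> (n.+1 <= g + (d.+1 + d.+1))%N ->
  subspace W' -> subspace M' ->
  (forall w, quadrics iota xi w -> W' (rho gent (map_mpoly (@inFt K n.+1) w))) ->
  (forall v, M' v ->
    exists2 u, lforms (map_mx (@inFt K n.+1) M) u & rho gent u = v) ->
  qdim_le (kcyc (@xop K' n) W' (m := n) (j := i))
    (kbnd (@xop K' n) M' (m := n) (j := i)) D ->
  qdim_le (kcyc (@xop K n.+1) (quadrics iota xi) (m := n.+1) (j := i))
    (kbnd (@xop K n.+1) (lforms M) (m := n.+1) (j := i)) (D + 'C(n, i) * g).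
Proof.
move=> Mv hM le sW' sM' WW' MM' hD.
apply: (poly_descent (iota := @inFt K n.+1)
          (W' := extend (@inFt K n.+1) (quadrics iota xi))).
  by move=> u hu P sP hP; exact: hP.
have [A hA hg] := vanish_qdim hM le.
apply: (poly_elim (t := gent) _ _ _ sM' _ _ MM' _ hg hD).
- exact: lforms_subspace.
- exact: extend_subspace.
- exact: lforms_subspace.
- move=> k u [v /submxP[a ->] ->].
  have -> : lam ((a *m map_mx (@inFt K n.+1) M) 0)
      = \sum_l a 0 l *: map_mpoly (@inFt K n.+1) (lam (row l M 0)).
    rewrite /lam; under eq_bigr do rewrite mxE scaler_suml.
    rewrite exchange_big /=; apply: eq_bigr => l _; rewrite rmorph_sum scaler_sumr /=.
    by apply: eq_bigr => j _; rewrite map_mpolyZX scalerA !mxE.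
  rewrite (lin_sum (xop_linear k)).
  have sE := @extend_subspace _ _ (@inFt K n.+1) _ (quadrics iota xi).
  apply: (@subspace_sum K' {mpoly K'[n.+1]} _ _ _ _ _ sE) => l _; rewrite (linZ (xop_linear k)).
  apply: (@subspaceZ K' {mpoly K'[n.+1]} _ _ _ sE) => P sP hP; have -> : xop k (map_mpoly (@inFt K n.+1) (lam (row l M 0)))
     = map_mpoly (@inFt K n.+1) (xop k (lam (row l M 0))).
    rewrite /xop rmorphM /=; congr (_ * _); rewrite /mvar; case: insub => [o|].
      by rewrite map_mpolyX.
    by rewrite rmorph0.
  apply: hP; split.
    rewrite /xop /mvar; case: insub => [o|]; last by rewrite mul0r rpred0.
    by apply: (dhomogM (d := 1%N) (e := 1%N) _ (lam_homog _)); rewrite dhomogX /= mdeg1.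
  move=> j; rewrite /xop rmorphM /= mmap_lam.
  by have := Mv _ (row_sub l M) j => ->; rewrite mulr0.
- move=> u hu; apply: (hu (fun f => f \is 2.-homog /\ W' (rho gent f))).
    split; first by rewrite rpred0 (lin0 (rho_linear _)); split=> //; exact: sW'.1.
    move=> a v w [hv hv'] [hw hw']; split; first exact: (homog_subspace _ _ 2).2.
    by rewrite rho_linear; exact: sW'.2.
  by move=> w hw; split; [exact: map_mpoly_homog hw.1|exact: WW'].
- by move=> u hu1 hu; exact: colon_ell hA hu1 hu.
Qed.
End SectionStep.

(** The number of linear forms met when eliminating [x_k]: by the trivial bound below
    [h], by the multiplier bound [2 h - (k + 1)] from [h] on. It is also the number of
    pairs [a, b < h] with [a + b = k]. *)
Definition strand_term (h k : nat) : nat := if (k < h)%N then k.+1 else (2 * h - k.+1)%N.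

Definition strand_bound (h n i : nat) : nat := (\sum_(k < n) strand_term h k * 'C(k, i))%N.

Section FamilyStep.
Variables (K : fieldType) (n : nat) (J : Type) (F : J -> fieldType).
Variables (iota : forall j, {rmorphism K -> F j}) (xi : forall j, 'I_n.+1 -> F j).
Local Notation K' := (fieldt K n.+1).
Variables (F2 : J -> fieldType) (iota2 : forall j, {rmorphism K' -> F2 j}).
Variable e : forall j, {rmorphism F j -> F2 j}.
Local Notation xi2 := (fun j (i : 'I_n) => e j (xi j (widen_ord (leqnSn n) i))).
Hypothesis iotaE : forall j a, iota2 j (inFt n.+1 a) = e j (iota j a).
Hypothesis onplane : forall j, \sum_i iota2 j ('X_i)%:F * e j (xi j i) = 0.

Lemma mmap_section j f :
  mmap (iota2 j) (xi2 j) (rho (@gent K n) f) = mmap (iota2 j) (fun i => e j (xi j i)) f.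
Proof.
have tn : iota2 j ('X_ord_max)%:F != 0.
  by rewrite fmorph_eq0 tofrac_eq0 -msize_poly_eq0 msizeX.
rewrite -(mmap_rho (t := @gent K n)).
  apply: mmap_eq => i /=; congr (e j (xi j _)).
  by apply: val_inj; rewrite /= /bump leqNgt ltn_ord.
apply/eqP; rewrite -subr_eq0; apply/eqP; apply: (mulfI tn).
rewrite mulr0; exact: etrans (gent_vanish (iota2 j) (fun i => e j (xi j i))) (onplane j).
Qed.

Lemma mmap_extension j w : mmap (iota2 j) (fun i => e j (xi j i))
    (map_mpoly (@inFt K n.+1) w) = e j (mmap (iota j) (xi j) w).
Proof.
apply: (rmorph_mpoly_eq (f := mmap (iota2 j) (fun i => e j (xi j i)) \o
    map_mpoly (@inFt K n.+1)) (g := e j \o mmap (iota j) (xi j))) w => [c|i] /=.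
  by rewrite map_mpolyC !mmapC; exact: iotaE.
by rewrite map_mpolyX !mmapX !mmap1U.
Qed.

Lemma quadrics_section w : quadrics iota xi w ->
  quadrics iota2 xi2 (rho (@gent K n) (map_mpoly (@inFt K n.+1) w)).
Proof.
move=> [hw hv]; split=> [|j]; first by apply: rho_homog; exact: map_mpoly_homog.
by rewrite mmap_section mmap_extension hv rmorph0.
Qed.

Lemma vanish_section r (M : 'M[K]_(r, n.+1)) u :
  (forall u, (u <= M)%MS -> vanish iota xi u) ->
  (u <= map_mx (@inFt K n.+1) M *m restr K n)%MS -> vanish iota2 xi2 u.
Proof.
move=> hM /submxP[a ->] j; rewrite mulmxA -mmap_lam -rho_lam_restr mmap_section mmap_lam.
under eq_bigr do rewrite mxE rmorph_sum mulr_suml.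
rewrite exchange_big big1 // => l _ /=.
have := hM _ (row_sub l M) j => /(congr1 (e j)); rewrite rmorph0 rmorph_sum => h.
transitivity (iota2 j (a 0 l) * \sum_i e j (iota j (row l M 0 i) * xi j i)).
  by rewrite mulr_sumr; apply: eq_bigr => i _; rewrite !mxE !rmorphM -iotaE mulrA.
by rewrite h mulr0.
Qed.
End FamilyStep.

(** The bound on the linear strand of a family of points in [h + d] variables
    spanning transcendence degree [d]: cut by generic hyperplanes until all
    points are gone, then eliminate the remaining [h] variables. *)
Theorem family_bound (h d : nat) (K : fieldType) (J : Type) (F : J -> fieldType) n
    (iota : forall j, {rmorphism K -> F j}) (xi : forall j, 'I_n -> F j)
    r (M : 'M[K]_(r, n)) i :
  n = (h + d)%N -> (forall j, trdeg_ge (iota j) (xi j) d) ->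
  (0 < d -> spanned_or_multiplier iota xi M)%N ->
  (forall u, (u <= M)%MS -> vanish iota xi u) ->
  qdim_le (kcyc (@xop K n) (quadrics iota xi) (m := n) (j := i))
    (kbnd (@xop K n) (lforms M) (m := n) (j := i)) (strand_bound h n i).
Proof.
have base (L : fieldType) :
    qdim_le (kcyc (@xop L h) (fun f => f \is 2.-homog) (m := h) (j := i))
      (kbnd (@xop L h) (fun f => f = 0) (m := h) (j := i)) (strand_bound h h i).
  have := @homog_bound L h i; rewrite /strand_bound.
  by congr qdim_le; apply: eq_bigr => k _; rewrite /strand_term ltn_ord.
elim: d K F n iota xi r M => [|d IH] K F n iota xi r M.
  rewrite addn0 => en; subst n => _ _ _; apply: (qdim_le_sub _ _ _ (base K)).
  - move=> z [hz Dz]; split=> //; apply: kall_sub hz => f; by case.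
  - move=> z _ [w hw ->]; exists w => //; apply: kall_sub hw => f ->.
    exact: (lforms_subspace M).1.
  - exact: kcyc_subspace (@xop_linear K h) (quadrics_subspace iota xi).
rewrite addnS; case: n iota xi M => // n iota xi M [en] htr hM Mv.
rewrite /strand_bound big_ord_recr /= [(strand_term _ _ * _)%N]mulnC -/(strand_bound h n i).
have le : (n.+1 <= strand_term h n + (d.+1 + d.+1))%N.
  by rewrite /strand_term en; case: (ltnP (h + d) h); lia.
have {}hM := hM isT.
case: d htr le en IH => [|d] htr le en IH.
  rewrite addn0 in en; subst n.
  apply: (elim_section htr Mv hM le (W' := fun f => f \is 2.-homog)
            (M' := fun f => f = 0) _ _ _ _ (base _)).
  - exact: homog_subspace.
  - exact: zero_subspace.
  - by move=> w [hw _]; apply: rho_homog; exact: map_mpoly_homog.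
  - move=> v ->; exists 0; first exact: (lforms_subspace _).1.
    exact: lin0 (rho_linear _).
have [F2 [iota2 [e [htr2 iotaE onplane hM2]]]] := family_section htr.
set xi2 := (fun j (i : 'I_n) => _) in htr2 hM2.
pose M2 := map_mx (@inFt K n.+1) M *m restr K n.
have h2 := IH _ F2 n iota2 xi2 r M2 en htr2 (fun=> hM2 _ M hM)
   (fun u => vanish_section iotaE onplane Mv (u := u)).
apply: (elim_section htr Mv hM le _ _ _ _ h2).
- exact: quadrics_subspace.
- exact: lforms_subspace.
- exact: (quadrics_section iotaE onplane).
- move=> v [u /submxP[a ->] ->].
  exists (lam ((a *m map_mx (@inFt K n.+1) M) 0)).
    by exists (a *m map_mx (@inFt K n.+1) M); rewrite // submxMl.
  by rewrite rho_lam_restr mulmxA.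
Qed.

(** Partial summation; the same holds for [strand_bound_geE]. *)
Lemma strand_bound_leE h n i : (n <= h)%N ->
  (strand_bound h n i + 'C(n, i.+2) = n * 'C(n, i.+1))%N.
Proof.
elim: n => [|n IH] le; first by rewrite /strand_bound big_ord0.
have {}IH := IH (ltnW le).
rewrite /strand_bound big_ord_recr /= -/(strand_bound h n i) /strand_term le !binS.
by move: IH; rewrite !mulnDr !mulSn; lia.
Qed.

Lemma strand_bound_geE h d i : (d <= h)%N ->
  (strand_bound h (h + d) i + 2 * 'C(h, i.+2)
   = (h - d) * 'C(h + d, i.+1) + 'C(h + d, i.+2))%N.
Proof.
elim: d => [|d IH] le.
  by rewrite addn0 subn0; have := strand_bound_leE i (leqnn h); lia.
have {}IH := IH (ltnW le); have [e he] : exists e, (h - d.+1)%N = e by exists (h - d.+1)%N.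
rewrite addnS /strand_bound big_ord_recr /= -/(strand_bound h (h + d) i) /strand_term.
rewrite ltnNge leq_addr /= !binS.
have -> : (2 * h - (h + d).+1 = e)%N by lia.
have he2 : (h - d = e.+1)%N by lia.
rewrite he; rewrite he2 in IH.
by move: IH; rewrite !mulnDr !mulSn; lia.
Qed.

(** Vandermonde's identity in the shape of the sharp bound. *)
Lemma strand_bound_double h i : (strand_bound h h.*2 i + 2 * 'C(h, i.+2) = 'C(2 * h, i.+2))%N.
Proof. by have := strand_bound_geE i (leqnn h); rewrite addnn subnn [(2 * h)%N]mul2n. Qed.

Lemma strand_bound_le h n i : (strand_bound h n i <= strand_bound h h.*2 i)%N.
Proof.
have mono m k : (m <= k)%N -> (strand_bound h m i <= strand_bound h k i)%N.
  move=> /subnKC <-; elim: (k - m)%N => [|q IH]; first by rewrite addn0.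
  by rewrite addnS /strand_bound big_ord_recr /=; apply: leq_trans IH (leq_addr _ _).
have [le|lt] := leqP n h.*2; first exact: mono.
have : (h.*2 <= n)%N := ltnW lt; move=> /subnKC <-; elim: (n - _)%N => [|q IH].
  by rewrite addn0.
rewrite addnS /strand_bound big_ord_recr /= /strand_term ltnNge.
have -> : (h <= h.*2 + q)%N by lia.
have -> : (2 * h - (h.*2 + q).+1 = 0)%N by lia.
by rewrite mul0n addn0 -/(strand_bound h (h.*2 + q) i).
Qed.

(** * Noetherian rings *)

Definition idl (R : comNzRingType) (I : R -> Prop) : Prop :=
  I 0 /\ forall a x y, I x -> I y -> I (a * x + y).

(** Membership in the ideal generated by [s]; the quantification over ideals makes
    proofs by induction on generators immediate. *)
Definition ideal_gen (R : comNzRingType) (s : seq R) (f : R) : Prop :=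
  forall J, idl J -> (forall x, x \in s -> J x) -> J f.

Definition noetherian (R : comNzRingType) : Prop :=
  forall I : R -> Prop, idl I ->
    exists2 s : seq R, forall x, x \in s -> I x & forall f, I f -> ideal_gen s f.

Section Ideals.
Variable R : comNzRingType.
Implicit Types (I J : R -> Prop) (s t : seq R).

Lemma idlM I a x : idl I -> I x -> I (a * x).
Proof. by case=> h0 h hx; rewrite -[_ * _]addr0; apply: h. Qed.
Lemma idlD I x y : idl I -> I x -> I y -> I (x + y).
Proof. by case=> h0 h hx hy; rewrite -[x]mul1r; apply: h. Qed.
Lemma idlB I x y : idl I -> I x -> I y -> I (x - y).
Proof. by case=> h0 h hx hy; rewrite addrC -mulN1r; apply: h. Qed.
Lemma ideal_gen_idl s : idl (ideal_gen s).
Proof.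
split=> [J hJ _|a x y hx hy J hJ hs]; first by case: hJ.
by case: (hJ) => _; apply; [exact: hx|exact: hy].
Qed.

Lemma ideal_gen_mem s x : x \in s -> ideal_gen s x.
Proof. by move=> hx J _; apply. Qed.

Lemma ideal_gen_sub s t f : {subset s <= t} -> ideal_gen s f -> ideal_gen t f.
Proof. by move=> st h J hJ ht; apply: h => // x /st; exact: ht. Qed.

(** Otherwise dependent choice gives a strictly increasing sequence, whose union is
    finitely generated, hence equal to one of its members. *)
Lemma noetherian_max (Fam : (R -> Prop) -> Prop) I0 : noetherian R ->
  (forall I, Fam I -> idl I) -> Fam I0 ->
  exists2 I, Fam I & (forall x, I0 x -> I x) /\
    forall J, Fam J -> (forall x, I x -> J x) -> forall x, J x -> I x.
Proof.
move=> noe hF F0; apply: boolp.contrapT => no.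
pose T := {I : R -> Prop | Fam I /\ forall x, I0 x -> I x}.
have /boolp.choice[nx hnx] : forall I : T, exists J : T,
    (forall x, sval I x -> sval J x) /\ exists2 x, sval J x & ~ sval I x.
  move=> [I [FI sI]] /=; apply: boolp.contrapT => noJ; apply: no; exists I => //.
  split=> // J FJ IJ x Jx; apply: boolp.contrapT => nIx; apply: noJ.
  have hJ : Fam J /\ forall x, I0 x -> J x by split=> // y /sI; exact: IJ.
  by exists (exist _ J hJ); split=> //; exists x.
pose c k : T := iter k nx (exist _ I0 (conj F0 (fun x (h : I0 x) => h))).
have mono k d x : sval (c k) x -> sval (c (k + d)%N) x.
  elim: d => [|d IH]; first by rewrite addn0.
  by move=> /IH h; rewrite addnS; exact: (hnx _).1.
have hc k : idl (sval (c k)) by apply: hF; case: (c k) => J [].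
pose U x := exists k, sval (c k) x.
have Uid : idl U.
  split=> [|a x y [k hx] [l hy]]; first by exists 0%N; case: (hc 0%N).
  exists (k + l)%N; case: (hc (k + l)%N) => _; apply; first exact: mono.
  by rewrite addnC; exact: mono.
have [s sU gU] := noe U Uid.
have [k hk] : exists k, forall x, x \in s -> sval (c k) x.
  elim: s sU {gU} => [|y s IH] sU; first by exists 0%N.
  have [|k hk] := IH; first by move=> x xs; apply: sU; rewrite inE xs orbT.
  have [l hl] := sU y (mem_head _ _).
  exists (k + l)%N => x; rewrite inE => /orP[/eqP ->|/hk]; last exact: mono.
  by rewrite addnC; exact: mono.
have [x hx nx'] := (hnx (c k)).2; apply: nx'.
by apply: (gU x _ _ (hc k) hk); exists k.+1.
Qed.
End Ideals.

Lemma noetherian_surj (R S : comNzRingType) (f : {rmorphism R -> S}) :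
  (forall y, exists x, f x = y) -> noetherian R -> noetherian S.
Proof.
move=> surj noe I Iid; have [|s sI gI] := noe (I \o f).
  case: Iid => h0 h; split=> [|a x y hx hy] /=; first by rewrite rmorph0.
  by rewrite rmorphD rmorphM; apply: h.
exists (map f s) => [y /mapP[x /sI ? ->] //|y].
have [x <-] := surj y => /gI g J [J0 JD] hs; apply: (g (J \o f)) => /=.
  by split=> [|a u v hu hv] /=; rewrite ?rmorph0 // rmorphD rmorphM; apply: JD.
by move=> u us; apply: hs; apply: map_f.
Qed.

Lemma noetherian_field (K : fieldType) : noetherian K.
Proof.
move=> I Iid; have [[x hx x0]|no] := boolp.EM (exists2 x, I x & x != 0).
  exists [:: x] => [y|f _ J hJ hs]; first by rewrite inE => /eqP ->.
  by rewrite -(divfK x0 f); apply: idlM => //; apply: hs; rewrite inE.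
exists [::] => // f hf J [J0 _] _; suff -> : f = 0 by [].
by apply/eqP/negPn/negP => f0; apply: no; exists f.
Qed.

(** Hilbert's basis theorem: generators of an ideal [I] are obtained by lifting
    generators of the ideals of its leading coefficients in each degree; these
    ideals form an increasing sequence, stationary from some degree [D]. *)
Lemma noetherian_poly (R : comNzRingType) : noetherian R -> noetherian {poly R}.
Proof.
move=> noe I Iid; pose L d a := exists2 f : {poly R}, I f & (size f <= d.+1)%N /\ f`_d = a.
have Lid d : idl (L d).
  split=> [|a x y [f hf [sf ef]] [g hg [sg eg]]].
    by exists 0; [case: Iid|rewrite size_poly0 coef0].
  exists (a%:P * f + g); first by case: Iid => _; apply.
  split; last by rewrite coefD coefCM ef eg.
  by rewrite (leq_trans (size_polyD _ _)) // geq_max sg andbT mul_polyC (leq_trans (size_scale_leq _ _)).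
have Lmono d e x : L d x -> L (d + e)%N x.
  move=> [f hf [sf <-]]; exists ('X^e * f); first exact: idlM.
  split; last by rewrite coefXnM ltnNge leq_addl /= addnK.
  have [->|f0] := eqVneq f 0; first by rewrite mulr0 size_poly0.
  by rewrite mulrC size_mulXn // addnC -addSn leq_add2r.
pose good d (t : seq {poly R}) := forall a, L d a ->
  exists2 f, ideal_gen t f & (size f <= d.+1)%N /\ f`_d = a.
have goodS d s t : {subset s <= t} -> good d s -> good d t.
  by move=> st h a /h[f hf ?]; exists f => //; exact: ideal_gen_sub hf.
have lifts d s : (forall a, a \in s -> L d a) -> exists2 t,
    forall f, f \in t -> I f & forall a, ideal_gen s a ->
      exists2 f, ideal_gen t f & (size f <= d.+1)%N /\ f`_d = a.
  move=> hs; have [t tI ht] : exists2 t : seq {poly R}, forall f, f \in t -> I f & forall a, a \in s ->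
      exists2 f, f \in t & (size f <= d.+1)%N /\ f`_d = a.
    elim: s hs => [|a s IH] hs; first by exists [::].
    have [|t tI ht] := IH; first by move=> b hb; apply: hs; rewrite inE hb orbT.
    have [f hf e] := hs a (mem_head _ _).
    exists (f :: t) => [g|b]; rewrite inE; first by case/orP => [/eqP ->//|/tI].
    case/orP => [/eqP ->|/ht[g hg e']]; first by exists f; rewrite ?mem_head.
    by exists g => //; rewrite inE hg orbT.
  pose A a := exists2 f, ideal_gen t f & (size f <= d.+1)%N /\ f`_d = a.
  exists t => // a h; apply: (h A) => [|b /ht[f hf e]]; last first.
    by exists f => //; exact: ideal_gen_mem.
  have [g0 gD] := ideal_gen_idl t.
  split=> [|b x y [f hf [sf <-]] [g hg [sg <-]]]; first by exists 0; rewrite // size_poly0 coef0.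
  exists (b%:P * f + g); first exact: gD.
  split; last by rewrite coefD coefCM.
  by rewrite (leq_trans (size_polyD _ _)) // geq_max sg andbT mul_polyC (leq_trans (size_scale_leq _ _)).
have Linf : idl (fun a => exists d, L d a).
  split=> [|a x y [d hx] [e hy]]; first by exists 0%N; case: (Lid 0%N).
  exists (d + e)%N; case: (Lid (d + e)%N) => _; apply; first exact: Lmono.
  by rewrite addnC; exact: Lmono.
have [s sL gL] := noe _ Linf.
have [D hD] : exists D, forall a, a \in s -> L D a.
  elim: s sL {gL} => [|a s IH] sL; first by exists 0%N.
  have [|D hD] := IH; first by move=> b hb; apply: sL; rewrite inE hb orbT.
  have [e he] := sL a (mem_head _ _).
  exists (D + e)%N => b; rewrite inE => /orP[/eqP ->|/hD]; last exact: Lmono.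
  by rewrite addnC; exact: Lmono.
have [tD tDI htD] := lifts D s hD.
have high d : (D <= d)%N -> good d tD.
  move=> /subnKC <-; move: (d - D)%N => e a La.
  have [f hf [sf ef]] := htD a (gL a (ex_intro (fun d => L d a) _ La)).
  exists ('X^e * f); first exact: idlM (ideal_gen_idl _) hf.
  split; last by rewrite coefXnM ltnNge leq_addl /= addnK.
  have [->|f0] := eqVneq f 0; first by rewrite mulr0 size_poly0.
  by rewrite mulrC size_mulXn // addnC -addSn leq_add2r.
have low k : exists2 t, forall f, f \in t -> I f & forall d, (d < k)%N -> good d t.
  elim: k => [|k [t tI ht]]; first by exists [::].
  have [u uL gu] := noe (L k) (Lid k); have [v vI hv] := lifts k u uL.
  exists (t ++ v) => [f|d]; first by rewrite mem_cat => /orP[/tI|/vI].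
  rewrite ltnS leq_eqVlt => /orP[/eqP ->|/ht].
    by move=> a /gu /hv[f hf e]; exists f => //; apply: ideal_gen_sub hf => x; rewrite mem_cat orbC => ->.
  by apply: goodS => x; rewrite mem_cat => ->.
have [t tI ht] := low D; exists (t ++ tD) => [f|].
  by rewrite mem_cat => /orP[/tI|/tDI].
have allgood d : good d (t ++ tD).
  have [/ht|/high] := ltnP d D; apply: goodS => x; rewrite mem_cat => ->; rewrite ?orbT //.
move=> f; have [k] := ubnP (size f); elim: k f => // k IH f lt hf.
have [->|f0] := eqVneq f 0; first by case: (ideal_gen_idl (t ++ tD)).
have [|g hg [sg eg]] := allgood (size f).-1 f`_(size f).-1.
  by exists f => //; rewrite prednK // size_poly_gt0.
rewrite prednK ?size_poly_gt0 // in sg.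
have Ig : I g by apply: hg => // x; rewrite mem_cat => /orP[/tI|/tDI].
rewrite -(subrK g f); apply: idlD (ideal_gen_idl _) _ hg; apply: IH; last exact: idlB.
apply: (leq_trans _ (n := size f)); last by rewrite -ltnS.
rewrite -[X in (_ < X)%N]prednK ?size_poly_gt0 // ltnS.
apply/leq_sizeP => j; rewrite leq_eqVlt => /orP[/eqP <-|lj].
  by rewrite coefB eg subrr.
rewrite prednK ?size_poly_gt0 // in lj.
by rewrite coefB !nth_default ?subrr // (leq_trans sg).
Qed.

Lemma mmap_id (K : fieldType) n (g : {mpoly K[n]}) :
  mmap (@mpolyC n K) (fun i => 'X_i) g = g.
Proof.
apply: (rmorph_mpoly_eq (f := mmap (@mpolyC n K) (fun i => 'X_i)) (g := idfun)) => [c|i] /=.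
  exact: mmapC.
by rewrite mmapX mmap1U.
Qed.

(** A polynomial in [n + 1] variables as a polynomial in the variable [x_a]. *)
Lemma mpoly_split (K : fieldType) n (a : 'I_n.+1) (g : {mpoly K[n.+1]}) :
  exists q : {poly {mpoly K[n]}}, forall (R : comNzRingType) (f : {rmorphism K -> R}) y,
    mmap f y g = (map_poly (mmap f (y \o lift a)) q).[y a].
Proof.
elim/mpoly_ring_ind: g => [c|i|g1 g2 [q1 e1] [q2 e2]|g1 g2 [q1 e1] [q2 e2]].
- by exists (c%:MP)%:P => R f y; rewrite map_polyC hornerC /= !mmapC.
- case: (unliftP a i) => [k|] ->.
    by exists ('X_k)%:P => R f y; rewrite map_polyC hornerC /= !mmapX !mmap1U.
  by exists 'X => R f y; rewrite map_polyX hornerX mmapX mmap1U.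
- by exists (q1 + q2) => R f y; rewrite !rmorphD hornerD /= e1 e2.
by exists (q1 * q2) => R f y; rewrite !rmorphM hornerM /= e1 e2.
Qed.

Lemma mpoly_split_neq0 (K : fieldType) n (a : 'I_n.+1) (g : {mpoly K[n.+1]}) : g != 0 ->
  exists2 q : {poly {mpoly K[n]}}, q != 0 &
  forall (R : comNzRingType) (f : {rmorphism K -> R}) y,
    mmap f y g = (map_poly (mmap f (y \o lift a)) q).[y a].
Proof.
move=> g0; have [q hq] := mpoly_split a g; exists q => //.
by apply: contraNneq g0 => q0; rewrite -[g]mmap_id hq q0 rmorph0 horner0.
Qed.

Lemma noetherian_mpoly (K : fieldType) n : noetherian {mpoly K[n]}.
Proof.
elim: n => [|n IH].
  apply: (noetherian_surj (f := @mpolyC 0 K) _ (@noetherian_field K)) => y.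
  elim/mpoly_ring_ind: y => [c|[]//|f g [a <-] [b <-]|f g [a <-] [b <-]].
  - by exists c.
  - by exists (a + b); rewrite rmorphD.
  - by exists (a * b); rewrite rmorphM.
pose ren : {rmorphism {mpoly K[n]} -> {mpoly K[n.+1]}} :=
  mmap (@mpolyC n.+1 K) (fun i => 'X_(lift ord_max i)).
apply: (noetherian_surj (f := horner_eval 'X_ord_max \o map_poly ren) _ (noetherian_poly IH)) => y.
by have [q hq] := mpoly_split ord_max y; exists q; rewrite /= -[RHS]mmap_id hq.
Qed.

Local Open Scope quotient_scope.

(** * Prime ideals and their generic points *)

Section QuotientDomain.
Variables (R : comNzRingType) (p : {pred R}).
Hypothesis hp : prime_ideal p.

Definition prime_pack : prime_idealr R :=
  HB.pack p (isIdealr.Build R p hp.1) (isPrimeIdealrClosed.Build R p hp.2).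
Local Notation Q := {ideal_quot prime_pack}.

Let unitQ : {pred Q} := fun x => boolp.asbool (exists y : Q, y * x = 1).
Let invQ (x : Q) : Q :=
  if boolp.pselect (exists y : Q, y * x = 1) is left h then projT1 (boolp.cid h) else x.

Let mulVQ : {in unitQ, left_inverse 1 invQ *%R}.
Proof.
move=> x /boolp.asboolP h; rewrite /invQ; case: boolp.pselect => // h'.
by case: (boolp.cid h').
Qed.
Let unitQP (x y : Q) : y * x = 1 -> x \in unitQ.
Proof. by move=> h; apply/boolp.asboolP; exists y. Qed.
Let invQ_out : {in [predC unitQ], invQ =1 id}.
Proof.
move=> x /negP hx; rewrite /invQ; case: boolp.pselect => // h; case: hx.
exact/boolp.asboolP.
Qed.

Definition quotient_unit : comUnitRingType :=
  HB.pack Q (GRing.ComNzRing_hasMulInverse.Build Q mulVQ unitQP invQ_out).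
Definition quotient_domain : idomainType :=
  HB.pack quotient_unit (GRing.ComUnitRing_isIntegral.Build quotient_unit
    (@Quotient.rquot_IdomainAxiom _ prime_pack)).

(** The fraction field of the quotient, which is made into an integral domain by
    choosing inverses. *)
Lemma exists_residue_field : exists (F : fieldType) (f : {rmorphism R -> F}),
  forall x, (x \in p) = (f x == 0).
Proof.
pose f : {rmorphism R -> {fraction quotient_domain}} :=
  (@FracField.tofrac quotient_domain \o (\pi_Q : R -> quotient_domain)).
exists {fraction quotient_domain}, f => x.
rewrite /f /= tofrac_eq0.
have := @Quotient.equivE _ prime_pack x 0; rewrite subr0 => <-.
by rewrite [in RHS](_ : 0 = \pi_Q 0) ?piE // rmorph0.
Qed.
End QuotientDomain.

Definition is_point (K F : fieldType) n (iota : {rmorphism K -> F}) (xi : 'I_n -> F)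
    (p : {pred {mpoly K[n]}}) : Prop :=
  forall f, (f \in p) = (mmap iota xi f == 0).

Lemma exists_point (K : fieldType) n (p : {pred {mpoly K[n]}}) : prime_ideal p ->
  exists (F : fieldType) (iota : {rmorphism K -> F}) (xi : 'I_n -> F), is_point iota xi p.
Proof.
move=> /exists_residue_field[F [g hg]].
exists F, (g \o @mpolyC n K), (fun i => g 'X_i) => f; rewrite hg; congr (_ == 0).
apply: (rmorph_mpoly_eq (g := mmap (g \o @mpolyC n K) (fun i => g 'X_i))) => [c|i].
  by rewrite /= mmapC.
by rewrite /= mmapX mmap1U.
Qed.

Lemma ker_prime (R : comNzRingType) (D : idomainType) (f : {rmorphism R -> D}) :
  prime_ideal [pred x | f x == 0].
Proof.
have E x : (x \in [pred x | f x == 0]) = (f x == 0) by [].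
split; last by move=> u v; rewrite !E rmorphM mulf_eq0.
split=> [||a u v]; first by rewrite E rmorph0.
  by rewrite E rmorph1 oner_eq0.
by rewrite !E rmorphD rmorphM => /eqP -> /eqP ->; rewrite mulr0 addr0.
Qed.

Section Extension.
Variables (K F : fieldType) (iota : {rmorphism K -> F}).

Lemma indep_eq d (y z : 'I_d -> F) : y =1 z -> indep iota y -> indep iota z.
Proof. by move=> e h f; rewrite -(mmap_eq iota e) => /h. Qed.

Definition rcons_fun (T : Type) d (y : 'I_d -> T) (z : T) (i : 'I_d.+1) : T :=
  if unlift ord_max i is Some k then y k else z.

Lemma indep_or_algebraic d (y : 'I_d -> F) z :
  indep iota (rcons_fun y z) \/
  exists2 q : {poly {mpoly K[d]}}, q != 0 & (map_poly (mmap iota y) q).[z] = 0.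
Proof.
have [h|/boolp.existsNP[g /boolp.not_implyP[eg /eqP g0]]] :=
  boolp.EM (indep iota (rcons_fun y z)); [by left|right].
have [q q0 hq] := mpoly_split_neq0 ord_max g0; exists q => //.
rewrite -[RHS]eg hq /rcons_fun unlift_none; congr (_.[z]).
by apply: eq_map_poly => f /=; apply: mmap_eq => k /=; rewrite liftK.
Qed.

Lemma trdeg_ge_le n (xi : 'I_n -> F) d e : (d <= e)%N ->
  trdeg_ge iota xi e -> trdeg_ge iota xi d.
Proof.
move=> le [T hT]; exists (T \o widen_ord le).
apply: (indep_inj (s := widen_ord le) (y := xi \o T)) => // i j /(congr1 val) /= e'.
exact: val_inj.
Qed.

Lemma trdeg_ge_bound n (xi : 'I_n -> F) d : trdeg_ge iota xi d -> (d <= n)%N.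
Proof.
by move=> [T /indep_index_inj/leq_card]; rewrite !card_ord.
Qed.

Lemma exists_trdeg n (xi : 'I_n -> F) d : trdeg_ge iota xi d ->
  exists2 r, (d <= r)%N & trdeg_ge iota xi r /\ ~ trdeg_ge iota xi r.+1.
Proof.
move=> hd; have [k] := ubnP (n - d); elim: k d hd => // k IH d hd lt.
have [h|h] := boolp.EM (trdeg_ge iota xi d.+1); last by exists d.
have le := trdeg_ge_bound h.
have [|r le2 hr] := IH _ h; first by rewrite -ltnS (leq_trans _ lt) // !ltnS subnS prednK ?subn_gt0.
by exists r => //; exact: ltnW.
Qed.

Lemma maximal_algebraic n (xi : 'I_n -> F) r (T : 'I_r -> 'I_n) :
  ~ trdeg_ge iota xi r.+1 -> forall i, exists2 q : {poly {mpoly K[r]}}, q != 0 &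
    (map_poly (mmap iota (xi \o T)) q).[xi i] = 0.
Proof.
move=> hmax i; have [h|//] := indep_or_algebraic (xi \o T) (xi i).
case: hmax; exists (rcons_fun T i); apply: indep_eq h => k.
by rewrite /rcons_fun /=; case: (unlift _ _).
Qed.
End Extension.

Section Specialization.
Variables (K F1 F2 : fieldType) (iota1 : {rmorphism K -> F1}) (iota2 : {rmorphism K -> F2}).
Variables (n : nat) (xi1 : 'I_n -> F1) (xi2 : 'I_n -> F2).
Hypothesis sub12 : forall f, mmap iota1 xi1 f = 0 -> mmap iota2 xi2 f = 0.

Lemma indep_sub s (T : 'I_s -> 'I_n) : indep iota2 (xi2 \o T) -> indep iota1 (xi1 \o T).
Proof. by move=> hT g; rewrite -mmap_rename => /sub12; rewrite mmap_rename => /hT. Qed.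

Lemma trdeg_ge_sub s : trdeg_ge iota2 xi2 s -> trdeg_ge iota1 xi1 s.
Proof. by move=> [T /indep_sub]; exists T. Qed.

(** Were the first point algebraic over [K(x_T)], a function vanishing only at
    the second point would satisfy an equation over [K[x_T]] with nonzero constant
    term; this term would vanish at the second point. *)
Lemma trdeg_ge_strict f s : mmap iota2 xi2 f = 0 -> mmap iota1 xi1 f != 0 ->
  trdeg_ge iota2 xi2 s -> trdeg_ge iota1 xi1 s.+1.
Proof.
move=> f2 f1 [T hT]; apply: boolp.contrapT => hmax; have hT1 := indep_sub hT.
have [i1 hi1] := exists_flift (f := mmap iota1 (xi1 \o T)) hT1.
have alg g : algebraicOver i1 (mmap iota1 xi1 g).
  elim/mpoly_ring_ind: g => [c|i|g h ag ah|g h ag ah].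
  - suff <- : i1 (c%:MP)%:F = mmap iota1 xi1 c%:MP by exact: algebraic_id.
    rewrite hi1; apply: (@etrans _ _ (iota1 c)); first exact: mmapC.
    exact/esym/mmapC.
  - have [q q0 hq] := maximal_algebraic T hmax i; rewrite mmapX mmap1U.
    exists (map_poly (@FracField.tofrac _) q).
      by rewrite map_poly_eq0_id0 // tofrac_eq0 lead_coef_eq0.
    rewrite -map_poly_comp /root; apply/eqP; rewrite -[RHS]hq; congr (_.[_]).
    by apply: eq_map_poly => x /=; rewrite hi1.
  - by rewrite rmorphD; exact: algebraic_add.
  - by rewrite rmorphM; exact: algebraic_mul.
have [P P0 rP] := alg f; set w := mmap iota1 xi1 f in f1 rP.
have [m [Q hQ eP]] := multiplicity_XsubC P 0.
rewrite P0 /= in hQ; have Q0 : Q`_0 != 0 by rewrite -horner_coef0.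
have rQ : (map_poly i1 Q).[w] = 0.
  move: rP; rewrite eP rmorphM rmorphXn rmorphB /= map_polyX map_polyC /= rmorph0 subr0.
  by rewrite /root hornerM hornerXn mulf_eq0 expf_eq0 (negbTE f1) andbF orbF => /eqP.
have [d [a [d0 ha]]] := common_denominator (fun k : 'I_(size Q) => Q`_k).
have sQ : (0 < size Q)%N by rewrite size_poly_gt0; apply: contraNneq Q0 => ->; rewrite coef0.
have dF : d%:F != 0 by rewrite tofrac_eq0.
pose ren := mmap (@mpolyC n K) (fun i => 'X_(T i)).
have e1 : mmap iota1 xi1 (\sum_(k < size Q) ren (a k) * f ^+ k) = 0.
  rewrite -[RHS](mulr0 (i1 d%:F)) -rQ horner_coef size_map_poly mulr_sumr rmorph_sum /=.
  apply: eq_bigr => k _; rewrite coef_map /= ha fmorph_div mulrA [_ * (_ / _)]mulrC.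
  by rewrite divfK ?fmorph_eq0 // hi1 rmorphM rmorphXn /= /ren mmap_rename.
have := sub12 e1; rewrite rmorph_sum /= (bigD1 (Ordinal sQ)) //= expr0 mulr1.
rewrite big1 => [|k k0].
  rewrite addr0 /ren mmap_rename => /hT ea; case/eqP: Q0.
  by rewrite (ha (Ordinal sQ)) ea tofrac0 mul0r.
rewrite rmorphM rmorphXn /= f2 expr0n.
have -> : (k == 0 :> nat) = false by apply/negbTE; apply: contraNneq k0 => e0; apply/eqP/val_inj.
by rewrite mulr0.
Qed.
End Specialization.

(** Among the annihilators of the classes of [f * g] outside [I], a maximal one is
    prime; [f] is not in it because [I] is radical. *)
Lemma exists_associated (R : comNzRingType) (I : {pred R}) f : noetherian R ->
  idealr_closed I -> radical_ideal I -> f \notin I ->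
  exists2 p, associated_prime I p & f \notin p.
Proof.
move=> noe [I0 I1 ID] rad fI.
have IM a x : x \in I -> a * x \in I by move=> hx; rewrite -[_ * _]addr0; apply: ID.
pose Fam (J : R -> Prop) := exists2 g, f * g \notin I & forall x, J x <-> x * (f * g) \in I.
have [||J [g gI hJ] [_ Jmax]] := @noetherian_max R Fam (fun x => x * (f * 1) \in I) noe.
- move=> J [g _ hJ]; split=> [|a x y]; first by apply/hJ; rewrite mul0r.
  by move=> /hJ hx /hJ hy; apply/hJ; rewrite mulrDl -mulrA; apply: ID.
- by exists 1; rewrite // mulr1.
pose p : {pred R} := fun x => x * (f * g) \in I.
have pE x : (x \in p) = (x * (f * g) \in I) by [].
have hp : prime_ideal p.
  split; first split.
  - by rewrite pE mul0r.
  - by rewrite pE mul1r.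
  - by move=> a u v; rewrite !pE mulrDl -mulrA; apply: ID.
  move=> u v; rewrite !pE => huv.
  have [|hv] := boolP (v * (f * g) \in I); rewrite ?orbT // orbF.
  apply/hJ; apply: (Jmax (fun x => x * (f * (g * v)) \in I)).
  - by exists (g * v) => //; apply: contra hv; congr (_ \in I); ring.
  - by move=> x /hJ hx; have := IM v _ hx; congr is_true; congr (_ \in I); ring.
  - by move: huv; congr is_true; congr (_ \in I); ring.
exists p; first by split=> //; exists (f * g).
rewrite pE; apply: contra gI => h; apply: (rad _ 2); have := IM g _ h.
by congr is_true; congr (_ \in I); ring.
Qed.

Local Close Scope quotient_scope.

(** * Chains of primes and transcendence degree *)

Section ChainBelow.
Variables (K F : fieldType) (iota : {rmorphism K -> F}) (n : nat) (xi : 'I_n -> F).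

(** Substitution of the coordinates of the point for the variables in [A]. *)
Definition subst_point (A : pred 'I_n) : {mpoly K[n]} -> {mpoly F[n]} :=
  mmap (@mpolyC n F \o iota) (fun i => if A i then (xi i)%:MP else 'X_i).

HB.instance Definition _ A := GRing.RMorphism.copy (subst_point A)
  (mmap (@mpolyC n F \o iota) (fun i => if A i then (xi i)%:MP else 'X_i)).

Definition subst_ker (A : pred 'I_n) : {pred {mpoly K[n]}} :=
  [pred f | subst_point A f == 0].

Lemma subst_ker_prime A : prime_ideal (subst_ker A).
Proof. exact: (@ker_prime _ _ (subst_point A)). Qed.

Lemma subst_ker_sub (A B : pred 'I_n) : (forall i, A i -> B i) ->
  {subset subst_ker A <= subst_ker B}.
Proof.
move=> AB f; rewrite -[f \in subst_ker A]/(subst_point A f == 0).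
rewrite -[f \in subst_ker B]/(subst_point B f == 0) => /eqP e.
pose psi := mmap (@mpolyC n F) (fun i => if B i then (xi i)%:MP else 'X_i).
suff -> : subst_point B f = psi (subst_point A f) by rewrite e /psi mmap0.
apply: (rmorph_mpoly_eq (f := subst_point B) (g := psi \o subst_point A)) => [c|i] /=.
  by rewrite /subst_point /psi !mmapC.
rewrite /subst_point /psi !mmapX !mmap1U; case Ai: (A i).
  by rewrite (AB i Ai) mmapC.
by rewrite mmapX mmap1U.
Qed.

Lemma subst_ker_full f : (f \in subst_ker predT) = (mmap iota xi f == 0).
Proof.
rewrite -[LHS]/(subst_point predT f == 0) -[RHS](@mpolyC_eq0 n); congr (_ == 0).
apply: (rmorph_mpoly_eq (f := subst_point predT) (g := @mpolyC n F \o mmap iota xi)) => [c|i] /=.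
  by rewrite /subst_point !mmapC.
by rewrite /subst_point !mmapX !mmap1U.
Qed.

Variables (r : nat) (T : 'I_r -> 'I_n).
Hypothesis hT : indep iota (xi \o T).
Hypothesis hmax : ~ trdeg_ge iota xi r.+1.

(** An equation of [x_j] over [K[x_T]] survives as long as [x_j] is free. *)
Lemma subst_ker_strict (A B : pred 'I_n) j : (forall k, A (T k)) -> ~~ A j -> B j ->
  (forall i, A i -> B i) -> ~ {subset subst_ker B <= subst_ker A}.
Proof.
move=> AT Aj Bj AB; have [q q0 hq] := maximal_algebraic T hmax j.
pose ren := mmap (@mpolyC n K) (fun i => 'X_(T i)).
pose g := (map_poly ren q).['X_j].
pose Q := map_poly (mmap iota (xi \o T)) q.
have E (C : pred 'I_n) : (forall k, C (T k)) ->
    subst_point C g = (map_poly (@mpolyC n F) Q).[subst_point C 'X_j].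
  move=> CT; rewrite /g -(horner_map (subst_point C)) /= -!map_poly_comp; congr (_.[_]).
  apply: eq_map_poly; apply: (rmorph_mpoly_eq (f := subst_point C \o ren)
    (g := @mpolyC n F \o mmap iota (xi \o T))) => [c|k] /=.
    by rewrite /ren /subst_point !mmapC.
  by rewrite /ren /subst_point !mmapX !mmap1U mmapX mmap1U CT.
have Q0 : Q != 0.
  rewrite map_poly_eq0_id0 //; apply: contra_neq q0 => /hT.
  by move=> e; apply/eqP; rewrite -lead_coef_eq0 e.
move=> /(_ g); rewrite -[g \in subst_ker B]/(subst_point B g == 0).
rewrite -[g \in subst_ker A]/(subst_point A g == 0) !E //; last by move=> k; exact: AB.
rewrite /subst_point !mmapX !mmap1U Bj (negbTE Aj) horner_map /= hq mpolyC0 eqxx.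
move=> /(_ isT)/eqP e; case/eqP: Q0; apply/polyP => k; rewrite coef0.
have := congr1 (mcoeff (U_(j) *+ k)) e; rewrite mcoeff0 horner_coef raddf_sum /=.
rewrite size_map_poly; clearbody Q; have [lt|ge] := ltnP k (size Q); last by rewrite nth_default.
move=> e'; rewrite -[RHS]e' (bigD1 (Ordinal lt)) //= coef_map /= mul_mpolyC mcoeffZ mpolyXn.
rewrite mcoeffX eqxx mulr1 big1 ?addr0 // => i ne.
rewrite coef_map /= mul_mpolyC mcoeffZ mpolyXn mcoeffX; case: eqP => [/mnmP/(_ j)|]; last by rewrite mulr0.
by rewrite !mulmnE mnm1E eqxx !mul1n => ei; case/eqP: ne; apply: val_inj.
Qed.

(** Freeing the coordinates outside a transcendence basis one by one gives the primes
    below the given one. *)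
Lemma chain_below : exists2 c, prime_chain (n - r) c & c (n - r)%N =i subst_ker predT.
Proof.
pose s := [seq i <- enum 'I_n | i \notin codom T].
have us : uniq s by rewrite filter_uniq ?enum_uniq.
have ss : size s = (n - r)%N.
  have -> : size s = #|[predC codom T]|.
    rewrite -(card_uniqP us); apply: eq_card => i.
    by rewrite mem_filter mem_enum andbT !inE.
  have := cardC (mem (codom T)); rewrite card_ord (card_codom (indep_index_inj hT)) card_ord.
  by move=> e; rewrite -[X in (X - r)%N]e addKn.
pose A k : pred 'I_n := fun i => (i \in codom T) || (i \in take k s).
have AT k l : A k (T l) by rewrite /A codom_f.
have AS k i : A k i -> A k.+1 i.
  rewrite /A; case: (i \in codom T) => //= hi; have [lt|ge] := ltnP k (size s).
    by rewrite (take_nth i lt) mem_rcons inE hi orbT.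
  by move: hi; rewrite !take_oversize // ltnW.
exists (fun k => subst_ker (A k)).
  split=> [k _|k lt]; first exact: subst_ker_prime.
  split; first exact/subst_ker_sub/AS.
  have lts : (k < size s)%N by rewrite ss.
  have [j0 _] : exists j : 'I_n, True by case: (s) lts => // j s' _; exists j.
  pose j := nth j0 s k; have js : j \in s by exact: mem_nth.
  have jT : j \notin codom T by move: js; rewrite mem_filter => /andP[].
  apply: (@subst_ker_strict _ _ j) => //; last exact: AS.
    rewrite /A (negbTE jT) /=; apply/negP => /nthP -/(_ j0)[i].
    rewrite size_take lts => lti; rewrite nth_take // => e.
    by move/eqP: e; rewrite nth_uniq // ?(ltn_trans lti) // => /eqP ei; rewrite ei ltnn in lti.
  by rewrite /A (take_nth j0 lts) mem_rcons mem_head orbT.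
move=> f; apply/idP/idP; apply: subst_ker_sub => // i _; rewrite /A.
have [//|hi] := boolP (i \in codom T); rewrite take_oversize ?ss //.
by rewrite mem_filter hi mem_enum.
Qed.
End ChainBelow.

Lemma trdeg_ge0 (K F : fieldType) (iota : {rmorphism K -> F}) n (xi : 'I_n -> F) :
  trdeg_ge iota xi 0.
Proof.
exists (fun k : 'I_0 => False_rect _ (notF (ltn_ord k))) => g.
have [c ->] : exists c, g = c%:MP.
  elim/mpoly_ring_ind: g => [c|[]//|f g [a ->] [b ->]|f g [a ->] [b ->]].
  - by exists c.
  - by exists (a + b); rewrite mpolyCD.
  - by exists (a * b); rewrite mpolyCM.
by rewrite mmapC => /eqP; rewrite fmorph_eq0 => /eqP ->.
Qed.

(** A chain of length [n - r] ends at the prime of a point of transcendence degree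
    [r], hence [n - r <= h]. *)
Lemma height_trdeg (K F : fieldType) (iota : {rmorphism K -> F}) n (xi : 'I_n -> F) p h :
  is_point iota xi p -> prime_height p h -> trdeg_ge iota xi (n - h).
Proof.
move=> hp [_ hh]; have [r _ [[T hT] hmax]] := exists_trdeg (trdeg_ge0 iota xi).
have [c hc ec] := chain_below hT hmax.
have le : (n - r <= h)%N by apply: hh hc _ => f; rewrite ec subst_ker_full hp.
apply: (trdeg_ge_le (e := r)); last by exists T.
by rewrite leq_subLR addnC -leq_subLR.
Qed.

Lemma degree_contra p q : (p + q).-1 = 1%N -> (1 < p)%N -> (0 < q)%N -> False.
Proof. lia. Qed.

Section ChainAbove.
Variables (K F : fieldType) (iota : {rmorphism K -> F}) (n : nat) (xi : 'I_n -> F).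
Variables (r : nat) (T : 'I_r.+1 -> 'I_n).
Hypothesis hT : indep iota (xi \o T).
Hypothesis hmax : ~ trdeg_ge iota xi r.+2.
Local Notation A := {mpoly K[r.+1]}.
Local Notation phi := (mmap iota xi).
Local Notation ev := (mmap iota (xi \o T)).

Let ren : {rmorphism A -> {mpoly K[n]}} := mmap (@mpolyC n K) (fun i => 'X_(T i)).

Let phi_ren g : phi (ren g) = ev g. Proof. exact: mmap_rename. Qed.

(** Integrality over [K[x_T, 1 / D]], the image of a polynomial ring in one
    more variable, which is mapped to [1 / D]. *)
Definition inv_eval (D : A) : {mpoly K[r.+2]} -> F :=
  mmap iota (rcons_fun (xi \o T) (ev D)^-1).
HB.instance Definition _ D := GRing.RMorphism.copy (inv_eval D)
  (mmap iota (rcons_fun (xi \o T) (ev D)^-1)).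

Let up : {rmorphism A -> {mpoly K[r.+2]}} :=
  mmap (@mpolyC r.+2 K) (fun i => 'X_(lift ord_max i)).

Let inv_eval_up D g : inv_eval D (up g) = ev g.
Proof.
rewrite /inv_eval /up mmap_rename; apply: mmap_eq => k /=.
by rewrite /rcons_fun liftK.
Qed.

Let inv_eval_last D : inv_eval D 'X_ord_max = (ev D)^-1.
Proof. by rewrite /inv_eval mmapX mmap1U /rcons_fun unlift_none. Qed.

Let ev_eq0 g : (ev g == 0) = (g == 0).
Proof. by apply/eqP/eqP => [/hT//|->]; rewrite mmap0. Qed.

(** Take for [D] the product of the leading coefficients of equations of all
    coordinates over [K[x_T]]. *)
Lemma exists_integral : exists2 D : A, D != 0 &
  forall f, integralOver (inv_eval D) (phi f).
Proof.
have /boolp.choice[q hq] : forall i, exists q : {poly A}, q != 0 /\ (map_poly ev q).[xi i] = 0.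
  by move=> i; have [q q0 e] := maximal_algebraic T hmax i; exists q.
pose l i := lead_coef (q i); pose D := \prod_i l i.
have D0 : D != 0 by apply/prodf_neq0 => i _; rewrite lead_coef_eq0 (hq i).1.
exists D => // f; elim/mpoly_ring_ind: f => [c|i|f g hf hg|f g hf hg].
- have -> : phi c%:MP = inv_eval D c%:MP by rewrite /inv_eval !mmapC.
  exact: integral_id.
- rewrite mmapX mmap1U; have [q0 qx] := hq i; pose m := (size (q i)).-1.
  pose oth := \prod_(j | j != i) l j.
  have eD : D = l i * oth by rewrite /D (bigD1 i).
  pose Z := up oth * 'X_ord_max.
  have Zl : inv_eval D Z * ev (l i) = 1.
    rewrite /Z rmorphM /= inv_eval_up inv_eval_last mulrAC -rmorphM /= mulrC [oth * _]mulrC -eD.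
    by rewrite mulVf // ev_eq0.
  pose Q := Z%:P * (map_poly up (q i) - (up (l i))%:P * 'X^m).
  have sQ : (size Q <= m)%N.
    rewrite /Q !mul_polyC; apply: leq_trans (size_scale_leq _ _) _; apply/leq_sizeP => j; rewrite leq_eqVlt.
    rewrite coefB coefZ coefXn coef_map /= => /orP[/eqP <-|lt].
      by rewrite eqxx mulr1 subrr.
    have -> : (q i)`_j = 0 by apply: nth_default; move: lt; rewrite /m; case: (size _).
    by rewrite rmorph0 gtn_eqF // mulr0 subr0.
  exists ('X^m + Q); first by rewrite monicE lead_coefDl ?lead_coefXn // size_polyXn ltnS.
  apply/rootP; rewrite rmorphD /= map_polyXn hornerD hornerXn /Q.
  rewrite [map_poly _ (_ * _)]rmorphM hornerM /= map_polyC hornerC /=.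
  rewrite [map_poly _ (_ - _)]rmorphB hornerD hornerN /= -map_poly_comp.
  rewrite [map_poly _ (_ * _)]rmorphM hornerM /= map_polyC hornerC map_polyXn hornerXn /=.
  have -> : map_poly (inv_eval D \o up) (q i) = map_poly ev (q i).
    by apply: eq_map_poly => g /=; rewrite inv_eval_up.
  by rewrite qx sub0r inv_eval_up mulrN mulrA Zl mul1r subrr.
- by rewrite rmorphD; exact: integral_add.
- by rewrite rmorphM; exact: integral_mul.
Qed.

(** Monotone in the exponent, so that finitely many denominators can be cleared at
    once. *)
Lemma clear_denominator D (b : {mpoly K[r.+2]}) : D != 0 ->
  exists e, forall e', (e <= e')%N -> exists B, inv_eval D b * ev D ^+ e' = ev B.
Proof.
move=> D0; have D1 : ev D != 0 by rewrite ev_eq0.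
have mono b0 e : (exists B, inv_eval D b0 * ev D ^+ e = ev B) ->
    forall e', (e <= e')%N -> exists B, inv_eval D b0 * ev D ^+ e' = ev B.
  move=> [B eB] e' le; exists (B * D ^+ (e' - e)).
  by rewrite rmorphM rmorphXn /= -eB -mulrA -exprD subnKC.
suff : exists e B, inv_eval D b * ev D ^+ e = ev B by move=> [e he]; exists e; exact: mono he.
elim/mpoly_ring_ind: b => [c|i|b c [e [B eB]] [e' [C eC]]|b c [e [B eB]] [e' [C eC]]].
- by exists 0%N, c%:MP; rewrite expr0 mulr1 /inv_eval !mmapC.
- case: (unliftP ord_max i) => [k|] ->.
    exists 0%N, 'X_k; rewrite expr0 mulr1 -[RHS](inv_eval_up D); congr (inv_eval D _).
    by rewrite /up /= mmapX mmap1U.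
  by exists 1%N, 1; rewrite expr1 inv_eval_last mulVf // rmorph1.
- have [B' eB'] := mono b e (ex_intro _ B eB) (e + e')%N (leq_addr _ _).
  have [C' eC'] := mono c e' (ex_intro _ C eC) (e + e')%N (leq_addl _ _).
  by exists (e + e')%N, (B' + C'); rewrite !rmorphD mulrDl eB' eC'.
by exists (e + e')%N, (B * C); rewrite !rmorphM /= -eB -eC exprD; ring.
Qed.

(** Modulo [1 + x_a D] the element [D] is a unit, so this polynomial would divide one
    free of [x_a], although its degree in [x_a] is positive. *)
Lemma no_multiple (a : 'I_r.+1) (D : A) (c : {mpoly K[r]}) e (w : A) : D != 0 -> c != 0 ->
  D ^+ e * mmap (@mpolyC r.+1 K) (fun i => 'X_(lift a i)) c <> (1 + 'X_a * D) * w.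
Proof.
move=> D0 c0 h; set c' := mmap _ _ c in h; set u := 1 + 'X_a * D in h.
have [v hv] : exists v, ('X_a * D) ^+ e = (- 1) ^+ e + u * v.
  have hs := subrXX ('X_a * D) (-1) e; rewrite opprK in hs.
  by eexists; apply/eqP; rewrite addrC -subr_eq hs /u [1 + _]addrC.
have {h} h : c' = u * ((- 1) ^+ e * ('X_a ^+ e * w - v * c')).
  have e1 : (-1) ^+ e * (-1) ^+ e = 1 :> A by rewrite -exprMn mulrNN mulr1 expr1n.
  have : 'X_a ^+ e * (D ^+ e * c') = 'X_a ^+ e * (u * w) by rewrite h.
  rewrite mulrA -exprMn hv => h2.
  rewrite [LHS](_ : c' = (-1) ^+ e * ((-1) ^+ e * c')); last by rewrite mulrA e1 mul1r.
  have -> : (-1) ^+ e * c' = 'X_a ^+ e * (u * w) - u * v * c' by rewrite -h2; ring.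
  ring.
pose m : {rmorphism A -> {poly {mpoly K[r]}}} := mmap (@polyC _ \o @mpolyC r K)
   (fun i => if unlift a i is Some k then ('X_k)%:P else 'X).
have mc : m c' = c%:P.
  rewrite /m /c' ; apply: (rmorph_mpoly_eq (f := m \o mmap (@mpolyC r.+1 K) (fun i => 'X_(lift a i)))
     (g := @polyC _)) => [x|i] /=; first by rewrite /m !mmapC.
  by rewrite /m !mmapX !mmap1U mmapX mmap1U liftK.
have mI g : m g = 0 -> g = 0.
  pose back : {rmorphism {poly {mpoly K[r]}} -> A} := horner_eval 'X_a \o
    map_poly (mmap (@mpolyC r.+1 K) (fun i => 'X_(lift a i))).
  have bm : back (m g) = g.
    apply: (rmorph_mpoly_eq (f := back \o m) (g := idfun)) => [x|i] /=.
      by rewrite /m mmapC /= /back /= map_polyC /horner_eval /= hornerC mmapC.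
    rewrite /m mmapX mmap1U /back /horner_eval /=; case: (unliftP a i) => [k|] ->.
      by rewrite map_polyC hornerC /= mmapX mmap1U.
    by rewrite map_polyX hornerX.
  by move=> e0; rewrite -bm e0 rmorph0.
have su : (1 < size (m u))%N.
  have mD : m D != 0 by apply: contra_neq D0 => /mI.
  have mX : m 'X_a = 'X by rewrite /m /= mmapX mmap1U unlift_none.
  have s1 : size ('X * m D) = (size (m D)).+1 by rewrite mulrC size_mulX.
  have gt : (0 < size (m D))%N by rewrite size_poly_gt0.
  rewrite rmorphD rmorph1 rmorphM /= mX addrC size_polyDl s1 ?size_poly1 //.
set vv := (_ * (_ - _)) in h; have e2 : c%:P = m u * m vv by rewrite -rmorphM -h mc.
have y0 : m vv != 0 by apply: contra_neq c0 => y00; apply/eqP; rewrite -polyC_eq0 e2 y00 mulr0.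
have x0 : m u != 0 by rewrite -size_poly_gt0 ltnW.
have e3 : (size (m u) + size (m vv)).-1 = 1%N.
  rewrite -(size_mul x0 y0) -e2 size_polyC c0; exact: erefl.
rewrite -size_poly_gt0 in y0; exact: degree_contra e3 su y0.
Qed.

Let lft (a : 'I_r.+1) : {rmorphism {mpoly K[r]} -> A} :=
  mmap (@mpolyC r.+1 K) (fun i => 'X_(lift a i)).

(** Otherwise multiply an integral equation of [f] by a power of [1 + x_a D] and of [D]:
    [1 + x_a D] would divide a power of [D] times a power of [c] in [K[x_T]]. *)
Lemma not_divisor (a : 'I_r.+1) (D : A) f c : D != 0 -> c != 0 ->
  integralOver (inv_eval D) (phi f) -> phi f * ev (1 + 'X_a * D) <> ev (lft a c).
Proof.
move=> D0 c0 [P Pm rP] h; set u := 1 + _ in h; pose n0 := (size P).-1.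
have sP : size P = n0.+1 by rewrite prednK // size_poly_gt0 monic_neq0.
have /boolp.choice[ee hee] := fun k : 'I_n0.+1 => clear_denominator P`_k D0.
pose e := (\max_k ee k)%N.
have /boolp.choice[B hB] : forall k : 'I_n0.+1, exists B, inv_eval D P`_k * ev D ^+ e = ev B.
  by move=> k; apply: hee; exact: leq_bigmax.
have e0 : \sum_(k < n0.+1) B k * (lft a c) ^+ k * u ^+ (n0 - k) = 0.
  apply: hT; rewrite rmorph_sum /=; have := rP.
  have le : (size (map_poly (inv_eval D) P) <= n0.+1)%N.
    by rewrite map_polyE (leq_trans (size_Poly _)) // size_map sP.
  rewrite /root (horner_coef_wide _ le).
  move=> /eqP/(congr1 (fun x => ev D ^+ e * ev u ^+ n0 * x)); rewrite mulr0 => e1.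
  rewrite -[RHS]e1 mulr_sumr; apply: eq_bigr => k _.
  rewrite !rmorphM !rmorphXn /= -hB -h exprMn coef_map /=.
  have -> : ev u ^+ n0 = ev u ^+ k * ev u ^+ (n0 - k).
    by rewrite -exprD subnKC // -ltnS.
  ring.
have BD : B ord_max = D ^+ e.
  apply/eqP; rewrite -subr_eq0 -ev_eq0 rmorphB rmorphXn /= -hB subr_eq0.
  have -> : P`_(@ord_max n0) = 1 by have := monicP Pm; rewrite /lead_coef sP.
  by rewrite rmorph1 mul1r.
apply: (@no_multiple a D (c ^+ n0) e (- \sum_(k < n0) B (widen_ord (leqnSn n0) k) *
  (lft a c) ^+ k * u ^+ (n0 - k.+1)) D0 (expf_neq0 _ c0)).
rewrite -[mmap _ _ _]/(lft a (c ^+ n0)) rmorphXn -/u.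
move: e0; rewrite big_ord_recr /= subnn expr0 mulr1 BD => /eqP.
rewrite addrC addr_eq0 => /eqP ->; rewrite mulrN mulr_sumr; congr (- _).
apply: eq_bigr => k _; have -> : (n0 - k = (n0 - k.+1).+1)%N by rewrite subnS prednK // subn_gt0.
by rewrite exprS; ring.
Qed.

(** With one coordinate [x_a] of the transcendence basis removed, [1 + x_a D] is not
    invertible modulo [p] over the field generated by the others. An ideal maximal
    among those containing [p] and [1 + x_a D] and avoiding the nonzero polynomials in
    the other coordinates is prime. *)
Lemma exists_prime_above : exists q : {pred {mpoly K[n]}},
  [/\ prime_ideal q, forall f, phi f = 0 -> f \in q,
      exists2 f, f \in q & phi f != 0 &
      forall (F2 : fieldType) (i2 : {rmorphism K -> F2}) xi2,
        is_point i2 xi2 q -> trdeg_ge i2 xi2 r].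
Proof.
have [D D0 hD] := exists_integral; pose a : 'I_r.+1 := ord_max.
pose u := ren (1 + 'X_a * D).
have u_ev : phi u = ev (1 + 'X_a * D) by rewrite phi_ren.
pose low c := ren (lft a c).
pose I0 x := exists f, phi x = phi f * phi u.
have I0id : idl I0.
  split=> [|b x y [f ef] [g eg]]; first by exists 0; rewrite !rmorph0 mul0r.
  by exists (b * f + g); rewrite !rmorphD !rmorphM /= ef eg mulrDl mulrA.
pose Fam (J : {mpoly K[n]} -> Prop) := [/\ idl J, forall x, I0 x -> J x &
   forall c, c != 0 -> ~ J (low c)].
have F0 : Fam I0.
  split=> // c c0 [f ef]; apply: (@not_divisor a D f c) => //.
  by rewrite -u_ev -ef /low phi_ren.
have [|J [Jid J0 Jav] [_ Jmax]] := @noetherian_max _ Fam I0 (@noetherian_mpoly K n) _ F0.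
  by move=> J [].
pose q : {pred {mpoly K[n]}} := fun f => boolp.asbool (J f).
have qP f : (f \in q) <-> J f by split=> [/boolp.asboolP|h]; [|apply/boolp.asboolP].
have J1 : ~ J 1.
  by move=> h; apply: (Jav 1 (oner_neq0 _)); rewrite /low !rmorph1.
have hext f : ~ J f -> exists2 c, c != 0 & exists2 g, J (low c - g * f) & True.
  move=> nf; apply: boolp.contrapT => no.
  pose J2 x := exists g, J (x - g * f).
  apply: nf; apply: (Jmax J2); last by exists 1; rewrite mul1r subrr; case: Jid.
    split.
    - split; first by exists 0; rewrite mul0r subr0; case: Jid.
      move=> b x y [g hg] [h hh]; exists (b * g + h).
      have -> : b * x + y - (b * g + h) * f = b * (x - g * f) + (y - h * f) by ring.
      by case: Jid => _; apply.
    - by move=> x /J0 hx; exists 0; rewrite mul0r subr0.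
    - by move=> c c0 [g hg]; apply: no; exists c => //; exists g.
  by move=> x hx; exists 0; rewrite mul0r subr0.
have qprime : prime_ideal q.
  split; first split.
  - by apply/qP; case: Jid.
  - by apply/negP => /qP.
  - by move=> b x y /qP hx /qP hy; apply/qP; case: Jid => _; apply.
  move=> f g /qP hfg; apply/orP.
  have [hf|/hext[c c0 [f' hf' _]]] := boolp.EM (J f); first by left; apply/qP.
  have [hg|/hext[c' c0' [g' hg' _]]] := boolp.EM (J g); first by right; apply/qP.
  case: (Jav (c * c')); first exact: mulf_neq0.
  have -> : low (c * c') = low c * (low c' - g' * g) + (g' * g) * (low c - f' * f)
      + (f' * g') * (f * g).
    have E (x y z t z' t' : {mpoly K[n]}) : x * y
        = x * (y - t' * t) + t' * t * (x - z' * z) + z' * t' * (z * t) by ring.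
    by rewrite -E /low !rmorphM.
  by apply: idlD => //; first apply: idlD => //; apply: idlM.
exists q; split=> // [f hf||F2 i2 xi2 hq].
- by apply/qP/J0; exists 0; rewrite hf rmorph0 mul0r.
- exists u; first by apply/qP/J0; exists 1; rewrite rmorph1 mul1r.
  rewrite u_ev ev_eq0; apply/eqP => u0.
  have := congr1 (mcoeff 0%MM) u0; rewrite mcoeffD mcoeff1 eqxx mulrC mcoeffMXU mnm0E eqxx.
  by rewrite addr0 mcoeff0; apply/eqP; exact: oner_neq0.
exists (T \o lift a) => g e; apply/eqP/negPn/negP => g0; apply: (Jav g g0); apply/qP.
rewrite hq /low -[X in _ == X]e; apply/eqP.
by rewrite /ren /lft /= mmap_rename mmap_rename.
Qed.
End ChainAbove.

(** The prime is enlarged step by step, each time with a loss of one degree of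
    transcendence. *)
Lemma chain_above (K : fieldType) n r : forall (p : {pred {mpoly K[n]}}), prime_ideal p ->
  (forall (F : fieldType) (iota : {rmorphism K -> F}) (xi : 'I_n -> F),
     is_point iota xi p -> trdeg_ge iota xi r) ->
  exists2 c, prime_chain r c & {subset p <= c 0%N}.
Proof.
elim: r => [|r IH] p hp htr.
  by exists (fun=> p); [split|].
have [F [iota [xi hxi]]] := exists_point hp.
have [[//|s] le [[T hT] hmax]] := exists_trdeg (htr _ _ _ hxi).
have [q [hq sub [f fq fp] hqt]] := exists_prime_above hT hmax.
have [|c [c1 c2] qc] := IH q hq.
  by move=> F2 i2 xi2 /hqt; apply: trdeg_ge_le.
have pq : {subset p <= q} by move=> g; rewrite hxi => /eqP/sub.
exists (fun k => if k is k'.+1 then c k' else p) => //; split=> [[|k]//|[_|k]] //.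
- exact: c1.
- split; first by move=> g /pq/qc.
  by move=> h; have := h f (qc _ fq); rewrite hxi (negbTE fp).
- exact: c2.
Qed.

Lemma chain_trdeg_add (K : fieldType) n d r (c : nat -> {pred {mpoly K[n]}}) :
  prime_chain d c ->
  (forall (F : fieldType) (iota : {rmorphism K -> F}) (xi : 'I_n -> F),
    is_point iota xi (c d) -> trdeg_ge iota xi r) ->
  forall (F : fieldType) (iota : {rmorphism K -> F}) (xi : 'I_n -> F),
    is_point iota xi (c 0%N) -> trdeg_ge iota xi (r + d).
Proof.
elim: d c => [|d IH] c [c1 c2] hr F iota xi hxi; first by rewrite addn0; exact: hr.
have [F2 [i2 [xi2 h2]]] := exists_point (c1 1%N isT).
have h := IH (fun k => c k.+1) _ hr F2 i2 xi2 h2.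
have [sub /boolp.existsNP[f /boolp.not_implyP[f1 f0]]] := c2 0%N isT.
rewrite addnS; apply: (@trdeg_ge_strict _ _ _ iota i2 n xi xi2 _ f) => //.
- by move=> g /eqP; rewrite -hxi => /sub; rewrite h2 => /eqP.
- by apply/eqP; rewrite -h2.
- by rewrite -hxi; apply/negP.
- by apply: h; split=> k hk; [exact: c1|exact: c2].
Qed.

Lemma chain_trdeg (K : fieldType) n d (c : nat -> {pred {mpoly K[n]}}) : prime_chain d c ->
  forall (F : fieldType) (iota : {rmorphism K -> F}) (xi : 'I_n -> F),
    is_point iota xi (c 0%N) -> trdeg_ge iota xi d.
Proof.
by move=> hc; apply: (chain_trdeg_add (r := 0) hc) => *; exact: trdeg_ge0.
Qed.

(** A prime of height [h] over [I] has transcendence degree at least [n - h] and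
    starts a chain of that length. So [dim S / I >= n - h], and by unmixedness the
    same holds for every associated prime; along a chain the transcendence degree
    strictly decreases. *)
Theorem associated_trdeg (K : fieldType) n (I p : {pred {mpoly K[n]}}) h :
  unmixed I -> height I h -> associated_prime I p ->
  forall (F : fieldType) (iota : {rmorphism K -> F}) (xi : 'I_n -> F),
    is_point iota xi p -> trdeg_ge iota xi (n - h).
Proof.
move=> um [[p0 [hp0 I0 h0]] _] ass F iota xi hxi.
have [c hc pc] := chain_above hp0 (fun F i x hx => height_trdeg hx h0).
have bound m (c' : nat -> {pred {mpoly K[n]}}) : prime_chain m c' -> (m <= n)%N.
  move=> hm; have [F' [i' [x' h']]] := exists_point (hm.1 0%N (leq0n m)).
  exact: trdeg_ge_bound (chain_trdeg hm h').
pose Q m := boolp.asbool (exists2 c : nat -> {pred {mpoly K[n]}},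
  prime_chain m c & {subset I <= c 0%N}).
have Q0 : exists m, Q m.
  by exists (n - h)%N; apply/boolp.asboolP; exists c => // f /I0; exact: pc.
have Qb m : Q m -> (m <= n)%N by move=> /boolp.asboolP[c' /bound].
have [d /boolp.asboolP[cd hd Id] dmax] := ex_maxnP Q0 Qb.
have qI : quotient_dim I d.
  by split; [exists cd|move=> m c' hm Ic'; apply: dmax; apply/boolp.asboolP; exists c'].
have le : (n - h <= d)%N by apply: dmax; apply/boolp.asboolP; exists c => // f /I0; exact: pc.
have [[cp hcp pcp] _] := (um p ass d).1 qI.
apply: trdeg_ge_le le _; have [F' [i' [x' h']]] := exists_point (hcp.1 0%N (leq0n d)).
apply: (trdeg_ge_sub (iota2 := i') (xi2 := x') _ (chain_trdeg hcp h')).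
by move=> f /eqP; rewrite -hxi => /pcp; rewrite h' => /eqP.
Qed.

(** * Exactness of Koszul complexes *)

Section Ends.
Variables (K : fieldType) (X : lmodType K).

Fixpoint kap n : kos X n 1 -> X :=
  match n with 0 => fun z => z | n'.+1 => fun z => kap z.1 end.
Fixpoint kin n (v : X) : kos X n 1 :=
  match n with 0 => v | n'.+1 => (kin n' v, 0) end.

Lemma kinK n v : kap (kin n v) = v. Proof. by elim: n. Qed.
Lemma kapK n (z : kos X n 1) : kin n (kap z) = z.
Proof. by elim: n z => [|n IH] z //=; apply: pairP; [exact: IH|exact: kos0P]. Qed.
Lemma kap_linear n : linear (@kap n).
Proof. by elim: n => [|n IH] a u v //=; rewrite IH. Qed.
Lemma kin_linear n : linear (kin n).
Proof.
elim: n => [|n IH] a u v //=; apply: pairP => /=; first exact: IH.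
exact: kos0P.
Qed.
Lemma kall_kin (P : X -> Prop) n v : P v -> kall P (kin n v).
Proof. by elim: n => [|n IH] //= /IH h; split=> //; exact: kall0. Qed.
Lemma kall_kap (P : X -> Prop) n (z : kos X n 1) : kall P z -> P (kap z).
Proof. by elim: n z => [|n IH] //= z [/IH]. Qed.
End Ends.

Lemma kap_kmap (K : fieldType) (X Y : lmodType K) (f : X -> Y) n (z : kos X n 1) :
  kap (kmap f z) = f (kap z).
Proof. by elim: n z => [|n IH] z //=. Qed.

Section Exactness.
Variables (K : fieldType) (X : lmodType K) (x : nat -> X -> X) (N : nat).
Variable sig : nat -> X -> X.
Hypothesis xL : forall k, linear (x k).
Hypothesis xC : forall k l u, x k (x l u) = x l (x k u).
Hypothesis sigL : forall n, linear (sig n).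
Hypothesis sig0 : forall v, sig 0 v = v.
Hypothesis sig_lt : forall n k v, (k < n)%N -> sig n (x k v) = 0.
Hypothesis sig_eq : forall n v, (n < N)%N -> sig n (x n v) = x n (sig n v).
Hypothesis sig_step : forall n v, (n < N)%N -> exists g, sig n v = sig n.+1 v + x n g.
Hypothesis sig_idem : forall n v, sig n (sig n v) = sig n v.
Hypothesis x_inj : forall n v, (n < N)%N -> x n v = 0 -> v = 0.

(** The image is [(x_0, ..., x_(n-1)) X], i.e. what is killed by setting these
    variables to zero. *)
Lemma kD_image n (b : kos X n 1) : (n <= N)%N ->
  (exists a : kos X n 2, kD x a = b) <-> sig n (kap b) = 0.
Proof.
elim: n b => [|n IH] b le.
  rewrite sig0; split=> [[a <-] //|e]; exists 0.
  by apply: etrans (esym e).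
split=> [[a <-]|e].
  have IH1 : sig n (kap (kD x a.1)) = 0 := (IH _ (ltnW le)).1 (ex_intro _ a.1 erefl).
  rewrite /= (linD (@kap_linear _ _ n)) kap_kmap (linD (sigL _)) (sig_lt _ (ltnSn n)) addr0.
  have [g eg] := sig_step (kap (kD x a.1)) le.
  have e1 : sig n.+1 (sig n.+1 (kap (kD x a.1))) = - sig n.+1 (x n g).
    by rewrite -(linN (sigL _)); congr (sig _ _); apply/eqP; rewrite -addr_eq0 -eg IH1.
  by rewrite -sig_idem e1 (sig_lt _ (ltnSn n)) oppr0.
have [g eg] := sig_step (kap b) le; rewrite [sig n.+1 (kap b)]e add0r in eg.
have [_ h] := IH (kin n (kap b - x n g)) (ltnW le).
have [|a ea] := h; first by rewrite kinK (linB (sigL _)) -eg sig_idem subrr.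
exists ((a, kin n g) : kos X n.+1 2); apply: pairP => /=; last exact: kos0P.
rewrite ea -[b.1]kapK -(kapK (kmap (x n) (kin n g))) kap_kmap kinK.
by rewrite -(linD (@kin_linear _ _ n)) subrK.
Qed.

(** In a cycle [a + e_n b] the coefficient [b] is a cycle, hence a boundary by induction;
    in lowest degree this is the regularity of [x_n] modulo the previous variables.
    Subtracting a boundary leaves a cycle in one variable less. *)
Lemma koszul_exact n q (z : kos X n q.+2) : (n <= N)%N -> kD x z = 0 ->
  exists w : kos X n q.+3, z = kD x w.
Proof.
elim: n q z => [|n IH] q z le; first by exists 0; exact: row0P.
have xD := linD (xL n); have xN := linN (xL n).
case: z => a b [e1 /eqP]; rewrite oppr_eq0 => /eqP e2.
have [b' eb] : exists b' : kos X n q.+2, b = kD x b'.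
  case: q a b e1 e2 => [|q] a b e1 e2; last exact: IH (ltnW le) e2.
  have h : sig n (kap (kmap (x n) b)) = 0.
    apply: ((kD_image (kmap (x n) b) (ltnW le)).1 _); exists (- a).
    by rewrite kDN //; apply/eqP; rewrite eqr_oppLR -addr_eq0 e1.
  rewrite kap_kmap sig_eq // in h.
  by have [a' <-] := (kD_image b (ltnW le)).2 (x_inj le h); exists a'.
have [a' ea] : exists a' : kos X n q.+3, a + kmap (x n) b' = kD x a'.
  apply: IH (ltnW le) _; rewrite kDD // -e1; congr (_ + _).
  by rewrite eb (kmap_kD (y := x)) // => k u _; rewrite xC.
exists ((a', - b') : kos X n.+1 q.+3); apply: pairP => /=.
  by rewrite -ea (kmap_opp xN) addrK.
by rewrite kDN // opprK.
Qed.
End Exactness.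

(** * Dimension shifting *)

Lemma kmap_kD2 (K : fieldType) (X Y : lmodType K) (f g : X -> Y)
    (x : nat -> X -> X) (y : nat -> Y -> Y) n :
  linear f -> linear g -> (forall k u, f (x k u) = y k (g u)) ->
  forall i (z : kos X n i.+1), kmap f (kD x z) = kD y (kmap g z).
Proof.
move=> fL gL h; elim: n => [|n IH] i z.
  case: i z => [|i] z; first exact: row0P.
  exact: (kmap0 (lin0 fL)).
case: i z => [|i] z; first exact: row0P.
apply: pairP => /=; last by rewrite (kmap_opp (linN fL)) IH.
rewrite (kmap_add (linD fL)) IH; congr (_ + _); rewrite !kmap_comp.
by apply: (kmap_eq (P := fun=> True)) (kallT _) => u _ /=.
Qed.

(** What is used of graded free modules, including the ring itself: commuting
    operators [gx k] of degree one, the projections [gpr e] to the homogeneous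
    components, and the exactness of the Koszul complex. *)
Record graded_module (K : fieldType) (N : nat) := GradedModule {
  gcar :> lmodType K;
  gx : nat -> gcar -> gcar;
  gpr : int -> gcar -> gcar;
  gx_linear : forall k, linear (gx k);
  gxC : forall k l u, gx k (gx l u) = gx l (gx k u);
  gpr_linear : forall e, linear (gpr e);
  gpr_x : forall e k u, gpr e (gx k u) = gx k (gpr (e - 1) u);
  gpr_idem : forall e u, gpr e (gpr e u) = gpr e u;
  gexact : forall q (z : kos gcar N q.+2), kD gx z = 0 -> exists w, z = kD gx w }.
Arguments gpr_linear {K N} g e.
Arguments gx_linear {K N} g k.

Section GradedChains.
Variables (K : fieldType) (N : nat) (X : graded_module K N).

Definition in_degree (e : int) (v : X) : Prop := gpr e v = v.

(** Cycles of a submodule that bound in the ambient module, and boundaries of the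
    submodule; [e] is the degree of the coefficients. In positive exterior degree
    the first are all cycles; in degree zero they are the part of the submodule that
    dies in the ambient module modulo the variables. This uniform definition makes
    the dimension shift valid in all degrees. *)
Definition hcyc (Z : X -> Prop) q (e : int) (z : kos X N q.+1) : Prop :=
  kall (fun v => Z v /\ in_degree e v) z /\
  exists2 w, kall (in_degree (e - 1)) w & z = kD (@gx _ _ X) w.
Definition hbnd (Z : X -> Prop) q (e : int) (z : kos X N q.+1) : Prop :=
  exists2 w, kall (fun v => Z v /\ in_degree (e - 1) v) w & z = kD (@gx _ _ X) w.

Lemma in_degree_subspace e : subspace (in_degree e).
Proof.
have L := gpr_linear X e; split; first exact: lin0 L.
by rewrite /in_degree => a u v hu hv; rewrite L hu hv.
Qed.

Lemma and_subspace (P Q : X -> Prop) : subspace P -> subspace Q ->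
  subspace (fun v => P v /\ Q v).
Proof.
move=> sP sQ; split; first by split; [exact: sP.1|exact: sQ.1].
by move=> a u v [? ?] [? ?]; split; [exact: sP.2|exact: sQ.2].
Qed.

Lemma hcyc_subspace Z q e : subspace Z -> subspace (@hcyc Z q e).
Proof.
move=> sZ; have s1 := kall_subspace N q.+1 (and_subspace sZ (in_degree_subspace e)).
have s2 := kall_subspace N q.+2 (in_degree_subspace (e - 1)).
have L := kD_linear (gx_linear X); split.
  by split; [exact: s1.1|exists 0; [exact: s2.1|rewrite (lin0 (L _ _))]].
move=> a u v [hu [u' hu' eu]] [hv [v' hv' ev]]; split; first exact: s1.2.
by exists (a *: u' + v'); [exact: s2.2|rewrite L -eu -ev].
Qed.

Lemma kall_in_degree e q (z : kos X N q) :
  kall (in_degree e) z <-> kmap (gpr e) z = z.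
Proof.
split=> [h|<-].
  by rewrite (kmap_eq (g := id) _ h) ?kmap_id.
by apply: (kall_map (P := fun=> True)) (kallT _) => v _; exact: gpr_idem.
Qed.

Lemma gpr_kD e q (w : kos X N q.+1) :
  kmap (gpr e) (kD (@gx _ _ X) w) = kD (@gx _ _ X) (kmap (gpr (e - 1)) w).
Proof. by apply: kmap_kD2 => [||k u]; rewrite ?gpr_x //; exact: gpr_linear. Qed.

Lemma graded_exact e q (z : kos X N q.+2) : kall (in_degree e) z ->
  kD (@gx _ _ X) z = 0 -> exists2 w, kall (in_degree (e - 1)) w & z = kD (@gx _ _ X) w.
Proof.
move=> /kall_in_degree hz /gexact[w ew]; exists (kmap (gpr (e - 1)) w).
  by apply: (kall_map (P := fun=> True)) (kallT _) => v _; exact: gpr_idem.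
by rewrite -gpr_kD -ew.
Qed.
End GradedChains.

Section Shift.
Variables (K : fieldType) (N : nat) (X Y : graded_module K N) (del : Y -> X).
Hypothesis delL : linear del.
Hypothesis del_x : forall k u, del (gx k u) = gx k (del u).
Hypothesis del_pr : forall e u, del (gpr e u) = gpr e (del u).
Local Notation D := (kD (@gx _ _ _)).

Definition im (v : X) : Prop := exists u, del u = v.
Definition ker (u : Y) : Prop := del u = 0.

Lemma ker_subspace : subspace ker.
Proof.
split; first exact: lin0 delL.
by rewrite /ker => a u v hu hv; rewrite delL hu hv scaler0 addr0.
Qed.
Lemma im_subspace : subspace im.
Proof.
split; first by exists 0; exact: lin0 delL.
by move=> a u v [u' <-] [v' <-]; exists (a *: u' + v'); rewrite delL.
Qed.

Let delD q (w : kos Y N q.+1) : kmap del (D w) = D (kmap del w).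
Proof. by apply: kmap_kD; [exact: (linD delL)|move=> k u _; exact: del_x]. Qed.

Let lift_degree e q (z : kos X N q) : kall (fun v => im v /\ in_degree e v) z ->
  exists2 y, kall (@in_degree _ _ Y e) y & kmap del y = z.
Proof.
apply: kall_lift => v [[u eu] hv]; exists (gpr e u); first exact: gpr_idem.
by rewrite del_pr eu.
Qed.

Let del_degree e q (y : kos Y N q) : kall (@in_degree _ _ Y e) y ->
  kall (fun v => im v /\ in_degree e v) (kmap del y).
Proof.
apply: kall_map => v hv; split; first by exists v.
by rewrite /in_degree -del_pr hv.
Qed.

Let ker_kmap q (y : kos Y N q) (P : Y -> Prop) : kall P y -> kmap del y = 0 ->
  kall (fun v => ker v /\ P v) y.
Proof.
move=> hy e; apply: kall_sub (kall_and_map0 hy e) => v [? ?]; by split.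
Qed.

Let kmap_ker q (y : kos Y N q) (P : Y -> Prop) : kall (fun v => ker v /\ P v) y ->
  kmap del y = 0.
Proof.
move=> hy; rewrite (kmap_eq (g := fun=> 0) _ hy); last by move=> v [].
exact: kmap_zero.
Qed.

Let R q e (z : kos X N q.+2) (y : kos Y N q.+1) : Prop :=
  exists2 z', kall (@in_degree _ _ Y e) z' & kmap del z' = z /\ D z' = y.

Let R0 q e : @R q e 0 0.
Proof.
exists 0; first exact: (kall_subspace _ _ (in_degree_subspace Y e)).1.
by rewrite (lin0 (kmap_linear delL)) (kD0 (gx_linear Y)).
Qed.

Let RD q e a u v u' v' : @R q e u v -> @R q e u' v' -> R e (a *: u + u') (a *: v + v').
Proof.
move=> [z hz [<- <-]] [z' hz' [<- <-]]; exists (a *: z + z').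
  exact: (kall_subspace _ _ (in_degree_subspace Y e)).2.
by rewrite (kmap_linear delL) (kD_linear (gx_linear Y)).
Qed.

Let eB (e : int) : e + 1 - 1 = e. Proof. by rewrite addrK. Qed.

(** The connecting homomorphism sends a cycle to the differential of a lift; if this
    bounds in the kernel, the lift can be corrected to a cycle, which bounds because
    the Koszul complex of [Y] is exact. *)
Lemma shift_down q e d :
  qdim_le (@hcyc _ _ Y ker q (e + 1)) (@hbnd _ _ Y ker q (e + 1)) d ->
  qdim_le (@hcyc _ _ X im q.+1 e) (@hbnd _ _ X im q.+1 e) d.
Proof.
apply: (qdim_le_rel (R := R e)); [exact: R0|exact: RD|exact: hcyc_subspace im_subspace|..].
  move=> z [hz [w hw ez]]; have [z' hz' ez'] := lift_degree hz.
  exists (D z'); last by exists z'.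
  split; last by exists z'; rewrite ?eB.
  apply: ker_kmap; last first.
    by rewrite delD ez' ez (kDkD (gx_linear X) (@gxC _ _ X)).
  apply/kall_in_degree; rewrite gpr_kD eB; congr (kD _ _).
  exact/kall_in_degree.
move=> z y hz [z' hz' [ez ey]] [v hv ev].
have hv0 : kmap del v = 0 by exact: kmap_ker hv.
have hv1 : kall (@in_degree _ _ Y e) v.
  by apply: kall_sub hv => u []; rewrite eB.
have [w hw ew] : exists2 w, kall (@in_degree _ _ Y (e - 1)) w & z' - v = D w.
  apply: graded_exact; first exact: subspaceB (kall_subspace _ _ (in_degree_subspace Y e)) hz' hv1.
  by rewrite (kDB (gx_linear Y)) ey ev subrr.
exists (kmap del w); first exact: del_degree hw.
by rewrite -delD -ew (linB (kmap_linear delL)) hv0 subr0.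
Qed.

(** Conversely, a cycle of the kernel that bounds in [Y] is the differential of a lift
    of a cycle of the image. *)
Lemma shift_up q e d :
  qdim_le (@hcyc _ _ X im q.+1 e) (@hbnd _ _ X im q.+1 e) d ->
  qdim_le (@hcyc _ _ Y ker q (e + 1)) (@hbnd _ _ Y ker q (e + 1)) d.
Proof.
apply: (qdim_le_rel (R := fun y z => R e z y)); [exact: R0|by move=> *; exact: RD|exact: hcyc_subspace ker_subspace|..].
  move=> y [hy [z' hz' ey]]; rewrite eB in hz'; exists (kmap del z'); last by exists z'.
  have hz := del_degree hz'; split=> //; apply: graded_exact.
    by apply: kall_sub hz => v [].
  by rewrite -delD -ey; exact: kmap_ker hy.
move=> y z hy [z' hz' [ez ey]] [v hv ev]; have [v' hv' ev'] := lift_degree hv.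
exists (z' - D v'); last first.
  by rewrite (kDB (gx_linear Y)) (kDkD (gx_linear Y) (@gxC _ _ Y)) subr0.
rewrite eB; apply: ker_kmap; last first.
  by rewrite (linB (kmap_linear delL)) delD ev' ez ev subrr.
apply: subspaceB (kall_subspace _ _ (in_degree_subspace Y e)) hz' _.
by apply/kall_in_degree; rewrite gpr_kD; congr (kD _ _); exact/kall_in_degree.
Qed.
End Shift.

(** * Graded free modules *)

Section PolyModule.
Variables (K : fieldType) (N : nat).
Local Notation S := {mpoly K[N]}.

(** Degrees are integers because the generators of a free module may have any
    degree. *)
Definition pihz (e : int) (f : S) : S := if e is Posz d then pihomog mdeg d f else 0.

Lemma pihz_linear e : linear (pihz e).
Proof.
by case: e => d a u v /=; [rewrite linearP|rewrite scaler0 addr0].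
Qed.

Lemma pihz_homog (e : int) b (f : S) : f \is b.-homog ->
  pihz e f = if e == b%:Z then f else 0.
Proof.
move=> hf; case: e => [d|d] //=; rewrite eqz_nat; case: eqP => [->|/eqP ne].
  by rewrite pihomog_dE.
by rewrite (pihomog_ne0 _ hf) // eq_sym.
Qed.

Lemma pihz_mul (e t : int) (f d : S) : (forall m, m \in msupp d -> (mdeg m)%:Z = t) ->
  pihz (e + t) (f * d) = pihz e f * d.
Proof.
move=> hd; have [->|d0] := eqVneq d 0; first by rewrite !mulr0 (lin0 (pihz_linear _)).
have ht := hd _ (mlead_supp d0); have hd' : d \is (mdeg (mlead d)).-homog.
  by apply/dhomogP => m /hd; rewrite -ht => -[].
rewrite -ht; elim/mpolyind: f => [|c m f _ _ IH].
  by rewrite mul0r !(lin0 (pihz_linear _)) mul0r.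
rewrite [in LHS]mulrDl -[in LHS]scalerAl [LHS]pihz_linear [in RHS]pihz_linear [in RHS]mulrDl IH.
rewrite -[in RHS]scalerAl; congr (_ *: _ + _).
have hm : 'X_[m] * d \is (mdeg m + mdeg (mlead d)).-homog by rewrite dhomogM // dhomogX.
have hX : 'X_[K, m] \is (mdeg m).-homog by rewrite dhomogX.
rewrite (pihz_homog _ hm) (pihz_homog _ hX) PoszD (inj_eq (addIr _)).
by case: eqP; rewrite ?mul0r.
Qed.

Lemma pihz_xop e k (f : S) : pihz e (xop k f) = xop k (pihz (e - 1) f).
Proof.
rewrite /xop ![mvar _ _ _ * _]mulrC; have := @pihz_mul (e - 1) 1 f (mvar K N k).
rewrite subrK => -> // m.
rewrite /mvar; case: insub => [i|]; last by rewrite msupp0.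
by rewrite msuppX inE => /eqP ->; rewrite mdeg1.
Qed.

Lemma pihz_idem e (f : S) : pihz e (pihz e f) = pihz e f.
Proof. by case: e => d //=; rewrite pihomog_id. Qed.

Definition kill (n : nat) : S -> S :=
  mmap (@mpolyC N K) (fun i => if (i < n)%N then 0 else 'X_i).
HB.instance Definition _ n := GRing.RMorphism.copy (kill n)
  (mmap (@mpolyC N K) (fun i => if (i < n)%N then 0 else 'X_i)).

Lemma killX n i : kill n 'X_i = if (i < n)%N then 0 else 'X_i.
Proof. by rewrite /kill mmapX mmap1U. Qed.
Lemma killC n c : kill n c%:MP = c%:MP. Proof. exact: mmapC. Qed.
Lemma kill_linear n : linear (kill n).
Proof. by move=> a u v; rewrite /kill mmapD mmapZ mul_mpolyC. Qed.

Lemma kill0 v : kill 0 v = v. Proof. exact: mmap_id. Qed.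

Lemma kill_lt n k v : (k < n)%N -> kill n (xop k v) = 0.
Proof.
move=> lt; rewrite /xop rmorphM /= /mvar; case: insubP => [i _ ei|_].
  by rewrite killX ei lt mul0r.
by rewrite rmorph0 mul0r.
Qed.

Lemma mvar_lt n (lt : (n < N)%N) : mvar K N n = 'X_(Ordinal lt).
Proof. by rewrite -(mvarE K (Ordinal lt)). Qed.

Lemma kill_eq n v : (n < N)%N -> kill n (xop n v) = xop n (kill n v).
Proof. by move=> lt; rewrite /xop rmorphM /= mvar_lt killX ltnn. Qed.

Lemma kill_step n v : (n < N)%N -> exists g, kill n v = kill n.+1 v + xop n g.
Proof.
move=> lt; rewrite /xop mvar_lt; set X := 'X_(Ordinal lt).
elim/mpoly_ring_ind: v => [c|i|f g [a e] [b e']|f g [a e] [b e']].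
- by exists 0; rewrite !killC mulr0 addr0.
- rewrite !killX; have [ei|ne] := eqVneq (i : nat) n.
    exists 1; rewrite ei ltnn ltnSn add0r mulr1 /X; congr 'X_[U_(_)]; exact: val_inj.
  exists 0; rewrite mulr0 addr0.
  by have -> : (i < n.+1)%N = (i < n)%N by rewrite ltnS [LHS]leq_eqVlt (negbTE ne).
- by exists (a + b); rewrite !rmorphD /= e e'; ring.
by exists (a * kill n.+1 g + kill n.+1 f * b + X * a * b); rewrite !rmorphM /= e e'; ring.
Qed.

Lemma kill_idem n v : kill n (kill n v) = kill n v.
Proof.
apply: (rmorph_mpoly_eq (f := kill n \o kill n) (g := kill n)) => [c|i] /=.
  by rewrite !killC.
by rewrite killX; case lt: (i < n)%N; rewrite ?rmorph0 // killX lt.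
Qed.

Lemma xop_inj n (v : S) : (n < N)%N -> xop n v = 0 -> v = 0.
Proof.
move=> lt /eqP; rewrite /xop mvar_lt mulf_eq0 => /orP[|/eqP //].
by rewrite -msize_poly_eq0 msizeX.
Qed.

Lemma kill_constant (f : S) : kill N f = (f@_0%MM)%:MP.
Proof.
elim/mpoly_ring_ind: f => [c|i|f g e e'|f g e e'].
- by rewrite killC mcoeffC eqxx mulr1.
- rewrite killX ltn_ord mcoeffX; case: eqP => [/mnmP/(_ i)|]; last by rewrite mpolyC0.
  by rewrite mnmE mnm0E eqxx.
- by rewrite rmorphD mcoeffD mpolyCD /= e e'.
by rewrite rmorphM /= e e' -mpolyCM (rmorphM (mcoeff 0%MM)).
Qed.

Definition poly_gmod : graded_module K N :=
  GradedModule (@xop_linear K N) (@xopC K N) pihz_linear pihz_xop pihz_idem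
    (fun q z => koszul_exact (@xop_linear K N) (@xopC K N) kill_linear kill0 kill_lt
       kill_eq kill_step kill_idem xop_inj (leqnn N)).

(** The basis vector [k] of the free module has degree [s k]. *)
Variables (r : nat) (s : 'I_r -> int).
Local Notation X := {ffun 'I_r -> S}.

Definition fx k (v : X) : X := [ffun i => xop k (v i)].
Definition fpr (e : int) (v : X) : X := [ffun i => pihz (e - s i) (v i)].
Definition fkill n (v : X) : X := [ffun i => kill n (v i)].

Lemma coord_linear (f : 'I_r -> S -> S) : (forall i, linear (f i)) ->
  linear (fun v : X => [ffun i => f i (v i)] : X).
Proof. by move=> L a u v; apply/ffunP => i; rewrite !ffunE L. Qed.

Lemma fx_linear k : linear (fx k).
Proof. by apply: (coord_linear (f := fun=> xop k)) => i; exact: xop_linear. Qed.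
Lemma fpr_linear e : linear (fpr e).
Proof. by apply: (coord_linear (f := fun i => pihz (e - s i))) => i; exact: pihz_linear. Qed.
Lemma fkill_linear n : linear (fkill n).
Proof. by apply: (coord_linear (f := fun=> kill n)) => i; exact: kill_linear. Qed.
Lemma fxC k l u : fx k (fx l u) = fx l (fx k u).
Proof. by apply/ffunP => i; rewrite !ffunE xopC. Qed.
Lemma fpr_fx e k u : fpr e (fx k u) = fx k (fpr (e - 1) u).
Proof. by apply/ffunP => i; rewrite !ffunE pihz_xop addrAC. Qed.
Lemma fpr_idem e u : fpr e (fpr e u) = fpr e u.
Proof. by apply/ffunP => i; rewrite !ffunE pihz_idem. Qed.

Lemma fkill_step n v : (n < N)%N -> exists g, fkill n v = fkill n.+1 v + fx n g.
Proof.
move=> lt; have /boolp.choice[g hg] := fun i : 'I_r => kill_step (v i) lt.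
by exists [ffun i => g i]; apply/ffunP => i; rewrite !ffunE hg.
Qed.

Lemma fkill0 v : fkill 0 v = v. Proof. by apply/ffunP => i; rewrite ffunE kill0. Qed.
Lemma fkill_lt n k v : (k < n)%N -> fkill n (fx k v) = 0.
Proof. by move=> lt; apply/ffunP => i; rewrite !ffunE kill_lt. Qed.
Lemma fkill_eq n v : (n < N)%N -> fkill n (fx n v) = fx n (fkill n v).
Proof. by move=> lt; apply/ffunP => i; rewrite !ffunE kill_eq. Qed.
Lemma fkill_idem n v : fkill n (fkill n v) = fkill n v.
Proof. by apply/ffunP => i; rewrite !ffunE kill_idem. Qed.
Lemma fx_inj n (v : X) : (n < N)%N -> fx n v = 0 -> v = 0.
Proof.
by move=> lt /ffunP e; apply/ffunP => i; have := e i; rewrite !ffunE => /(xop_inj lt).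
Qed.

Definition free_gmod : graded_module K N :=
  GradedModule fx_linear fxC fpr_linear fpr_fx fpr_idem
    (fun q z => koszul_exact fx_linear fxC fkill_linear fkill0 fkill_lt
       fkill_eq fkill_step fkill_idem fx_inj (leqnn N)).
End PolyModule.

(** * Tor and Koszul homology *)

Section Images.
Variables (K : fieldType) (N : nat).
Local Notation S := {mpoly K[N]}.

Lemma poly_image (b : kos S N 1) :
  (exists a : kos S N 2, kD (@xop K N) a = b) <-> (kap b)@_0%MM = 0.
Proof.
have h := kD_image (@kill_linear K N) (@kill0 K N) (@kill_lt K N)
   (@kill_step K N) (@kill_idem K N) b (leqnn N).
split=> [/h|e].
  by rewrite kill_constant => /eqP; rewrite mpolyC_eq0 => /eqP.
by apply/h; rewrite kill_constant e mpolyC0.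
Qed.

Variables (r : nat) (s : 'I_r -> int).
Local Notation Y := {ffun 'I_r -> S}.

Lemma free_image (b : kos Y N 1) :
  (exists a : kos Y N 2, kD (@fx K N r) a = b) <-> forall k, (kap b k)@_0%MM = 0.
Proof.
have h := kD_image (@fkill_linear K N r) (@fkill0 K N r) (@fkill_lt K N r)
   (@fkill_step K N r) (@fkill_idem K N r) b (leqnn N).
split=> [/h /ffunP e k|e].
  by have := e k; rewrite !ffunE kill_constant => /eqP; rewrite mpolyC_eq0 => /eqP.
by apply/h/ffunP => k; rewrite !ffunE kill_constant e mpolyC0.
Qed.

Definition cst (c : 'rV[K]_r) : Y := [ffun k => (c 0 k)%:MP].
Definition cpart (v : Y) : 'rV[K]_r := \row_k (v k)@_0%MM.

Lemma cst_linear : linear cst.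
Proof.
by move=> a u v; apply/ffunP => k; rewrite !ffunE !mxE mpolyCD mpolyCM mul_mpolyC.
Qed.
Lemma cpart_linear : linear cpart.
Proof. by move=> a u v; apply/rowP => k; rewrite !mxE !ffunE mcoeffD mcoeffZ. Qed.
Lemma cpart_cst c : cpart (cst c) = c.
Proof. by apply/rowP => k; rewrite !mxE ffunE mcoeffC eqxx mulr1. Qed.

Definition supported (j : int) (c : 'rV[K]_r) : Prop := forall k, s k != j -> c 0 k = 0.

Definition degree_mx (j : int) : 'M[K]_r := diag_mx (\row_k (s k == j)%:R).

Lemma supported_sub j (c : 'rV[K]_r) :
  (c <= degree_mx j)%MS <-> supported j c.
Proof.
split=> [/submxP[a ->] k ne|h].
  by rewrite mul_mx_diag !mxE (negbTE ne) mulr0.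
apply/submxP; exists c; apply/rowP => k; rewrite mul_mx_diag !mxE.
by case: eqP (h k) => [_ _|_ -> //]; rewrite ?mulr1 ?mulr0.
Qed.

Lemma cst_degree j c : supported j c -> fpr s j (cst c) = cst c.
Proof.
move=> h; apply/ffunP => k; rewrite !ffunE.
have h0 : ((c 0 k)%:MP : S) \is 0.-homog.
  by apply/dhomogP => m; rewrite msuppC; case: eqP => // _; rewrite inE => /eqP ->; exact: mdeg0.
rewrite (pihz_homog _ h0) subr_eq0 eq_sym; case: eqP => // /eqP ne.
by rewrite h // mpolyC0.
Qed.

Lemma cpart_fpr j v k : cpart (fpr s j v) 0 k = if s k == j then cpart v 0 k else 0.
Proof.
rewrite !mxE ffunE; have [->|ne] := eqVneq (s k) j.
  rewrite subrr /=; elim/mpolyind: (v k) => [|c m p _ _ IH]; first by rewrite pihomog0.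
  rewrite linearP /= !mcoeffD !mcoeffZ IH; congr (_ * _ + _); rewrite pihomogX.
  case: eqP => // ne0; rewrite mcoeff0 mcoeffX; case: eqP => // m0.
  by case: ne0; rewrite m0; exact: mdeg0.
have : j - s k != 0 by rewrite subr_eq0 eq_sym.
case: (j - s k) => [[|d]|d] //= _; last by rewrite mcoeff0.
by apply: (dhomog_nemf_coeff (pihomogP _ _ _)); rewrite /= mdeg0.
Qed.

Lemma supported_cpart j v : fpr s j v = v -> supported j (cpart v).
Proof. by move=> <- k ne; rewrite cpart_fpr (negbTE ne). Qed.

(** An element without constant terms lies in [(x_0, ..., x_(N-1)) Y], with cofactors of
    one degree less. *)
Lemma ideal_part j (v : Y) : fpr s j v = v -> cpart v = 0 ->
  exists2 a : kos Y N 2, kall (@in_degree _ _ (free_gmod K N s) (j - 1)) a &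
    kD (@fx K N r) a = kin N v.
Proof.
move=> hv h0; have [_ h] := free_image (kin N v).
have [|a ea] := h; first by move=> k; rewrite kinK; have /rowP/(_ k) := h0; rewrite !mxE.
exists (kmap (fpr s (j - 1)) a).
  apply: (kall_map (P := fun=> True)) (kallT _) => u _; exact: fpr_idem.
have := @gpr_kD _ _ (free_gmod K N s) j 1 a => /= <-; rewrite ea.
by rewrite -[LHS]kapK kap_kmap kinK hv.
Qed.

End Images.

Section Base.
Variables (K : fieldType) (N : nat) (X : graded_module K N) (r : nat) (s : 'I_r -> int).
Local Notation S := {mpoly K[N]}.
Local Notation Y := (free_gmod K N s).
Variable del : Y -> X.
Hypothesis delL : linear del.
Hypothesis del_x : forall k (u : Y), del (gx k u) = gx k (del u).
Hypothesis del_pr : forall e (u : Y), del (gpr e u) = gpr e (del u).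
Variables (j : int) (C Bd : 'rV[K]_r -> Prop).
Hypothesis sC : subspace C.
Hypothesis CE : forall c, C c <-> supported s j c /\
  exists w : kos X N 2, kD (@gx _ _ X) w = kin N (del (cst N c)).
Hypothesis BE : forall c, Bd c <-> supported s j c /\
  exists2 u : Y, del u = 0 & c = cpart u.

Let delD q (w : kos Y N q.+1) : kmap del (kD (@gx _ _ Y) w) = kD (@gx _ _ X) (kmap del w).
Proof. by apply: kmap_kD; [exact: (linD delL)|move=> k u _; exact: del_x]. Qed.

Let kmap_kin u : kmap del (kin N u) = kin N (del u).
Proof. by rewrite -[LHS]kapK kap_kmap kinK. Qed.

Let bnd_of (v : Y) : in_degree j v -> cpart v = 0 ->
  hbnd (im del) j (kin N (del v) : kos X N 1).
Proof.
move=> hv h0; have [a ha ea] := ideal_part hv h0.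
exists (kmap del a); last by rewrite -delD -kmap_kin; congr (kmap _ _).
apply: kall_map ha => u hu; split; first by exists u.
by rewrite /in_degree -del_pr hu.
Qed.

Let sB : subspace (@hbnd K N X (im del) 0 j).
Proof.
have s1 := kall_subspace N 2 (and_subspace (im_subspace delL) (in_degree_subspace X (j - 1))).
split; first by exists 0; [exact: s1.1|rewrite (kD0 (gx_linear X))].
move=> a u v [u1 h1 ->] [v1 h2 ->]; exists (a *: u1 + v1); first exact: s1.2.
by rewrite (kD_linear (gx_linear X)).
Qed.

(** Modulo [(x) im del], an element of [im del] depends only on the constant terms of a
    preimage. *)
Lemma base_down d : qdim_le C Bd d -> qdim_le (@hcyc _ _ X (im del) 0 j) (@hbnd _ _ X (im del) 0 j) d.
Proof.
pose R (z : kos X N 1) c := hbnd (im del) j (z - kin N (del (cst N c)) : kos X N 1).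
have L a u v : kin N (del (cst N (a *: u + v))) = a *: kin N (del (cst N u)) + kin N (del (cst N v)).
  by rewrite (@cst_linear K N r) delL kin_linear.
apply: (qdim_le_rel (R := R)).
- rewrite /R (lin0 (@cst_linear K N r)) (lin0 delL) (lin0 (@kin_linear _ _ _)) subrr; exact: sB.1.
- move=> a u v u' v' h1 h2; rewrite /R L opprD addrACA -scalerBr; exact: sB.2.
- exact: hcyc_subspace (im_subspace delL).
- move=> z [hz [w hw ew]]; have [[u0 eu0] hv] := kall_kap hz.
  pose u := gpr j u0; have eu : del u = kap z by rewrite del_pr eu0.
  have hu : in_degree j u by exact: gpr_idem.
  have sc : supported s j (cpart u) by exact: supported_cpart.
  have Rzc : R z (cpart u).
    rewrite /R -[z]kapK -eu -(linB (@kin_linear _ _ _)) -(linB delL).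
    apply: bnd_of; first by apply: subspaceB (in_degree_subspace Y j) hu _; exact: cst_degree.
    by rewrite (linB (@cpart_linear K N r)) cpart_cst subrr.
  exists (cpart u) => //; apply/CE; split=> //; have [b _ eb] := Rzc.
  exists (w - b); rewrite (kDB (gx_linear X)) -ew -eb; by rewrite opprB addrC subrK.
- move=> z c hz Rzc /BE[sc [u du ec]].
  rewrite -(subrK (kin N (del (cst N c))) z); apply: subspaceD sB Rzc _.
  pose u' := gpr j u; have du' : del u' = 0 by rewrite del_pr du (lin0 (gpr_linear X j)).
  have -> : kin N (del (cst N c)) = kin N (del (cst N c - u')).
    by rewrite (linB delL) du' subr0.
  apply: bnd_of.
    by apply: subspaceB (in_degree_subspace Y j) _ _; [exact: cst_degree|exact: gpr_idem].
  rewrite (linB (@cpart_linear K N r)) cpart_cst; apply/rowP => k.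
  rewrite !mxE; have := cpart_fpr s j u k; rewrite -ec [LHS]mxE -/u' => ->.
  by case: eqP (sc k) => [_ _|_ -> //]; rewrite subrr.
Qed.

Lemma base_up d : qdim_le (@hcyc _ _ X (im del) 0 j) (@hbnd _ _ X (im del) 0 j) d -> qdim_le C Bd d.
Proof.
apply: (qdim_le_rel (R := fun c z => z = kin N (del (cst N c)))).
- by rewrite (lin0 (@cst_linear K N r)) (lin0 delL) (lin0 (@kin_linear _ _ _)).
- by move=> a u v u' v' -> ->; rewrite (@cst_linear K N r) delL kin_linear.
- exact: sC.
- move=> c /CE[sc [w ew]]; exists (kin N (del (cst N c))) => //.
  have hd : in_degree j (del (cst N c)) by rewrite /in_degree -del_pr [gpr _ _](cst_degree N sc).
  split; first by apply: kall_kin; split=> //; exists (cst N c).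
  exists (kmap (gpr (j - 1)) w).
    by apply: (kall_map (P := fun=> True)) (kallT _) => u _; exact: gpr_idem.
  by rewrite -gpr_kD ew; apply/esym/kall_in_degree; apply: kall_kin.
- move=> c z /CE[sc _] -> [v hv ev]; apply/BE; split=> //.
  have [v' ev'] : exists v' : kos Y N 2, kmap del v' = v.
    have hv1 : kall (im del) v by apply: kall_sub hv => u [].
    have lft (x : X) : im del x -> exists2 u : Y, True & del u = x by case=> u; exists u.
    by have [v' _ e] := kall_lift lft hv1; exists v'.
  pose b := kD (@gx _ _ Y) v'; exists (cst N c - kap b).
    rewrite (linB delL) -kap_kmap delD ev' -ev kinK subrr //.
  rewrite (linB (@cpart_linear K N r)) cpart_cst.
  have [/(_ (ex_intro _ v' erefl)) h _] := free_image b.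
  by apply/rowP => k; rewrite !mxE h subr0.
Qed.
End Base.

Section RankQuotient.
Variables (K : fieldType) (n : nat).

Lemma qdim_le_rank m1 m2 (A : 'M[K]_(m1, n)) (B : 'M[K]_(m2, n)) d :
  qdim_le (fun c : 'rV_n => (c <= A)%MS) (fun c : 'rV_n => (c <= B)%MS) d ->
  (\rank A - \rank B <= d)%N.
Proof.
move=> /(_ (\rank A) (fun k => row k (row_base A)))[k|M hM].
  by rewrite -(eq_row_base A); exact: row_sub.
have sub : (kermx M *m row_base A <= B)%MS.
  apply/row_subP => k; rewrite row_mul.
  have e : row k (kermx M) *m M = 0 by apply/sub_kermxP; exact: row_sub.
  have -> : row k (kermx M) *m row_base A = comb (row k (kermx M)) (fun k => row k (row_base A)).
    by rewrite mulmx_sum_row.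
  exact: hM.
have := mxrankS sub; rewrite mxrankMfree ?row_base_free // mxrank_ker => le.
rewrite leq_subLR addnC -leq_subLR; apply: leq_trans le.
by rewrite leq_sub2l // rank_leq_col.
Qed.

Lemma rank_qdim_le m1 m2 (A : 'M[K]_(m1, n)) (B : 'M[K]_(m2, n)) d : (B <= A)%MS ->
  (\rank A - \rank B <= d)%N ->
  qdim_le (fun c : 'rV_n => (c <= A)%MS) (fun c : 'rV_n => (c <= B)%MS) d.
Proof.
move=> sBA le; have e := mxrank_cap_compl A B.
have rB : \rank (A :&: B)%MS = \rank B by rewrite capmxC (capmx_idPl sBA).
have le' : (\rank (A :\: B)%MS <= d)%N by rewrite -e rB addKn in le.
apply: (qdim_le_weaken le').
apply: (qdim_le_span (s := fun k => row k (row_base (A :\: B)%MS))).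
  split=> [|a u v hu hv]; first exact: sub0mx.
  by rewrite addmx_sub // scalemx_sub.
move=> z; rewrite -(addsmx_diff_cap_eq A B) => /sub_addsmxP[[a b] /= ->].
have /submxP[c ec] : (a *m (A :\: B)%MS <= row_base (A :\: B)%MS)%MS.
  by rewrite eq_row_base submxMl.
exists c; have -> : comb c (fun k => row k (row_base (A :\: B)%MS)) = a *m (A :\: B)%MS.
  by rewrite ec mulmx_sum_row.
by rewrite addrC addKr; apply: submx_trans (submxMl _ _) (capmxSr _ _).
Qed.
End RankQuotient.

Section Resolution.
Variables (K : fieldType) (N : nat).
Local Notation S := {mpoly K[N]}.

Definition dmap r r' (A : 'M[S]_(r, r')) (v : {ffun 'I_r -> S}) : {ffun 'I_r' -> S} :=
  [ffun l => \sum_k v k * A k l].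
Definition amap r (A : 'cV[S]_r) (v : {ffun 'I_r -> S}) : S := \sum_k v k * A k 0.

Lemma dmap_row r r' (A : 'M[S]_(r, r')) v : \row_l dmap A v l = (\row_k v k) *m A.
Proof. by apply/rowP => l; rewrite !mxE ffunE; apply: eq_bigr => k _; rewrite !mxE. Qed.
Lemma amap_row r (A : 'cV[S]_r) v : amap A v = ((\row_k v k) *m A) 0 0.
Proof. by rewrite mxE; apply: eq_bigr => k _; rewrite !mxE. Qed.

Lemma amap_linear r (A : 'cV[S]_r) : linear (amap A).
Proof.
move=> a u v; rewrite /amap scaler_sumr -big_split; apply: eq_bigr => k _ /=.
by rewrite !ffunE mulrDl scalerAl.
Qed.
Lemma dmap_linear r r' (A : 'M[S]_(r, r')) : linear (dmap A).
Proof.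
move=> a u v; apply/ffunP => l; rewrite !ffunE scaler_sumr -big_split.
by apply: eq_bigr => k _ /=; rewrite !ffunE mulrDl scalerAl.
Qed.
Lemma amap_x r (A : 'cV[S]_r) k u : amap A (fx k u) = xop k (amap A u).
Proof. by rewrite /amap /xop mulr_sumr; apply: eq_bigr => l _; rewrite ffunE mulrA. Qed.
Lemma dmap_x r r' (A : 'M[S]_(r, r')) k u : dmap A (fx k u) = fx k (dmap A u).
Proof.
apply/ffunP => l; rewrite !ffunE /xop mulr_sumr.
by apply: eq_bigr => i _; rewrite ffunE mulrA.
Qed.

Lemma amap_pr r (A : 'cV[S]_r) (s : 'I_r -> int) e u :
  (forall k m, m \in msupp (A k 0) -> (mdeg m)%:Z = s k) ->
  amap A (fpr s e u) = pihz e (amap A u).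
Proof.
move=> h; rewrite /amap (lin_sum (pihz_linear e)); apply: eq_bigr => k _.
by rewrite ffunE -(pihz_mul _ _ (h k)) subrK.
Qed.
Lemma dmap_pr r r' (A : 'M[S]_(r, r')) (s : 'I_r -> int) (s' : 'I_r' -> int) e u :
  (forall k l m, m \in msupp (A k l) -> (mdeg m)%:Z + s' l = s k) ->
  dmap A (fpr s e u) = fpr s' e (dmap A u).
Proof.
move=> h; apply/ffunP => l; rewrite !ffunE (lin_sum (pihz_linear _)); apply: eq_bigr => k _.
rewrite ffunE -(@pihz_mul _ _ (e - s k) (s k - s' l)) ?subrKA // => m /h <-.
by rewrite addrK.
Qed.

Lemma cpart_dmap r r' (A : 'M[S]_(r, r')) u :
  cpart (dmap A u) = cpart u *m map_mx (mcoeff 0%MM) A.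
Proof.
apply/rowP => l; rewrite !mxE ffunE (rmorph_sum (mcoeff 0%MM)) /=.
by apply: eq_bigr => k _; rewrite !mxE (rmorphM (mcoeff 0%MM)).
Qed.

Variables (I : {pred S}) (F : graded_resolution I).
Local Notation G p := (free_gmod K N (@shift _ _ _ F p)).

(** The Koszul homology of the [p]-th syzygy module inside the free module (or, for
    [p = 0], the ring) that contains it. *)
Definition strand_le (p q : nat) (e : int) (d : nat) : Prop :=
  match p with
  | 0 => qdim_le (@hcyc _ _ (poly_gmod K N) (im (X := poly_gmod K N) (Y := G 0) (amap (aug F))) q e)
                 (@hbnd _ _ (poly_gmod K N) (im (X := poly_gmod K N) (Y := G 0) (amap (aug F))) q e) d
  | p'.+1 => qdim_le (@hcyc _ _ (G p') (im (X := G p') (Y := G p'.+1) (dmap (diff F p'))) q e)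
                     (@hbnd _ _ (G p') (im (X := G p') (Y := G p'.+1) (dmap (diff F p'))) q e) d
  end.

Lemma row_ffun r (v : 'rV[S]_r) : v = \row_k [ffun k => v 0 k] k.
Proof. by apply/rowP => k; rewrite mxE ffunE. Qed.

Lemma ffun_row0 r (v : {ffun 'I_r -> S}) : v = 0 <-> (\row_k v k) = 0 :> 'rV_r.
Proof.
split=> [->|/rowP h]; first by apply/rowP => k; rewrite !mxE ffunE.
by apply/ffunP => k; have := h k; rewrite !mxE ffunE.
Qed.

Lemma im_amap (f : S) : im (X := poly_gmod K N) (Y := G 0) (amap (aug F)) f <-> f \in I.
Proof.
split=> [[u <-]|/(aug_image F)[v ->]]; first by apply/(aug_image F); exists (\row_k u k); exact: amap_row.
by exists [ffun k => v 0 k]; rewrite amap_row -row_ffun.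
Qed.

Lemma ker_amap : ker (X := poly_gmod K N) (Y := G 0) (amap (aug F))
  = im (X := G 0) (Y := G 1) (dmap (diff F 0)).
Proof.
apply: boolp.funext => v; apply/boolp.propext; split.
  move=> h; have [|w ew] := (@exact_aug _ _ _ F (\row_k v k)).1.
    by apply/matrixP => a b; rewrite !ord1 -amap_row mxE.
  exists [ffun k => w 0 k]; apply/ffunP => l.
  have := dmap_row (diff F 0) [ffun k => w 0 k]; rewrite -row_ffun -ew.
  by move=> /rowP/(_ l); rewrite !mxE.
case=> w <-; rewrite /ker amap_row dmap_row.
by have [_ ->] := @exact_aug _ _ _ F ((\row_k w k) *m diff F 0); [rewrite mxE|exists (\row_k w k)].
Qed.

Lemma ker_dmap p : ker (X := G p) (Y := G p.+1) (dmap (diff F p))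
  = im (X := G p.+1) (Y := G p.+2) (dmap (diff F p.+1)).
Proof.
apply: boolp.funext => v; apply/boolp.propext; split.
  move=> h; have [|w ew] := (@exact_diff _ _ _ F _ (\row_k v k)).1.
    by rewrite -dmap_row; apply/ffun_row0.
  exists [ffun k => w 0 k]; apply/ffunP => l.
  have := dmap_row (diff F p.+1) [ffun k => w 0 k]; rewrite -row_ffun -ew.
  by move=> /rowP/(_ l); rewrite !mxE.
case=> w <-; apply/ffun_row0; rewrite !dmap_row.
by have [_ ->] := @exact_diff _ _ _ F _ ((\row_k w k) *m diff F p.+1); [|exists (\row_k w k)].
Qed.

Let aL := @amap_linear _ (aug F).
Let dL p := @dmap_linear _ _ (diff F p).
Let ax k (u : G 0) : amap (aug F) (gx k u) = gx (g := poly_gmod K N) k (amap (aug F) u).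
Proof. exact: amap_x. Qed.
Let dx p k (u : G p.+1) : dmap (diff F p) (gx k u) = gx (g := G p) k (dmap (diff F p) u).
Proof. exact: dmap_x. Qed.
Let apr e (u : G 0) : amap (aug F) (gpr e u) = gpr (g := poly_gmod K N) e (amap (aug F) u).
Proof. by apply: amap_pr => k m; exact: aug_homog. Qed.
Let dpr p e (u : G p.+1) : dmap (diff F p) (gpr e u) = gpr (g := G p) e (dmap (diff F p) u).
Proof. by apply: dmap_pr => k l m; exact: diff_homog. Qed.

Lemma strand_shift p q e d : strand_le p q.+1 e d <-> strand_le p.+1 q (e + 1) d.
Proof.
case: p => [|p] /=.
  split=> h.
    by have := @shift_up K N (poly_gmod K N) (G 0) (amap (aug F)) aL ax apr _ _ _ h; rewrite ker_amap.
  by apply: (@shift_down K N (poly_gmod K N) (G 0) (amap (aug F)) aL ax apr); rewrite ker_amap.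
split=> h.
  by have := @shift_up K N (G p) (G p.+1) (dmap (diff F p)) (@dL p) (@dx p) (@dpr p) _ _ _ h; rewrite ker_dmap.
by apply: (@shift_down K N (G p) (G p.+1) (dmap (diff F p)) (@dL p) (@dx p) (@dpr p)); rewrite ker_dmap.
Qed.

Lemma strand_shifts p q e d : strand_le p q e d <-> strand_le (p + q) 0 (e + q%:Z) d.
Proof.
elim: q p e => [|q IH] p e; first by rewrite addn0 addr0.
by rewrite strand_shift IH addSnnS -addrA -intS.
Qed.

Let diffK_comp p : diffK F p.+1 *m diffK F p = 0.
Proof.
rewrite /diffK -(map_mxM (mcoeff 0%MM)); have -> : diff F p.+1 *m diff F p = 0.
  apply/row_matrixP => k; rewrite row0 row_mul; apply/(@exact_diff _ _ _ F p).
  by exists (delta_mx 0 k); rewrite -rowE.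
by apply/matrixP => a b; rewrite !mxE (rmorph0 (mcoeff 0%MM)).
Qed.

Lemma boundaries_sub p j : (boundaries F p j <= cycles F p j)%MS.
Proof.
rewrite /boundaries /cycles; case: p => [|p]; first exact: capmxSl.
rewrite sub_capmx capmxSl /=; apply: submx_trans (capmxSr _ _) _.
by apply/sub_kermxP; exact: diffK_comp.
Qed.

Lemma sub_degree_part p j c : (c <= degree_part F p j)%MS <-> supported (@shift _ _ _ F p) j c.
Proof. exact: supported_sub. Qed.

Lemma boundaries_iff p j c : (c <= boundaries F p j)%MS <->
  supported (@shift _ _ _ F p) j c /\ exists u, c = cpart (dmap (diff F p) u).
Proof.
rewrite sub_capmx; split=> [/andP[/sub_degree_part h /submxP[a ea]]|[/sub_degree_part -> [u ->]] /=].
  split=> //; exists (cst N a); by rewrite cpart_dmap cpart_cst.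
by rewrite cpart_dmap submxMl.
Qed.

Lemma submx_subspace m n (A : 'M[K]_(m, n)) : subspace (fun c : 'rV_n => (c <= A)%MS).
Proof.
by split=> [|a u v hu hv]; [exact: sub0mx|rewrite addmx_sub // scalemx_sub].
Qed.

(** In exterior degree zero the homology of the [p]-th syzygy module is that of the
    resolution modulo the variables. For [p = 0] the degree must be nonzero, so
    that the generators of [I] in this degree have no constant term. *)
Lemma strand_tor p (j : int) d : (p = 0%N -> j != 0) ->
  strand_le p 0 j d <-> (tor_dim F p j <= d)%N.
Proof.
move=> j0; pose C (c : 'rV[K]_(rk F p)) : Prop := (c <= cycles F p j)%MS.
pose Bd (c : 'rV[K]_(rk F p)) : Prop := (c <= boundaries F p j)%MS.
suff h : strand_le p 0 j d <-> qdim_le C Bd d.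
  rewrite h /tor_dim; split; first exact: qdim_le_rank.
  exact/rank_qdim_le/boundaries_sub.
have sC : subspace C by exact: submx_subspace.
case: p j0 @C @Bd sC => [|p] j0 C Bd sC /=.
  have CE c : C c <-> supported (@shift _ _ _ F 0) j c /\ exists w : kos S N 2,
      kD (@xop K N) w = kin N (amap (aug F) (cst N c)).
    rewrite /C /cycles; split=> [/sub_degree_part h|[/sub_degree_part //]].
    split=> //; apply/poly_image; rewrite kinK /amap (rmorph_sum (mcoeff 0%MM)) /=.
    rewrite big1 // => k _; rewrite ffunE mcoeffCM.
    have [e|ne] := eqVneq (@shift _ _ _ F 0 k) j; last by rewrite h ?mul0r.
    rewrite memN_msupp_eq0 ?mulr0 //; apply/negP => /aug_homog; rewrite mdeg0 e => e'.
    by case/eqP: (j0 erefl).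
  have BE c : Bd c <-> supported (@shift _ _ _ F 0) j c /\
      exists2 u : G 0, amap (aug F) u = 0 & c = cpart u.
    rewrite /Bd boundaries_iff; split=> -[h]; split=> //.
      case: b => u ->; exists (dmap (diff F 0) u) => //.
      by rewrite -[_ = 0]/(ker (X := poly_gmod K N) (Y := G 0) (amap (aug F)) _) ker_amap; exists u.
    case: b => u hu ->; have : ker (X := poly_gmod K N) (Y := G 0) (amap (aug F)) u by [].
    by rewrite ker_amap => -[w <-]; exists w.
  split=> h; first exact: (@base_up K N (poly_gmod K N) _ _ (amap (aug F)) aL ax apr j C Bd sC CE BE d h).
  exact: (@base_down K N (poly_gmod K N) _ _ (amap (aug F)) aL ax apr j C Bd CE BE d h).
have CE c : C c <-> supported (@shift _ _ _ F p.+1) j c /\ exists w : kos (G p) N 2,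
    kD (@gx _ _ (G p)) w = kin N (dmap (diff F p) (cst N c)).
  have E : (c *m diffK F p = 0) <-> exists w : kos (G p) N 2,
    kD (@gx _ _ (G p)) w = kin N (dmap (diff F p) (cst N c)).
    rewrite -[X in X *m _](cpart_cst N) -cpart_dmap; split.
      by move=> /rowP h; apply/free_image => l; have := h l; rewrite kinK !mxE.
    by move=> /free_image h; apply/rowP => l; have := h l; rewrite kinK !mxE.
  rewrite /C /cycles sub_capmx; split.
    by move=> /andP[/sub_degree_part h /sub_kermxP /E].
  by move=> [/sub_degree_part -> /E /sub_kermxP].
have BE c : Bd c <-> supported (@shift _ _ _ F p.+1) j c /\
    exists2 u : G p.+1, dmap (diff F p) u = 0 & c = cpart u.
  rewrite /Bd boundaries_iff; split=> -[h]; split=> //.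
    case: b => u ->; exists (dmap (diff F p.+1) u) => //.
    by rewrite -[_ = 0]/(ker (X := G p) (Y := G p.+1) (dmap (diff F p)) _) ker_dmap; exists u.
  case: b => u hu ->; have : ker (X := G p) (Y := G p.+1) (dmap (diff F p)) u by [].
  by rewrite ker_dmap => -[w <-]; exists w.
split=> h; first exact: (@base_up K N (G p) _ _ (dmap (diff F p)) (@dL p) (@dx p) (@dpr p) j C Bd sC CE BE d h).
exact: (@base_down K N (G p) _ _ (dmap (diff F p)) (@dL p) (@dx p) (@dpr p) j C Bd CE BE d h).
Qed.

Definition ideal_strand (e : nat) (f : S) : Prop := f \in I /\ f \is e.-homog.

Lemma ideal_strand_iff e f : ideal_strand e f <->
  im (X := poly_gmod K N) (Y := G 0) (amap (aug F)) f /\ in_degree (X := poly_gmod K N) e f.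
Proof.
rewrite /ideal_strand im_amap /in_degree /= homog_piE.
by split=> -[h1 h2]; split=> //; apply/eqP.
Qed.

(** The [i]-fold shift from exterior degree [i] to [0] turns coefficient degree [2] into
    [i + 2]. *)
Theorem tor_dim_koszul i d :
  qdim_le (kcyc (@xop K N) (ideal_strand 2) (m := N) (j := i))
          (kbnd (@xop K N) (ideal_strand 1) (m := N) (j := i)) d
  <-> (tor_dim F i (i + 2)%N%:Z <= d)%N.
Proof.
have -> : (i + 2)%N%:Z = 2 + i%:Z by rewrite addnC PoszD.
rewrite -strand_tor; last by [].
rewrite -[X in strand_le X]add0n -strand_shifts /=.
have E2 q (z : kos S N q) : kall (ideal_strand 2) z <-> kall (fun v =>
   im (X := poly_gmod K N) (Y := G 0) (amap (aug F)) v /\ in_degree (X := poly_gmod K N) 2 v) z.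
  by split; apply: kall_sub => u /ideal_strand_iff.
have E1 q (z : kos S N q) : kall (ideal_strand 1) z <-> kall (fun v =>
   im (X := poly_gmod K N) (Y := G 0) (amap (aug F)) v /\ in_degree (X := poly_gmod K N) (2 - 1) v) z.
  by split; apply: kall_sub => u /ideal_strand_iff.
have EC (z : kos S N i.+1) : kcyc (@xop K N) (ideal_strand 2) z <-> @hcyc _ _ (poly_gmod K N)
    (im (X := poly_gmod K N) (Y := G 0) (amap (aug F))) i 2 z.
  split; last first.
    case=> /E2 h [w _ ew]; split=> //; rewrite ew; case: (i) w {z h ew} => [|q] w.
      exact: kos0P.
    exact: (kDkD (@xop_linear K N) (@xopC K N)).
  case=> /E2 h e; split=> //; move: h e.
  case: (i) z => [|q] z h e; last first.
    by apply: (@graded_exact _ _ (poly_gmod K N)) e; apply: kall_sub h => u [].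
  have [_ hk] := kall_kap h; have [|a ea] := (poly_image z).2.
    by rewrite -hk; apply: (dhomog_nemf_coeff (pihomogP _ _ _)); rewrite /= mdeg0.
  exists (kmap (gpr (g := poly_gmod K N) (2 - 1)) a).
    by apply: (kall_map (P := fun=> True)) (kallT _) => u _; exact: gpr_idem.
  rewrite -gpr_kD -[kD _ a]/(kD (@xop K N) a) ea; apply/esym/kall_in_degree.
  by apply: kall_sub h => u [].
have EB (z : kos S N i.+1) : kbnd (@xop K N) (ideal_strand 1) z <-> @hbnd _ _ (poly_gmod K N)
    (im (X := poly_gmod K N) (Y := G 0) (amap (aug F))) i 2 z.
  by split=> -[w /E1 hw ->]; exists w.
split=> h m z hz.
  by have [M hM] := h m z (fun k => (EC _).2 (hz k)); exists M => c /hM /EB.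
by have [M hM] := h m z (fun k => (EC _).1 (hz k)); exists M => c /hM /EB.
Qed.
End Resolution.

(** * Existence of graded free resolutions *)

Section Submodules.
Variables (K : fieldType) (N r : nat).
Local Notation S := {mpoly K[N]}.
Local Notation Y := {ffun 'I_r -> S}.

Definition smul (a : S) (v : Y) : Y := [ffun k => a * v k].

Definition submodule (Q : Y -> Prop) : Prop :=
  Q 0 /\ forall a u v, Q u -> Q v -> Q (smul a u + v).

Definition module_gen (t : seq Y) (v : Y) : Prop :=
  forall Q, submodule Q -> (forall u, u \in t -> Q u) -> Q v.

Lemma module_gen_submodule t : submodule (module_gen t).
Proof.
split=> [Q [Q0 _] _ //|a u v hu hv Q sQ ht].
by case: (sQ) => _; apply; [exact: hu|exact: hv].
Qed.

Lemma submoduleB Q u v : submodule Q -> Q u -> Q v -> Q (u - v).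
Proof.
move=> [_ h] hu hv; have -> : u - v = smul (-1) v + u; last exact: h.
by apply/ffunP => k; rewrite !ffunE mulN1r addrC.
Qed.

Lemma submodule_sum Q (T : eqType) (x : seq T) (f : T -> Y) : submodule Q ->
  (forall i, i \in x -> Q (f i)) -> Q (\sum_(i <- x) f i).
Proof.
move=> sQ hf; rewrite big_seq; elim/big_ind: _ => //; first by case: sQ.
move=> u v hu hv; have -> : u + v = smul 1 u + v; last by case: sQ => _; apply.
by apply/ffunP => k; rewrite !ffunE mul1r.
Qed.

Lemma module_gen_sub t t' v : {subset t <= t'} -> module_gen t v -> module_gen t' v.
Proof. by move=> st h Q sQ ht; apply: h => // u /st; exact: ht. Qed.

Lemma module_gen_mem t v : v \in t -> module_gen t v.
Proof. by move=> hv Q _; apply. Qed.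

Lemma module_gen_trans t t' v : module_gen t v -> (forall u, u \in t -> module_gen t' u) ->
  module_gen t' v.
Proof. by move=> h ht; apply: h => //; exact: module_gen_submodule. Qed.

Lemma module_gen_coef t v : module_gen t v ->
  exists c : nat -> S, v = \sum_(i < size t) smul (c i) t`_i.
Proof.
move=> h; apply: (h (fun v => exists c : nat -> S, v = \sum_(i < size t) smul (c i) t`_i)) => [|u ut].
  split=> [|a u w [c ->] [d ->]].
    by exists (fun=> 0); rewrite big1 // => i _; apply/ffunP => k; rewrite !ffunE mul0r.
  exists (fun i => a * c i + d i); apply/ffunP => k; rewrite ffunE [smul _ _ _]ffunE !sum_ffunE.
  rewrite mulr_sumr -big_split; apply: eq_bigr => i _ /=; rewrite !ffunE.
  by rewrite mulrDl mulrA.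
have lt : (index u t < size t)%N by rewrite index_mem.
exists (fun i => (i == index u t)%:R); rewrite (bigD1 (Ordinal lt)) //= eqxx nth_index //.
rewrite big1 ?addr0 => [|i ne]; first by apply/ffunP => k; rewrite ffunE mul1r.
have /negbTE -> : (i : nat) != index u t by [].
by apply/ffunP => k; rewrite !ffunE mul0r.
Qed.

(** Submodules of free modules are finitely generated: filter by the number of
    coordinates allowed to be nonzero. *)
Lemma submodule_fg Q : submodule Q ->
  exists2 t : seq Y, forall u, u \in t -> Q u & forall v, Q v -> module_gen t v.
Proof.
move=> sQ; pose Qn n v := Q v /\ forall k : 'I_r, (n <= k)%N -> v k = 0.
have sQn n : submodule (Qn n).
  split=> [|a u v [hu hu'] [hv hv']]; first by split=> [|k _]; [case: sQ|rewrite ffunE].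
  split; first by case: sQ => _; apply.
  by move=> k le; rewrite !ffunE hu' // hv' // mulr0 addr0.
suff h n : (n <= r)%N -> exists2 t : seq Y, forall u, u \in t -> Q u &
    forall v, Qn n v -> module_gen t v.
  have [t tQ ht] := h r (leqnn r); exists t => // v hv; apply: ht; split=> // k.
  by rewrite leqNgt ltn_ord.
elim: n => [|n IH] le.
  exists [::] => // v [_ hv]; suff -> : v = 0 by case: (module_gen_submodule [::]).
  by apply/ffunP => k; rewrite hv // ffunE.
have [t tQ ht] := IH (ltnW le); pose k0 : 'I_r := Ordinal le.
pose J x := exists2 v, Qn n.+1 v & v k0 = x.
have Jid : idl J.
  split=> [|a x y [u hu <-] [v hv <-]]; first by exists 0; [case: (sQn n.+1)|rewrite ffunE].
  by exists (smul a u + v); [case: (sQn n.+1) => _; apply|rewrite !ffunE].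
have [s sJ gJ] := noetherian_mpoly Jid.
have [t2 t2Q ht2] : exists2 t2 : seq Y, forall u, u \in t2 -> Qn n.+1 u &
    forall x, x \in s -> exists2 v, v \in t2 & v k0 = x.
  elim: s sJ {gJ} => [|x s IHs] sJ; first by exists [::].
  have [|t2 h1 h2] := IHs; first by move=> y ys; apply: sJ; rewrite inE ys orbT.
  have [v hv ev] := sJ x (mem_head _ _); exists (v :: t2) => [u|y]; rewrite inE.
    by case/orP => [/eqP ->//|/h1].
  case/orP => [/eqP ->|/h2[w wt ew]]; first by exists v; rewrite ?mem_head.
  by exists w => //; rewrite inE wt orbT.
exists (t2 ++ t) => [u|v Qv]; first by rewrite mem_cat => /orP[/t2Q[]|/tQ].
pose P x := exists2 w, module_gen t2 w & Qn n.+1 w /\ w k0 = x.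
have [w gw [Qw ew]] : P (v k0).
  have Jv : J (v k0) by exists v.
  apply: (gJ _ Jv P) => [|x /ht2[w wt ew]]; last first.
    by exists w; [exact: module_gen_mem|split=> //; exact: t2Q].
  have [g0 gD] := module_gen_submodule t2; have [q0 qD] := sQn n.+1.
  split=> [|a x y [u gu [Qu <-]] [u' gu' [Qu' <-]]].
    by exists 0 => //; split=> //; rewrite ffunE.
  by exists (smul a u + u'); [exact: gD|split; [exact: qD|rewrite !ffunE]].
have hvw : module_gen t (v - w).
  apply: ht; have [q1 q2] := submoduleB (sQn n.+1) Qv Qw; split=> // k.
  rewrite leq_eqVlt => /orP[/eqP e|/q2 //].
  have -> : k = k0 by apply: val_inj.
  by rewrite !ffunE ew subrr.
have -> : v = (v - w) - (0 - w) by rewrite sub0r opprK subrK.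
have sg := module_gen_submodule (t2 ++ t).
apply: (submoduleB sg); first by apply: module_gen_sub hvw => u; rewrite mem_cat orbC => ->.
apply: (submoduleB sg); first by case: sg.
by apply: module_gen_sub gw => u; rewrite mem_cat => ->.
Qed.

Lemma mcoeff_pihz e (f : S) m : (pihz e f)@_m = if e == (mdeg m)%:Z then f@_m else 0.
Proof.
elim/mpolyind: f => [|c m' p _ _ IH].
  by rewrite (lin0 (pihz_linear e)) mcoeff0; case: eqP.
rewrite pihz_linear !mcoeffD !mcoeffZ IH.
have hX : 'X_[K, m'] \is (mdeg m').-homog by rewrite dhomogX.
rewrite (pihz_homog _ hX) mcoeffX; case: (eqVneq m' m) => [->|ne].
  by case: eqP; rewrite ?mcoeffX ?eqxx // mcoeff0 mulr0 addr0.
case: eqP => [_|_]; rewrite ?mcoeffX ?mcoeff0 ?(negbTE ne) mulr0 !add0r //.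
Qed.

Variable s : 'I_r -> int.

Lemma fpr_decomposition (v : Y) : exists es : seq int, v = \sum_(e <- es) fpr s e v.
Proof.
pose es := undup (flatten [seq [seq (mdeg m)%:Z + s k | m <- msupp (v k)] | k : 'I_r]).
exists es; apply/ffunP => k; rewrite sum_ffunE; apply/mpolyP => m; rewrite raddf_sum /=.
have E e : (fpr s e v k)@_m = if e == (mdeg m)%:Z + s k then (v k)@_m else 0.
  by rewrite ffunE mcoeff_pihz subr_eq.
under eq_bigr do rewrite E.
have [h|h] := boolP ((mdeg m)%:Z + s k \in es).
  rewrite (bigD1_seq _ h) ?undup_uniq //= eqxx big1 ?addr0 // => e /negbTE ->//.
rewrite big_seq big1 => [|e he]; last by case: eqP => // ee; rewrite -ee he in h.
apply: memN_msupp_eq0; apply: contra h => h; rewrite mem_undup.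
apply/flattenP; exists [seq (mdeg m)%:Z + s k | m <- msupp (v k)]; last exact: map_f.
by apply/mapP; exists k; rewrite ?mem_enum.
Qed.

(** The components of finitely many generators are finitely many homogeneous
    generators. *)
Lemma graded_cover Q : submodule Q -> (forall e v, Q v -> Q (fpr s e v)) ->
  exists r2 (s2 : 'I_r2 -> int) (A : 'M[S]_(r2, r)),
    (forall k l m, m \in msupp (A k l) -> (mdeg m)%:Z + s l = s2 k) /\
    forall v, Q v <-> exists w, v = dmap A w.
Proof.
move=> sQ hQ; have [t tQ gt] := submodule_fg sQ.
pose isgr (u : {ffun 'I_r -> {mpoly K[N]}}) := exists e, fpr s e u = u.
have [L LQ gL] : exists2 L : seq Y, forall u, u \in L -> Q u /\ isgr u &
    forall u, u \in t -> module_gen L u.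
  elim: t tQ {gt} => [|v t IH] tQ; first by exists [::].
  have [|L LQ gL] := IH; first by move=> u ut; apply: tQ; rewrite inE ut orbT.
  have [es ev] := fpr_decomposition v; exists ([seq fpr s e v | e <- es] ++ L) => u.
    rewrite mem_cat => /orP[/mapP[e _ ->]|/LQ //].
    by split; [apply: hQ; apply: tQ; rewrite mem_head|exists e; exact: fpr_idem].
  rewrite inE => /orP[/eqP ->|/gL]; last first.
    by apply: module_gen_sub => w; rewrite mem_cat orbC => ->.
  suff h : module_gen ([seq fpr s e v | e <- es] ++ L) (\sum_(e <- es) fpr s e v).
    by rewrite -ev in h.
  apply: submodule_sum (module_gen_submodule _) _ => e he.
  by apply: module_gen_mem; rewrite mem_cat; apply/orP; left; apply/mapP; exists e.
have /boolp.choice[s2 hs2] : forall k : 'I_(size L), exists e, fpr s e L`_k = L`_k.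
  by move=> k; have [_] := LQ L`_k (mem_nth _ (ltn_ord k)).
exists (size L), s2, (\matrix_(k, l) L`_k l); split=> [k l m|v].
  rewrite mxE -{1}hs2 mcoeff_msupp ffunE mcoeff_pihz.
  have [<- _|_] := eqVneq (s2 k - s l) (mdeg m)%:Z; last by rewrite eqxx.
  by rewrite subrK.
split=> [/gt h|[w ->]].
  have [c ->] := module_gen_coef (module_gen_trans h gL).
  exists [ffun k => c (val k)]; apply/ffunP => l; rewrite sum_ffunE ffunE.
  by apply: eq_bigr => k _; rewrite !ffunE mxE.
have -> : dmap (\matrix_(k, l) L`_k l) w = \sum_k smul (w k) L`_k.
  by apply/ffunP => l; rewrite sum_ffunE ffunE; apply: eq_bigr => k _; rewrite !ffunE mxE.
apply: (submodule_sum sQ) => k _; have [h _] := LQ L`_k (mem_nth _ (ltn_ord k)).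
have -> : smul (w k) L`_k = smul (w k) L`_k + 0 by rewrite addr0.
by case: sQ => h0; apply.
Qed.
End Submodules.

Section Existence.
Variables (K : fieldType) (N : nat).
Local Notation S := {mpoly K[N]}.

(** The state of the construction of a resolution: a graded submodule of a free module,
    to be covered by the next free module. *)
Record graded_sub := GradedSub {
  gs_r : nat;
  gs_s : 'I_gs_r -> int;
  gs_Q : {ffun 'I_gs_r -> S} -> Prop;
  gs_sub : submodule gs_Q;
  gs_pr : forall e v, gs_Q v -> gs_Q (fpr (@gs_s) e v) }.

Record cover (T : graded_sub) := Cover {
  cv_r : nat;
  cv_s : 'I_cv_r -> int;
  cv_A : 'M[S]_(cv_r, gs_r T);
  cv_homog : forall k l m, m \in msupp (cv_A k l) -> (mdeg m)%:Z + gs_s l = cv_s k;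
  cv_iff : forall v, gs_Q v <-> exists w, v = dmap cv_A w }.

Lemma exists_cover T : inhabited (cover T).
Proof.
by have [r2 [s2 [A [h1 h2]]]] := graded_cover (@gs_sub T) (@gs_pr T); split; exists r2 s2 A.
Qed.

Definition the_cover T : cover T := ClassicalEpsilon.epsilon (exists_cover T) (fun=> True).

Lemma kernel_submodule r r' (A : 'M[S]_(r, r')) : submodule (fun v => dmap A v = 0).
Proof.
split=> [|a u v hu hv]; first exact: lin0 (dmap_linear A).
rewrite (linD (dmap_linear A)) hv addr0; apply/ffunP => l; rewrite !ffunE.
transitivity (a * \sum_k u k * A k l).
  by rewrite mulr_sumr; apply: eq_bigr => k _; rewrite ffunE mulrA.
by have /ffunP/(_ l) := hu; rewrite !ffunE => ->; rewrite mulr0.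
Qed.

Lemma kernel_pr T (c : cover T) e v : dmap (cv_A c) v = 0 ->
  dmap (cv_A c) (fpr (@cv_s _ c) e v) = 0.
Proof.
move=> hv; rewrite (dmap_pr (s' := @gs_s T)) ?hv; last exact: cv_homog.
exact: lin0 (fpr_linear _ _).
Qed.

Definition next_sub T (c : cover T) : graded_sub :=
  GradedSub (kernel_submodule (cv_A c)) (@kernel_pr T c).

Variable I : {pred S}.
Hypothesis Iid : idealr_closed I.
Hypothesis Ihom : homogeneous_ideal I.

Let ideal_submodule : submodule (fun v : {ffun 'I_1 -> S} => v ord0 \in I).
Proof.
case: Iid => I0 _ ID; split=> [|a u v hu hv]; first by rewrite ffunE.
by rewrite !ffunE; apply: ID.
Qed.

Let ideal_pr e (v : {ffun 'I_1 -> S}) : v ord0 \in I -> fpr (fun=> 0) e v ord0 \in I.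
Proof.
move=> hv; rewrite ffunE subr0; case: e => d /=; first exact: Ihom.
by case: Iid.
Qed.

Let T0 := GradedSub ideal_submodule ideal_pr.

Fixpoint syz (i : nat) : graded_sub :=
  if i is i'.+1 then next_sub (the_cover (syz i')) else T0.

Let c i := the_cover (syz i).

Lemma ffun_dmap_row r r' (A : 'M[S]_(r, r')) (v : 'rV[S]_r) (w : 'rV[S]_r') :
  [ffun l => w 0 l] = dmap A [ffun k => v 0 k] <-> w = v *m A.
Proof.
split=> [e|->]; last first.
  by apply/ffunP => l; rewrite !ffunE mxE; apply: eq_bigr => k _; rewrite ffunE.
apply/rowP => l; have /ffunP/(_ l) := e; rewrite !ffunE mxE => ->.
by apply: eq_bigr => k _; rewrite ffunE.
Qed.

Lemma exact_cover T (cT : cover T) (v : 'rV[S]_(gs_r T)) :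
  gs_Q [ffun k => v 0 k] <-> exists w, v = w *m cv_A cT.
Proof.
split=> [/(cv_iff cT)[w ew]|[w /ffun_dmap_row e]].
  exists (\row_k w k); apply/ffun_dmap_row; rewrite ew; congr (dmap _ _).
  by apply/ffunP => k; rewrite ffunE mxE.
by apply/(cv_iff cT); exists [ffun k => w 0 k].
Qed.

Lemma kernel_row T (cT : cover T) (v : 'rV[S]_(cv_r cT)) :
  v *m cv_A cT = 0 <-> gs_Q (g := next_sub cT) [ffun k => v 0 k].
Proof.
rewrite /=; split=> [e|e].
  by have /esym/ffun_dmap_row <- := e; apply/ffunP => l; rewrite !ffunE mxE.
by apply/esym/ffun_dmap_row; rewrite e; apply/ffunP => l; rewrite !ffunE mxE.
Qed.

Lemma exists_resolution : inhabited (graded_resolution I).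
Proof.
split; apply: (@GradedResolution K N I (fun i => cv_r (c i)) (fun i => @cv_s _ (c i))
  (cv_A (c 0)) (fun i => cv_A (c i.+1))).
- by move=> k m /(cv_homog) <-; rewrite addr0.
- by move=> i k l m; exact: cv_homog.
- move=> f; have := @exact_cover _ (c 0) (const_mx f); rewrite /= ffunE mxE => h.
  rewrite h; split=> [[w e]|[w e]]; exists w.
    by rewrite -e mxE.
  by apply/matrixP => a b; rewrite !ord1 mxE e.
- move=> v; rewrite (@kernel_row _ (c 0) v); exact: (@exact_cover _ (c 1)).
- move=> i v; rewrite (@kernel_row _ (c i.+1) v); exact: (@exact_cover _ (c i.+2)).
Qed.
End Existence.

(** * The upper bound *)

Lemma betti_tor_dim (K : fieldType) N (I : {pred {mpoly K[N]}}) i j :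
  idealr_closed I -> homogeneous_ideal I ->
  exists F : graded_resolution I, betti I i j = tor_dim F i j.
Proof.
move=> Iid Ihom; have [F] := exists_resolution Iid Ihom.
exact: (ClassicalEpsilon.epsilon_spec (inhabits 0%N)
  (fun b => exists F : graded_resolution I, b = tor_dim F i j)
  (ex_intro _ _ (ex_intro _ F erefl))).
Qed.

Section AssociatedPoints.
Variables (K : fieldType) (N : nat) (I : {pred {mpoly K[N]}}).
Hypothesis Iid : idealr_closed I.
Hypothesis Irad : radical_ideal I.

Definition assoc := {p : {pred {mpoly K[N]}} | associated_prime I p}.

Record apoint (p : assoc) := APoint {
  ap_F : fieldType; ap_iota : {rmorphism K -> ap_F}; ap_xi : 'I_N -> ap_F;
  ap_point : is_point ap_iota ap_xi (sval p) }.

Lemma exists_apoint p : inhabited (apoint p).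
Proof.
by have [F [i [x h]]] := exists_point (svalP p).1; split; exists F i x.
Qed.
Definition the_apoint p : apoint p := ClassicalEpsilon.epsilon (exists_apoint p) (fun=> True).

Local Notation iota p := (ap_iota (the_apoint p)).
Local Notation xi p := (ap_xi (the_apoint p)).

(** A radical ideal is the intersection of its associated primes. *)
Lemma mem_apoints f : f \in I <-> forall p, mmap (iota p) (xi p) f = 0.
Proof.
split=> [hf p|h].
  apply/eqP; rewrite -(ap_point (the_apoint p)); have [_ [g hg]] := svalP p.
  by rewrite hg mulrC; case: Iid => I0 _ ID; rewrite -[_ * _]addr0; apply: ID.
apply/negPn/negP => hf.
have [p hp /negP] := exists_associated (@noetherian_mpoly K N) Iid Irad hf; apply.
by rewrite (ap_point (the_apoint (exist _ p hp))) h.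
Qed.

(** The bound for the family of all associated points; the linear forms that vanish at
    all of them are those of [I]. *)
Lemma quadratic_strand_bound h i : unmixed I -> height I h ->
  qdim_le (kcyc (@xop K N) (ideal_strand I 2) (m := N) (j := i))
          (kbnd (@xop K N) (ideal_strand I 1) (m := N) (j := i))
          ('C(2 * h, i + 2) - 2 * 'C(h, i + 2)).
Proof.
move=> um hI.
have hN : (h <= N)%N.
  have [[p0 [_ _ [[c hc _] _]]] _] := hI.
  have [F' [i' [x' h']]] := exists_point (hc.1 0%N (leq0n h)).
  exact: trdeg_ge_bound (chain_trdeg hc h').
have [M hM] := subspace_mx (vanish_subspace (fun p => iota p) (fun p => xi p)).
have tr p : trdeg_ge (iota p) (xi p) (N - h).
  exact: associated_trdeg um hI (svalP p) _ _ _ (ap_point (the_apoint p)).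
have fb := @family_bound h (N - h) K assoc (fun p => ap_F (the_apoint p)) N
   (fun p => iota p) (fun p => xi p) N M i (esym (subnKC hN)) tr
   (fun=> or_introl (fun u => (hM u).1)) (fun u => (hM u).2).
apply: (qdim_le_weaken (D := strand_bound h N i)).
  have := strand_bound_double h i; have := strand_bound_le h N i; rewrite !addn2; lia.
have s2 : subspace (ideal_strand I 2).
  split=> [|a u v [hu hu'] [hv hv']]; first by split; [case: Iid|exact: rpred0].
  split; last exact: (homog_subspace K N 2).2.
  by rewrite -mul_mpolyC; case: Iid => _ _; apply.
apply: (qdim_le_sub _ _ _ fb); last exact: kcyc_subspace (@xop_linear K N) s2.
- move=> z [hz Dz]; split=> //; apply: kall_sub hz => f [hf hf2]; split=> // p.
  exact: (mem_apoints f).1.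
- move=> z _ [w hw ->]; exists w => //; apply: kall_sub hw => f [u /hM hu ->].
  split; last exact: lam_homog.
  by apply/mem_apoints => p; rewrite mmap_lam; exact: hu.
Qed.
End AssociatedPoints.

Theorem betti_upper_bound (K : fieldType) N (I : {pred {mpoly K[N]}}) h i :
  idealr_closed I -> homogeneous_ideal I -> unmixed I -> radical_ideal I -> height I h ->
  (betti I i (i + 2)%N%:Z <= 'C(2 * h, i + 2) - 2 * 'C(h, i + 2))%N.
Proof.
move=> Iid Ihom um rad hI; have [F ->] := betti_tor_dim i (i + 2)%N%:Z Iid Ihom.
by apply/(tor_dim_koszul F); exact: quadratic_strand_bound.
Qed.

Import Num.Theory.

(** * Alternating forms of pure type *)

Lemma kD_ext (K : fieldType) (X : lmodType K) (x y : nat -> X -> X) n i (z : kos X n i.+1) :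
  (forall k u, (k < n)%N -> x k u = y k u) -> kD x z = kD y z.
Proof.
move=> e; have := @kmap_kD _ _ X X id x y n (fun u v => erefl) e i z.
by rewrite !kmap_id.
Qed.

Lemma kD_zero (K : fieldType) (X : lmodType K) (x : nat -> X -> X) n i (z : kos X n i.+1) :
  (forall k u, (k < n)%N -> x k u = 0) -> kD x z = 0.
Proof.
move=> e; rewrite (kD_ext (y := fun k u => 0)) //; elim: n i z {e} => [|n IH] [|i] z; try exact: row0P; try by [].
apply: pairP => /=; last by rewrite IH oppr0.
by rewrite IH add0r; exact: kmap_zero.
Qed.

Lemma kD_scale (K : fieldType) (X : lmodType K) (x : nat -> X -> X) a n i (z : kos X n i.+1) :
  kD (fun k u => a *: x k u) z = a *: kD x z.
Proof.
elim: n i z => [|n IH] [|i] z; try exact: kos0P.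
  by rewrite /= scaler0.
apply: pairP => /=; last by rewrite IH scalerN.
by rewrite IH kmapZf scalerDr.
Qed.

Section Pure.
Variable K : fieldType.
Local Notation V := (K^o).

(** [Jw] is the complex structure that exchanges the coordinates [2 k] and [2 k + 1]. *)
Definition wop (w : nat -> K) (k : nat) (v : V) : V := w k *: v.
Definition Jw (w : nat -> K) (k : nat) : K := if odd k then w k.-1 else - w k.+1.

Lemma wop_linear w k : linear (wop w k).
Proof. by move=> a u v; rewrite /wop scalerDr !scalerA mulrC. Qed.

(** A form of positive degree is determined by its contractions. *)
Lemma contraction_zero n q (z : kos V n q.+2) : (forall w, kD (wop w) z = 0) -> z = 0.
Proof.
elim: n q z => [|n IH] q z h; first exact: row0P.
have e2 : z.2 = 0.
  have [e _] : kD (wop (fun k => (k == n)%:R)) z = 0 by [].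
  move: e; rewrite kD_zero ?add0r => [|k u lt]; last by rewrite /wop ltn_eqF // scale0r.
  by rewrite (kmap_eq (g := id) (P := fun=> True)) ?kmap_id // => [u _|]; [rewrite /wop eqxx scale1r|exact: kallT].
apply: pairP => //; apply: IH => w; have [e _] := h w; move: e.
by rewrite e2 (kmap0 (lin0 (wop_linear w n))) addr0.
Qed.

(** In characteristic other than two and over a field with a square root of [-1], this
    says that [z] is a sum of forms of types [(q + 1, 0)] and [(0, q + 1)] for [J]. *)
Definition pure n q (z : kos V n q.+2) : Prop :=
  forall w, kD (wop w) (kD (wop (Jw w)) z) = 0.

Lemma pure_subspace n q : subspace (@pure n q).
Proof.
have L w := kD_linear (wop_linear w); split=> [w|a u v hu hv w].
  by rewrite !(kD0 (wop_linear _)).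
by rewrite !L hu hv scaler0 addr0.
Qed.

Let kmap_wop w m n i (z : kos V n i) : kmap (wop w m) z = w m *: z.
Proof. by have := @kmapZf _ _ V V (w m) id n i z; rewrite kmap_id. Qed.

(** Components of a form of pure type with respect to the last two variables:
    the mixed component vanishes, the first one is of pure type, and the two
    others are exchanged by [J]. *)
Lemma pure_step n q (z : kos V n.*2.+2 q.+3) : pure z ->
  [/\ pure z.1.1, pure z.1.2, z.2.2 = 0 &
      forall w, kD (wop w) z.2.1 = kD (wop (Jw w)) z.1.2].
Proof.
set m := n.*2 in z *; case: z => [[a b] [c d]] hz.
have mev : odd m = false by rewrite /m odd_double.
pose ext (w : nat -> K) s k := if (k < m)%N then w k else if k == m then s else 0.
have main w s : kD (wop w) (kD (wop (Jw w)) a) + s *: kD (wop w) c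
    - s *: kD (wop (Jw w)) b + (s * s) *: d = 0.
  have [[e _] _] := hz (ext w s); move: e => /=.
  have ew i (y : kos V m i.+1) : kD (wop (ext w s)) y = kD (wop w) y.
    by apply: kD_ext => k u lt; rewrite /wop /ext lt.
  have eJ i (y : kos V m i.+1) : kD (wop (Jw (ext w s))) y = kD (wop (Jw w)) y.
    apply: kD_ext => k u lt; rewrite /wop /Jw /ext; congr (_ *: _); case: ifP => od.
      by rewrite (leq_ltn_trans (leq_pred k) lt).
    have -> // : (k.+1 < m)%N.
    by rewrite ltn_neqAle lt andbT; apply: contraFneq od => ek; rewrite -[odd k]negbK -oddS ek mev.
  rewrite !ew !eJ !kmap_wop.
  have e1 : ext w s m = s by rewrite /ext ltnn eqxx.
  have e2 : ext w s m.+1 = 0 by rewrite /ext ltnNge leqnSn /= gtn_eqF.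
  have e3 : Jw (ext w s) m = 0 by rewrite /Jw mev e2 oppr0.
  have e4 : Jw (ext w s) m.+1 = s by rewrite /Jw oddS mev /= e1.
  rewrite e1 e2 e3 e4 !scale0r !addr0 (kDD (wop_linear _)) (kDZ (wop_linear _)).
  by rewrite scalerDr scalerN scalerA => e; rewrite -[RHS]e !addrA.
have pa : pure a.
  by move=> w; have := main w 0; rewrite !scale0r mulr0 scale0r subr0 !addr0.
have d0 : d = 0.
  have := main (fun=> 0) 1; rewrite mulr1 !scale1r pa add0r.
  rewrite (kD_zero (x := wop (fun=> 0))) => [|k u _]; last by rewrite /wop scale0r.
  rewrite (kD_zero (x := wop (Jw (fun=> 0)))) => [|k u _]; last first.
    by rewrite /wop /Jw oppr0; case: ifP; rewrite scale0r.
  by rewrite subr0 add0r.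
have ecb w : kD (wop w) c = kD (wop (Jw w)) b.
  have := main w 1; rewrite mulr1 !scale1r pa add0r d0 addr0 => /eqP.
  by rewrite subr_eq0 => /eqP.
split=> //= w; rewrite -ecb; apply: (kDkD (wop_linear w)) => k l u.
by rewrite /wop !scalerA mulrC.
Qed.

(** The components [z.1.1] and [z.1.2] determine a pure form, so that the dimensions obey
    Pascal's recursion. *)
Lemma pure_bound n q :
  qdim_le (@pure n.*2 q) (fun z => z = 0) (2 * 'C(n, q.+1)).
Proof.
elim: n q => [|n IH] q.
  rewrite bin0n muln0; apply: qdim_le0; first exact: pure_subspace.
  by move=> z _; exact: row0P.
case: q => [|q].
  have h0 : qdim_le (fun _ : V => True) (fun v : V => v = 0) 1.
    apply: (qdim_le_span (s := fun=> 1 : V)).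
      by split=> // a u v -> ->; rewrite scaler0 addr0.
    move=> z _; exists (const_mx z); rewrite /comb big_ord1 mxE.
    by rewrite [z *: _]mulr1 subrr.
  have hT : subspace (fun _ : V => True) by split.
  rewrite bin1 mul2n; have := qdim_le_kall (n := n.+1.*2) (i := 1%N) hT h0; rewrite bin1 muln1.
  apply: qdim_le_sub => [z _|z _|]; [exact: kallT| |exact: pure_subspace].
  move=> h; have := kmap_eq (f := id) (g := fun=> 0) (fun u (e : u = 0) => e) h.
  by rewrite kmap_id kmap_zero.
rewrite binS mulnDr.
apply: (qdim_le_filter (f := fun z : kos V n.+1.*2 q.+3 => z.1.1) (Z' := @pure n.*2 q.+1)
  (B' := fun z => z = 0)) => //.
- exact: pure_subspace.
- by move=> z /pure_step[].
apply: (qdim_le_rel (R := fun (z : kos V n.+1.*2 q.+3) y => z.1.2 = y) _ _ _ _ _ (IH q)) => //.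
- by move=> a u v u' v' <- <-.
- split; first by split=> //; exact: (pure_subspace _ _).1.
  move=> a u v [hu eu] [hv ev]; split; first exact: (pure_subspace _ _).2.
  by rewrite /= eu ev scaler0 addr0.
- by move=> z [/pure_step[_ h _ _] _]; exists z.1.2.
move=> z y [/pure_step[_ _ e3 e4] e1] <- e2.
apply: pairP; apply: pairP => //; apply: contraction_zero => w.
by rewrite e4 e2 (kD0 (wop_linear _)).
Qed.

Lemma kos_embedding n q :
  exists f : 'rV[K]_('C(n, q)) -> kos V n q.+1, linear f /\ forall u, f u = 0 -> u = 0.
Proof.
elim: n q => [|n IH] [|q].
- exists (fun u => u 0 0); split=> [a u v|u h]; first by rewrite !mxE.
  by apply/rowP => k; rewrite !mxE ord1.
- exists (fun u => u); split=> //.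
- rewrite bin0; have := IH 0%N; rewrite bin0 => -[f [fL fI]].
  exists (fun u => (f u, 0) : kos V n.+1 1); split=> [a u v|u [/fI]//].
  by apply: pairP => /=; [exact: fL|exact: kos0P].
rewrite binS; have [f [fL fI]] := IH q.+1; have [g [gL gI]] := IH q.
exists (fun u => (f (lsubmx u), g (rsubmx u)) : kos V n.+1 q.+2); split=> [a u v|u [/fI h1 /gI h2]].
  by apply: pairP => /=; rewrite linearP ?fL ?gL.
by rewrite -[u]hsubmxK h1 h2 row_mx0.
Qed.

Lemma qdim_ge_kos n q D : qdim_le (fun _ : kos V n q.+1 => True) (fun z => z = 0) D ->
  ('C(n, q) <= D)%N.
Proof.
have [f [fL fI]] := kos_embedding n q.
move=> /(_ _ (fun k => f (delta_mx 0 k)) (fun=> I))[M hM].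
have rM : row_free M.
  rewrite -kermx_eq0; apply/eqP/row_matrixP => k; rewrite row0; apply: fI.
  have := hM (row k (kermx M)); have -> : row k (kermx M) *m M = 0.
    by apply/sub_kermxP; exact: row_sub.
  move=> /(_ erefl) e; rewrite -[RHS]e [in LHS](row_sum_delta (row k (kermx M))) (lin_sum fL).
  by apply: eq_bigr => l _; rewrite (linZ fL).
by rewrite -(eqP rM) rank_leq_col.
Qed.
End Pure.

(** * A prime ideal attaining the bound *)

Section Example.
Variable h : nat.
Local Notation N := (h.*2).
Local Notation S := {mpoly rat[N]}.
Local Notation P := {mpoly algC[h]}.

Definition zc (k : nat) : algC := if odd k then 1 else 'i.

(** The point [(i t_1, t_1, ..., i t_h, t_h)]: its complex span of coordinates is an
    eigenspace of the complex structure [J]. *)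
Definition gpoint : S -> P :=
  mmap (@mpolyC h algC \o ratr) (fun i : 'I_N => zc i *: mvar algC h i./2).
HB.instance Definition _ := GRing.RMorphism.copy gpoint
  (mmap (@mpolyC h algC \o ratr) (fun i : 'I_N => zc i *: mvar algC h i./2)).

Definition conj_prime : {pred S} := [pred f | gpoint f == 0].

Lemma mem_conj_prime f : (f \in conj_prime) = (gpoint f == 0). Proof. by []. Qed.

Lemma conj_prime_prime : prime_ideal conj_prime.
Proof. exact: (@ker_prime _ _ gpoint). Qed.

Lemma gpointX (i : 'I_N) : gpoint 'X_i = zc i *: mvar algC h i./2.
Proof. by rewrite /gpoint mmapX mmap1U. Qed.

Lemma gpointC c : gpoint c%:MP = (ratr c)%:MP.
Proof. exact: mmapC. Qed.

Lemma gpointZ c f : gpoint (c *: f) = ratr c *: gpoint f.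
Proof. by rewrite -mul_mpolyC rmorphM /= gpointC mul_mpolyC. Qed.

Lemma mvar_homog (K : fieldType) n k : mvar K n k \is 1.-homog.
Proof. by rewrite /mvar; case: insub => [i|]; rewrite ?rpred0 // dhomogX /= mdeg1. Qed.

Lemma gpoint_homog d f : f \is d.-homog -> gpoint f \is d.-homog.
Proof.
move=> /dhomogP hf; rewrite /gpoint /mmap big_seq; apply: rpred_sum => m hm.
rewrite /= mul_mpolyC; apply: rpredZ; rewrite -(hf m hm) /= mdegE /mmap1.
elim/big_rec2: _ => [|i e p _ IH]; first exact: dhomog1.
rewrite dhomogM //.
have hz : zc i *: mvar algC h i./2 \is 1.-homog by rewrite rpredZ // mvar_homog.
by have := dhomogMn (m i) hz; rewrite mul1n.
Qed.

Lemma gpoint_pihomog d f : gpoint (pihomog mdeg d f) = pihomog mdeg d (gpoint f).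
Proof.
elim/mpolyind: f => [|c m f _ _ IH]; first by rewrite pihomog0 !rmorph0 pihomog0.
rewrite linearP /= !rmorphD /= !gpointZ linearP /= IH; congr (_ *: _ + _).
have hm : 'X_[rat, m] \is (mdeg m).-homog by rewrite dhomogX.
rewrite pihomogX; case: eqP => [<-|/eqP ne].
  by rewrite pihomog_dE //; exact: gpoint_homog.
by rewrite rmorph0 (pihomog_ne0 _ (gpoint_homog hm)).
Qed.

Lemma conj_prime_homog : homogeneous_ideal conj_prime.
Proof.
by move=> f d; rewrite !mem_conj_prime gpoint_pihomog => /eqP ->; rewrite pihomog0.
Qed.

Lemma conj_prime_radical : radical_ideal conj_prime.
Proof. by move=> f n; rewrite !mem_conj_prime rmorphXn expf_eq0 => /andP[]. Qed.

(** The only associated prime of a prime is itself. *)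
Lemma prime_unmixed (R : comNzRingType) (p : {pred R}) : prime_ideal p -> unmixed p.
Proof.
move=> [[p0 _ pD] pp] q [[[_ q1 _] _] [f hf]].
have E : q =i p.
  have fp : f \notin p by rewrite hf mul1r in q1.
  move=> g; rewrite hf; apply/idP/idP => [/pp|hg]; first by rewrite (negbTE fp) orbF.
  by rewrite mulrC -[_ * _]addr0; apply: pD.
have sub (A : {pred R}) : {subset p <= A} <-> {subset q <= A}.
  by split=> s x hx; apply: s; move: hx; rewrite E.
move=> d; split=> -[[c hc sc] hd]; split.
- by exists c => //; apply/sub.
- by move=> n c' hc' /sub; exact: hd.
- by exists c => //; apply/sub.
- by move=> n c' hc' /sub; exact: hd.
Qed.

Definition pt_iota : {rmorphism rat -> fieldt algC h} :=
  @FracField.tofrac _ \o (@mpolyC h algC \o ratr).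
Definition pt_xi (i : 'I_N) : fieldt algC h := (gpoint 'X_i)%:F.

Lemma conj_prime_point : is_point pt_iota pt_xi conj_prime.
Proof.
move=> f; rewrite mem_conj_prime -tofrac_eq0; congr (_ == 0).
apply: (rmorph_mpoly_eq (f := @FracField.tofrac _ \o gpoint)
  (g := mmap pt_iota pt_xi)) => [c|i] /=; first by rewrite mmapC gpointC.
by rewrite mmapX mmap1U.
Qed.

Lemma odd_index (k : 'I_h) : (k.*2.+1 < N)%N.
Proof. by rewrite -doubleS leq_double ltn_ord. Qed.

Lemma conj_prime_trdeg : trdeg_ge pt_iota pt_xi h.
Proof.
exists (fun k => Ordinal (odd_index k)) => f e.
have X1 (k : 'I_h) : gpoint 'X_(Ordinal (odd_index k)) = 'X_k.
  by rewrite gpointX /zc /= odd_double scale1r uphalf_double mvarE.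
have : (map_mpoly ratr f : P)%:F = 0.
  rewrite -[RHS]e; apply: (rmorph_mpoly_eq (f := @FracField.tofrac _ \o map_mpoly ratr)
    (g := mmap pt_iota (pt_xi \o (fun k => Ordinal (odd_index k))))) => [c|k] /=.
    by rewrite mmapC map_mpolyC.
  by rewrite mmapX mmap1U map_mpolyX /= /pt_xi X1.
move/eqP; rewrite tofrac_eq0 => /eqP e'; apply/mpolyP => m.
by apply/eqP; rewrite mcoeff0 -(fmorph_eq0 (ratr : {rmorphism rat -> algC})) -mcoeff_map_mpoly e' mcoeff0.
Qed.

Lemma sqr_i : 'i ^+ 2 = -1 :> algC. Proof. exact: sqrCi. Qed.

(** Among [h + 1] coordinates two have the same parameter, and then the sum of their
    squares vanishes. *)
Lemma conj_prime_trdeg_max : ~ trdeg_ge pt_iota pt_xi h.+1.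
Proof.
move=> [T hT]; have half (k : 'I_h.+1) : ((T k)./2 < h)%N.
  by rewrite ltn_half_double ltn_ord.
have [inj|/injectivePn[a [b ne /(congr1 val) /= e]]] :=
    boolP (injectiveb (fun k => Ordinal (half k))).
  by move: inj => /injectiveP/leq_card; rewrite !card_ord ltnn.
have Tinj := indep_index_inj hT.
have od : odd (T a) != odd (T b).
  apply: contra ne => /eqP eo; apply/eqP/Tinj/val_inj.
  by rewrite /= -(odd_double_half (T a)) -(odd_double_half (T b)) eo e.
have z0 : zc (T a) ^+ 2 + zc (T b) ^+ 2 = 0.
  move: od; rewrite /zc; case: (odd (T a)); case: (odd (T b)) => // _.
    by rewrite sqr_i expr1n subrr.
  by rewrite sqr_i expr1n addNr.
have g0 : 'X_a ^+ 2 + 'X_b ^+ 2 = 0 :> {mpoly rat[h.+1]}.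
  apply: hT; rewrite rmorphD !rmorphXn /= !mmapX !mmap1U /= /pt_xi !gpointX e.
  by rewrite -!rmorphXn -rmorphD /= !exprZn -scalerDl z0 scale0r tofrac0.
have := congr1 (mcoeff (U_(a) *+ 2)) g0; rewrite mcoeff0 mcoeffD !mpolyXn !mcoeffX eqxx.
case: eqP => [/mnmP/(_ a)|_]; last by rewrite addr0 => /eqP; rewrite oner_eq0.
by rewrite !mulmnE !mnm1E eqxx eq_sym (negbTE ne).
Qed.

Lemma conj_prime_height : height conj_prime h.
Proof.
have hp := conj_prime_prime.
have [c hc ec] : exists2 c, prime_chain h c & c h =i conj_prime.
  have [T hT] := conj_prime_trdeg; have [c] := chain_below hT conj_prime_trdeg_max.
  rewrite (_ : (N - h = h)%N); last by rewrite -addnn addnK.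
  move=> hc ec; exists c => // f; rewrite ec subst_ker_full; exact/esym/conj_prime_point.
split.
  exists conj_prime; split=> //; split; first by exists c.
  move=> n c' hc' ec'; have [F [io [x hx]]] := exists_point (hc'.1 0%N (leq0n n)).
  have le : (h + n <= N)%N.
    apply: (trdeg_ge_bound (chain_trdeg_add (r := h) hc' _ hx)) => F1 i1 x1 hx1.
    apply: (trdeg_ge_sub _ conj_prime_trdeg) => f /eqP.
    by rewrite -hx1 ec' (conj_prime_point f) => /eqP.
  by move: le; rewrite -addnn leq_add2l.
move=> q n hq sub [_ hn]; pose c' k := if (k < h)%N then c k else q.
apply: (hn h c'); last by move=> f; rewrite /c' ltnn.
have sq k : (k < h)%N -> {subset c k <= q}.
  move=> lt f hf; apply: sub; rewrite -ec.
  have up d : (k + d <= h)%N -> f \in c (k + d)%N.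
    elim: d => [|d IH] le; first by rewrite addn0.
    rewrite addnS in le *; by apply: (hc.2 _ le).1; apply: IH; exact: ltnW.
  by have := up (h - k)%N; rewrite (subnKC (ltnW lt)); apply.
split=> k lek; first by rewrite /c'; case: ifP => _ //; apply: hc.1.
rewrite /c' lek; split; first by case: ifP => _; [exact: (hc.2 _ lek).1|exact: sq].
move=> hs; apply: (hc.2 _ lek).2 => f hf; apply: hs; case: ifP => // nlt.
have e : k.+1 = h by apply/eqP; rewrite eqn_leq lek leqNgt nlt.
by apply: sub; rewrite -ec; move: hf; rewrite e.
Qed.
End Example.

Arguments conj_prime h : clear implicits.

Section LowerBound.
Variable h : nat.
Local Notation N := (h.*2).
Local Notation S := {mpoly rat[N]}.
Local Notation P := {mpoly algC[h]}.
Local Notation V := (rat^o).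

Lemma gpoint_mvar k : (k < N)%N -> gpoint (mvar rat N k) = zc k *: mvar algC h k./2.
Proof. by move=> lt; rewrite (mvarE rat (Ordinal lt)) gpointX. Qed.

(** The squares of both sides of [a i = - b] have opposite signs. *)
Lemma rat_i_combination (a b : rat) : ratr a * 'i + ratr b = 0 :> algC -> a = 0 /\ b = 0.
Proof.
move=> /eqP; rewrite addr_eq0 => /eqP e.
have : ratr (a ^+ 2 + b ^+ 2) = 0 :> algC.
  have := congr1 (fun x => x ^+ 2) e; rewrite sqrrN exprMn sqr_i mulrN1 => e2.
  by rewrite rmorphD !rmorphXn /= -e2 subrr.
move=> /eqP; rewrite fmorph_eq0 paddr_eq0 ?sqr_ge0 // !sqrf_eq0.
by case/andP => /eqP -> /eqP ->.
Qed.

Lemma conj_prime_linear f : f \in conj_prime h -> f \is 1.-homog -> f = 0.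
Proof.
rewrite mem_conj_prime => /eqP pf /homog1_lam ef; set u := (fun i => _) in ef.
suff u0 i : u i = 0 by rewrite ef /lam big1 // => i _; rewrite u0 scale0r.
have lti : (i./2 < h)%N by rewrite ltn_half_double ltn_ord.
pose k := Ordinal lti; pose lt1 := odd_index k; have lt0 : (k.*2 < N)%N by exact: ltnW.
pose i0 := Ordinal lt0; pose i1 := Ordinal lt1.
have e0 : ratr (u i0) * 'i + ratr (u i1) = 0 :> algC.
  have := congr1 (mcoeff U_(k)) pf; rewrite mcoeff0 => <-.
  rewrite ef /lam rmorph_sum raddf_sum /=.
  have E (l : 'I_N) : (gpoint (u l *: 'X_l))@_U_(k)
      = if l./2 == k then ratr (u l) * zc l else 0.
    have lt : (l./2 < h)%N by rewrite ltn_half_double ltn_ord.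
    rewrite gpointZ gpointX (mvarE algC (Ordinal lt)) !mcoeffZ mcoeffX mnm1_inj_eq -val_eqE /=.
    by case: eqP => _; rewrite ?mulr1 ?mulr0.
  under eq_bigr do rewrite E.
  have ne : i1 != i0 by rewrite -val_eqE /= gtn_eqF.
  rewrite (bigD1 i0) //= doubleK eqxx (bigD1 i1) //= uphalf_double eqxx.
  rewrite big1 ?addr0 => [|l /andP[l0 l1]]; last first.
    case: eqP => // el; case/negP: l0; apply/eqP/val_inj => /=.
    have := odd_double_half l; rewrite el; case ol: (odd l) => /= e; last by rewrite -e.
    by case/negP: l1; apply/eqP/val_inj; rewrite /= -e.
  by rewrite /zc /= odd_double /= mulr1.
have [u0 u1] := rat_i_combination e0.
have := odd_double_half i; case oi: (odd i) => /= e.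
  by have -> : i = i1 by apply: val_inj; rewrite /= -[LHS]e add1n.
by have -> : i = i0 by apply: val_inj; rewrite /= -[LHS]e add0n.
Qed.

(** The linear forms [y = J x]: each is ['i] times [x] at the generic point. *)
Definition yvar (k : nat) : S := if odd k then mvar rat N k.-1 else - mvar rat N k.+1.
Definition yop (k : nat) (f : S) : S := yvar k * f.

Lemma yop_linear k : linear (yop k).
Proof. by move=> a u v; rewrite /yop mulrDr scalerAr. Qed.

Lemma even_lt k : odd k = false -> (k < N)%N -> (k.+1 < N)%N.
Proof.
move=> ev lt; rewrite ltn_neqAle lt andbT; apply/eqP => e.
by have := odd_double h; rewrite -e oddS ev.
Qed.

Lemma gpoint_yvar k : (k < N)%N -> gpoint (yvar k) = 'i *: gpoint (mvar rat N k).
Proof.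
move=> lt; rewrite /yvar (gpoint_mvar lt) scalerA; case ok: (odd k).
  rewrite (gpoint_mvar (leq_ltn_trans (leq_pred k) lt)) /zc ok mulr1.
  case: k ok {lt} => // k /= /negbTE ev.
  by rewrite ev uphalf_half ev.
rewrite rmorphN /= (gpoint_mvar (even_lt ok lt)) /zc oddS ok /= scale1r uphalf_half ok add0n.
by rewrite -expr2 sqr_i scaleN1r.
Qed.

Definition econst (c : V) : S := c%:MP.
Lemma econst_linear : linear econst.
Proof. by move=> a u v; rewrite /econst mpolyCD mpolyCM mul_mpolyC. Qed.

Definition koszul_form i (eta : kos V N i.+3) : kos S N i.+1 :=
  kD (@xop rat N) (kD yop (kmap econst eta)).

Lemma koszul_form_linear i : linear (@koszul_form i).
Proof.
move=> a u v; rewrite /koszul_form (kmap_linear econst_linear).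
by rewrite (kD_linear yop_linear) (kD_linear (@xop_linear _ _)).
Qed.

(** At the generic point [y = i x], so the coefficients become those of a double
    contraction with [x]. *)
Lemma koszul_form_cycle i (eta : kos V N i.+3) :
  kcyc (@xop rat N) (ideal_strand (conj_prime h) 2) (koszul_form eta).
Proof.
split; last first.
  exact: (kDkD (@xop_linear _ _) (@xopC _ _)).
have mulh (f g : S) d : f \is 1.-homog -> g \is d.-homog -> f * g \is d.+1.-homog.
  by move=> hf hg; have := dhomogM hf hg.
have h2 : kall (fun f : S => f \is 2.-homog) (koszul_form eta).
  apply: (kall_kD (P := fun f => f \is 1.-homog)) => [k u hu| |].
  - by apply: mulh hu; exact: mvar_homog.
  - exact: homog_subspace.
  apply: (kall_kD (P := fun f => f \is 0.-homog)) => [k u hu| |].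
  - apply: mulh hu; rewrite /yvar; case: ifP => _; rewrite ?rpredN; exact: mvar_homog.
  - exact: homog_subspace.
  apply: (kall_map (P := fun=> True)) (kallT _) => c _.
  apply/dhomogP => m; rewrite msuppC; case: eqP => // _; rewrite inE => /eqP ->; exact: mdeg0.
pose px k (v : P) : P := gpoint (mvar rat N k) * v.
have pxL k : linear (px k) by move=> a u v; rewrite /px mulrDr scalerAr.
have gD : {morph @gpoint h : u v / u + v} by exact: rmorphD.
have e0 : kmap (@gpoint h) (koszul_form eta) = 0.
  rewrite /koszul_form (kmap_kD (y := px)) //; last by move=> k u _; exact: rmorphM.
  rewrite (kmap_kD (y := fun k u => 'i *: px k u)) //; last first.
    by move=> k u lt; rewrite /yop rmorphM /= (gpoint_yvar lt) -scalerAl.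
  rewrite kD_scale (kDZ pxL).
  by rewrite (kDkD pxL) ?scaler0 // => k l u; rewrite /px mulrCA.
apply: kall_sub (kall_and_map0 h2 e0) => f [hf pf]; split=> //.
by rewrite mem_conj_prime pf.
Qed.

Lemma conj_prime_boundary i (z : kos S N i.+1) :
  kbnd (@xop rat N) (ideal_strand (conj_prime h) 1) z -> z = 0.
Proof.
move=> [w hw ->]; have -> : w = 0; last exact: (kD0 (@xop_linear _ _)).
rewrite -[w]kmap_id (kmap_eq (g := fun=> 0) _ hw); first exact: kmap_zero.
by move=> f [hf hf1]; exact: conj_prime_linear.
Qed.

(** Evaluate the coefficients at all rational points. *)
Lemma koszul_form_pure i (eta : kos V N i.+3) : koszul_form eta = 0 -> pure (n := N) eta.
Proof.
move=> e w; pose ev : S -> V := mmap idfun (fun l => w l).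
have evX k : (k < N)%N -> ev (mvar rat N k) = w k.
  by move=> lt; rewrite (mvarE rat (Ordinal lt)) /ev mmapX mmap1U.
have evM f g : ev (f * g) = ev f * ev g by exact: rmorphM.
have evD f g : ev (f + g) = ev f + ev g by exact: rmorphD.
have evJ k : (k < N)%N -> ev (yvar k) = Jw w k.
  move=> lt; rewrite /yvar /Jw; case ok: (odd k).
    by rewrite evX // (leq_ltn_trans (leq_pred k) lt).
  by rewrite /ev mmapN -/(ev _) evX //; exact: even_lt.
have := congr1 (@kmap _ _ S V ev N i.+1) e; rewrite /koszul_form.
rewrite (kmap_kD (y := wop w)) //; last by move=> k u lt; rewrite evM evX.
rewrite (kmap_kD (y := wop (Jw w))) //; last by move=> k u lt; rewrite evM evJ.
rewrite kmap_comp (kmap_eq (g := id) (P := fun=> True)) ?kmap_id; first 1 last.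
- by move=> c _; rewrite /= /ev mmapC.
- exact: kallT.
by move=> ->; apply: kmap0; exact: mmap0.
Qed.

Lemma conj_prime_lower i D :
  qdim_le (kcyc (@xop rat N) (ideal_strand (conj_prime h) 2) (m := N) (j := i))
          (kbnd (@xop rat N) (ideal_strand (conj_prime h) 1) (m := N) (j := i)) D ->
  ('C(2 * h, i + 2) <= D + 2 * 'C(h, i + 2))%N.
Proof.
move=> hD; rewrite mul2n addn2.
have s1 : subspace (ideal_strand (conj_prime h) 1).
  have [[p0 _ pD] _] := conj_prime_prime h; split=> [|a u v [hu hu'] [hv hv']].
    by split; [|exact: rpred0].
  split; last exact: (homog_subspace _ _ 1).2.
  by rewrite -mul_mpolyC; exact: pD.
apply: (@qdim_ge_kos rat N i.+2).
apply: (qdim_le_filter (koszul_form_linear (i := i)) _ _ hD).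
- by split.
- by move=> z _; exact: koszul_form_cycle.
apply: (qdim_le_sub _ _ _ (@pure_bound rat h i.+1)) => //.
- by move=> z [_ /conj_prime_boundary]; exact: koszul_form_pure.
have [B0 BD] := @kbnd_subspace _ _ (@xop rat N) _ N i (@xop_linear _ _) s1.
have L := koszul_form_linear (i := i); split; first by rewrite (lin0 L).
by move=> a u v [_ hu] [_ hv]; split=> //; rewrite L; exact: BD.
Qed.
End LowerBound.

Theorem theorem2 (h : nat) (h_ge1 : (1 <= h)%N) :
  (exists (K : fieldType) (N : nat) (p : {pred {mpoly K[N]}}),
     [/\ homogeneous_ideal p,
         prime_ideal p,
         height p h
       & forall i : nat,
           (betti p i (i + 2)%N%:Z)%:Z
             = 'C(2 * h, i + 2)%:Z - 2 * 'C(h, i + 2)%:Z])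
  /\
  (forall (K : fieldType) (N : nat) (I : {pred {mpoly K[N]}}),
     idealr_closed I ->
     homogeneous_ideal I ->
     unmixed I ->
     radical_ideal I ->
     height I h ->
     forall i : nat,
       (betti I i (i + 2)%N%:Z)%:Z
         <= 'C(2 * h, i + 2)%:Z - 2 * 'C(h, i + 2)%:Z).
Proof.
have le i : (2 * 'C(h, i + 2) <= 'C(2 * h, i + 2))%N.
  by have := strand_bound_double h i; rewrite !addn2; lia.
have cast i b : (b <= 'C(2 * h, i + 2) - 2 * 'C(h, i + 2))%N ->
    b%:Z <= 'C(2 * h, i + 2)%:Z - 2 * 'C(h, i + 2)%:Z.
  by have := le i; lia.
split; last by move=> K N I *; apply: cast; exact: betti_upper_bound.
have hp := conj_prime_prime h; have hh := @conj_prime_homog h.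
exists rat, h.*2, (conj_prime h); split=> // [|i]; first exact: conj_prime_height.
have up := betti_upper_bound i hp.1 hh (prime_unmixed hp) (@conj_prime_radical h) (conj_prime_height h).
have [F eF] := betti_tor_dim i (i + 2)%N%:Z hp.1 hh.
have lo := conj_prime_lower ((tor_dim_koszul F i _).2 (leqnn _)).
by move: up lo (le i); rewrite eF; lia.
Qed.
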